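(* Let $b=\nu_\ell([G:B])$. If $0<c<b$, then $\mathrm{soc}(T^c)$, where $T^c=I(c)/\ell I(c)$, contains copies of the non-isomorphic irreducible $KG$-modules $M(b)=L(b)$ and $M(0)=L(0)/L(1)$. In particular, $\mathrm{soc}(T^c)$ is not irreducible.
   Context: Let $n\ge 2$ and $G=\mathrm{GL}_n(q)$, the general linear group over the finite field $F_q$ of characteristic $p$. Let $\ell\ne p$ be a prime, and let $R$ be a local principal ideal domain of characteristic $0$ with maximal ideal $\ell R$, containing a primitive $p$-th root of unity; $K=R/\ell R$. Modules are left modules. $\nu_\ell$ denotes the $\ell$-adic valuation of integers. $B$ is the group of upper triangular matrices in $G$; $S_n$ is viewed as the subgroup of permutation matrices of $G$; $\widehat{S}=\sum_{s\in S}s\in RG$ for $S\subseteq G$. Put $\varepsilon=\sum_{\sigma\in S_n}\mathrm{sg}(\sigma)\,\sigma\widehat{B}\in RG$. The Steinberg lattice is the left ideal $I=RG\cdot\varepsilon$, and $L=I/\ell I$, a $KG$-module. Let $f:I\times I\to R$ be the restriction to $I$ of the $R$-bilinear form on $RG$ given by $(g,h)\mapsto\delta_{g,h}$ for $g,h\in G$, scaled by $1/|B|$ (it takes values in $R$). For $c\ge 0$ put $I(c)=\{x\in I : f(x,I)\subseteq \ell^cR\}$, $L(c)=(I(c)+\ell I)/\ell I$ and $M(c)=L(c)/L(c+1)$. One has $L(b+1)=0$. *)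

(* Defs.v *)
From HB Require Import structures.
From mathcomp Require Import all_boot all_order all_algebra all_fingroup.
From mathcomp Require Import boolp.

Set Implicit Arguments.
Unset Strict Implicit.
Unset Printing Implicit Defensive.

Import GRing.Theory.
Local Open Scope ring_scope.
Local Open Scope quotient_scope.

Section Submodules.
Variables (A : pzRingType) (V : lmodType A).

Record submod (W : submodClosed V) : predArgType :=
  Submod { submod_val : V; submod_valP : submod_val \in W }.

Variable W : submodClosed V.

HB.instance Definition _ := [isSub of submod W for @submod_val W].
HB.instance Definition _ := [Choice of submod W by <:].
HB.instance Definition _ := [SubChoice_isSubLmodule of submod W by <:].

End Submodules.

Section QuotientModule.
Variables (A : pzRingType) (V : lmodType A) (W : submodClosed V).

(* MathComp does not infer closure under opposites from submodClosed. *)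
Definition submod_mem : {pred V} := fun v => v \in W.

Lemma submod_mem_zmod : zmod_closed submod_mem.
Proof. exact: (submodClosedP W). Qed.
HB.instance Definition _ := GRing.isZmodClosed.Build V submod_mem submod_mem_zmod.

Definition modquot := Quotient.quot submod_mem.
HB.instance Definition _ := GRing.Zmodule.on modquot.

Definition modquot_pi (v : V) : modquot := \pi_(Quotient.quot submod_mem) v.

Lemma modquot_piD : {morph modquot_pi : u v / u + v}.
Proof. by move=> u v; rewrite /modquot_pi raddfD. Qed.

Definition modquot_repr (x : modquot) : V := generic_quotient.repr (x : Quotient.quot submod_mem).

Lemma modquot_reprK : cancel modquot_repr modquot_pi.
Proof. by move=> x; rewrite /modquot_pi reprK. Qed.

Lemma modquot_eqP u v : (modquot_pi u = modquot_pi v) <-> (u - v \in W).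
Proof. by rewrite -[_ \in W]/(u - v \in submod_mem) Quotient.idealrBE; split=> /eqP. Qed.

Definition modquot_scale (a : A) (x : modquot) : modquot :=
  modquot_pi (a *: modquot_repr x).

Lemma modquot_scaleE a v : modquot_scale a (modquot_pi v) = modquot_pi (a *: v).
Proof.
apply/modquot_eqP; rewrite -scalerBr; apply: rpredZ.
by apply/modquot_eqP; rewrite modquot_reprK.
Qed.

Lemma modquot_scalerA a b x :
  modquot_scale a (modquot_scale b x) = modquot_scale (a * b) x.
Proof. by rewrite -(modquot_reprK x) !modquot_scaleE scalerA. Qed.

Lemma modquot_scale1r : left_id 1 modquot_scale.
Proof. by move=> x; rewrite -(modquot_reprK x) modquot_scaleE scale1r. Qed.

Lemma modquot_scalerDr : right_distributive modquot_scale +%R.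
Proof.
move=> a x y; rewrite -(modquot_reprK x) -(modquot_reprK y) -modquot_piD.
by rewrite !modquot_scaleE -modquot_piD scalerDr.
Qed.

Lemma modquot_scalerDl x : {morph modquot_scale^~ x : a b / a + b}.
Proof.
move=> a b; rewrite -(modquot_reprK x) !modquot_scaleE -modquot_piD.
by rewrite scalerDl.
Qed.

HB.instance Definition _ := GRing.Zmodule_isLmodule.Build A modquot
  modquot_scalerA modquot_scale1r modquot_scalerDr modquot_scalerDl.

End QuotientModule.

Section LeftIdeal.
Variables (A : pzRingType) (a : A).

Definition lideal : {pred A^o} := fun x => `[< exists r : A, (x : A) = r * a >].

Lemma lideal_submod : submod_closed lideal.
Proof.
split=> [|r x y /asboolP[s xE] /asboolP[t yE]]; apply/asboolP.
  by exists 0; rewrite mul0r.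
by exists (r * s + t); rewrite mulrDl -mulrA -xE -yE.
Qed.
HB.instance Definition _ := GRing.isSubmodClosed.Build A A^o lideal lideal_submod.

End LeftIdeal.

Section ModuleNotions.
Variable A : pzRingType.

Definition irreducible_mod (V : lmodType A) : Prop :=
  (exists v : V, v != 0) /\
  (forall W : submodClosed V,
     (forall v, v \in W -> v = 0) \/ (forall v, v \in W)).

Definition isomorphic_mod (V V' : lmodType A) : Prop :=
  exists h : {linear V -> V'}, bijective h.

Definition contains_copy (M V : lmodType A) (W : submodClosed V) : Prop :=
  exists h : {linear M -> V}, injective h /\ (forall x, h x \in W).

Definition socle (V : lmodType A) : {pred V} := fun x =>
  `[< exists s : seq V, x = \sum_(v <- s) v /\
        (forall v, v \in s ->
           exists W : submodClosed V, irreducible_mod (submod W) /\ v \in W) >].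

Lemma socle_submod (V : lmodType A) : submod_closed (@socle V).
Proof.
split=> [|a x y /asboolP[s [-> sP]] /asboolP[t [-> tP]]]; apply/asboolP.
  by exists [::]; rewrite big_nil.
exists ([seq a *: v | v <- s] ++ t).
rewrite big_cat big_map scaler_sumr; split=> // v.
rewrite mem_cat => /orP[/mapP[w /sP[W [irrW wW]] ->]|/tP //].
by exists W; split=> //; apply: rpredZ.
Qed.
HB.instance Definition _ (V : lmodType A) :=
  GRing.isSubmodClosed.Build A V (@socle V) (@socle_submod V).

End ModuleNotions.

Definition is_pid (R : idomainType) : Prop :=
  forall J : submodClosed R^o, exists a : R, J =i lideal a.

Definition maximal_ideal (R : comPzRingType) (J : submodClosed R^o) : Prop :=
  (1 : R^o) \notin J /\
  (forall J' : submodClosed R^o, {subset J <= J'} ->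
     J' =i J \/ (forall x, x \in J')).

Definition local_with_maximal_ideal (R : comPzRingType) (M : submodClosed R^o) :=
  forall J : submodClosed R^o, maximal_ideal J <-> J =i M.

Section ResidueRing.
Variables (R : comPzRingType) (a : R).

(* The ring R / aR. The quotient rings of mathcomp.ring_quotient require a
   proof that the ideal is proper, hence this construction, without one. *)
Definition residue := modquot (lideal a).
HB.instance Definition _ := GRing.Zmodule.on residue.

Definition residue_pi (x : R) : residue := modquot_pi (lideal a) x.

Lemma residue_piD : {morph residue_pi : x y / x + y}.
Proof. exact: (modquot_piD (lideal a)). Qed.

Lemma residue_pi0 : residue_pi 0 = 0.
Proof. by apply: (addrI (residue_pi 0)); rewrite -residue_piD !addr0. Qed.

Definition residue_repr (x : residue) : R := modquot_repr x.

Lemma residue_reprK : cancel residue_repr residue_pi.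
Proof. exact: (modquot_reprK (W := lideal a)). Qed.

Lemma residue_eqP x y : (residue_pi x = residue_pi y) <-> (exists r, x - y = r * a).
Proof.
by split=> [/modquot_eqP/asboolP|xy] //; apply/modquot_eqP/asboolP.
Qed.

Definition residue_one := residue_pi 1.
Definition residue_mul x y := residue_pi (residue_repr x * residue_repr y).

Lemma residue_piM x y : residue_mul (residue_pi x) (residue_pi y) = residue_pi (x * y).
Proof.
apply/residue_eqP.
have /residue_eqP[r] := residue_reprK (residue_pi x).
have /residue_eqP[s] := residue_reprK (residue_pi y).
move: (residue_repr _) => y' /(canRL (subrK _)) ->.
move: (residue_repr _) => x' /(canRL (subrK _)) ->.
exists (r * (s * a + y) + x * s).
by rewrite mulrDl [x * (_ + y)]mulrDr addrA addrK mulrDl mulrAC mulrA.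
Qed.

Lemma residue_mulA : associative residue_mul.
Proof.
move=> x y z; rewrite -(residue_reprK x) -(residue_reprK y) -(residue_reprK z).
by rewrite !residue_piM mulrA.
Qed.

Lemma residue_mulC : commutative residue_mul.
Proof. by move=> x y; rewrite /residue_mul mulrC. Qed.

Lemma residue_mul1 : left_id residue_one residue_mul.
Proof. by move=> x; rewrite -(residue_reprK x) residue_piM mul1r. Qed.

Lemma residue_mulDl : left_distributive residue_mul +%R.
Proof.
move=> x y z; rewrite -(residue_reprK x) -(residue_reprK y) -(residue_reprK z).
by rewrite -residue_piD !residue_piM -residue_piD mulrDl.
Qed.

HB.instance Definition _ := GRing.Zmodule_isComPzRing.Build residue
  residue_mulA residue_mulC residue_mul1 residue_mulDl.

End ResidueRing.

Section GroupAlgebra.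
Variables (R : pzRingType) (gT : finGroupType).

(* x g is the coefficient of x at g; an alias of {ffun gT -> R}, because the
   latter has the pointwise product. *)
Definition grpalg := {ffun gT -> R}.
HB.instance Definition _ := GRing.Zmodule.on grpalg.

Definition coeff (x : grpalg) (g : gT) : R := x g.

Definition grpalg_one : grpalg := [ffun g => (g == 1%g)%:R].
Definition grpalg_mul (x y : grpalg) : grpalg :=
  [ffun g => \sum_(h : gT) x h * y (h^-1 * g)%g].

Lemma grpalg_mulA : associative grpalg_mul.
Proof.
move=> x y z; apply/ffunP=> g; rewrite !ffunE.
under eq_bigr => h _ do rewrite ffunE mulr_sumr.
under [RHS]eq_bigr => k _ do rewrite ffunE mulr_suml.
rewrite [RHS]exchange_big /=; apply: eq_bigr => h _.
rewrite (reindex_inj (mulgI h^-1%g)) /=; apply: eq_bigr => k _.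
by rewrite mulrA invMg invgK !mulgA mulgK.
Qed.

Lemma grpalg_mul1 : left_id grpalg_one grpalg_mul.
Proof.
move=> x; apply/ffunP=> g; rewrite ffunE (bigD1 1%g) //= ffunE eqxx mul1r.
rewrite invg1 mul1g big1 ?addr0 // => h /negPf h1.
by rewrite ffunE h1 mul0r.
Qed.

Lemma grpalg_mulr1 : right_id grpalg_one grpalg_mul.
Proof.
move=> x; apply/ffunP=> g; rewrite ffunE (bigD1 g) //= ffunE mulVg eqxx mulr1.
rewrite big1 ?addr0 // => h /negPf hg.
by rewrite ffunE -eq_mulVg1 hg mulr0.
Qed.

Lemma grpalg_mulDl : left_distributive grpalg_mul +%R.
Proof.
move=> x y z; apply/ffunP=> g; rewrite !ffunE -big_split /=.
by apply: eq_bigr => h _; rewrite ffunE mulrDl.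
Qed.

Lemma grpalg_mulDr : right_distributive grpalg_mul +%R.
Proof.
move=> x y z; apply/ffunP=> g; rewrite !ffunE -big_split /=.
by apply: eq_bigr => h _; rewrite ffunE mulrDr.
Qed.

HB.instance Definition _ := GRing.Zmodule_isPzRing.Build grpalg
  grpalg_mulA grpalg_mul1 grpalg_mulr1 grpalg_mulDl grpalg_mulDr.

Definition gelt (g : gT) : grpalg := [ffun h => (h == g)%:R].
Definition hatsum (S : {set gT}) : grpalg := \sum_(g in S) gelt g.

End GroupAlgebra.

Section Reduction.
Variables (R : comPzRingType) (gT : finGroupType) (l : nat).
Variable V : lmodType (grpalg R gT).

Definition multiples : {pred V} := fun v => `[< exists w : V, v = w *+ l >].

Lemma multiples_submod : submod_closed multiples.
Proof.
split=> [|r x y /asboolP[s ->] /asboolP[t ->]]; apply/asboolP.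
  by exists 0; rewrite mul0rn.
by exists (r *: s + t); rewrite mulrnDl scalerMnr.
Qed.
HB.instance Definition _ :=
  GRing.isSubmodClosed.Build (grpalg R gT) V multiples multiples_submod.

Let K := residue (l%:R : R).
Let KG := grpalg K gT.

(* V / lV as a left module over (R / lR)G: an element of (R / lR)G acts through
   any of its lifts to RG; see reduction_scaleE. *)
Definition reduction := modquot multiples.
HB.instance Definition _ := GRing.Zmodule.on reduction.

Definition reduction_pi (v : V) : reduction := modquot_pi multiples v.

Definition grpalg_red (x : grpalg R gT) : KG := [ffun g => residue_pi l%:R (x g)].
Definition grpalg_lift (x : KG) : grpalg R gT := [ffun g => residue_repr (x g)].

Definition reduction_scale (x : KG) (v : reduction) : reduction :=
  (grpalg_lift x *: (v : modquot multiples)).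

Lemma grpalg_liftK : cancel grpalg_lift grpalg_red.
Proof. by move=> x; apply/ffunP=> g; rewrite !ffunE residue_reprK. Qed.

Lemma reduction_scaleE (x : grpalg R gT) (v : V) :
  reduction_scale (grpalg_red x) (reduction_pi v) = reduction_pi (x *: v).
Proof.
rewrite /reduction_scale /reduction_pi.
have -> : forall y, y *: modquot_pi multiples v = modquot_pi multiples (y *: v).
  exact: (fun y => modquot_scaleE multiples y v).
apply/modquot_eqP; rewrite -scalerBl; apply/asboolP.
have /all_sig[r rP] : forall g, {r | grpalg_lift (grpalg_red x) g - x g = r * l%:R}.
  move=> g; apply: cid; apply/residue_eqP.
  by rewrite ffunE residue_reprK ffunE.
exists (([ffun g => r g] : grpalg R gT) *: v).
rewrite scalerMnl; congr (_ *: _); apply/ffunP=> g.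
by rewrite [RHS]ffunMnE [in RHS]ffunE -[RHS]mulr_natr -rP !ffunE.
Qed.

Lemma grpalg_redD : {morph grpalg_red : x y / x + y}.
Proof. by move=> x y; apply/ffunP=> g; rewrite !ffunE residue_piD. Qed.

Lemma residue_pi_sum (a : R) (I : finType) (F : I -> R) :
  residue_pi a (\sum_i F i) = \sum_i residue_pi a (F i).
Proof.
exact: (big_morph _ (@residue_piD _ a) (residue_pi0 a)).
Qed.

Lemma grpalg_redM : {morph grpalg_red : x y / x * y}.
Proof.
move=> x y; apply/ffunP=> g; rewrite !ffunE residue_pi_sum.
by apply: eq_bigr => h _; rewrite !ffunE -residue_piM.
Qed.

Lemma grpalg_red1 : grpalg_red 1 = 1.
Proof.
apply/ffunP=> g; rewrite !ffunE; case: eqP => _ //=.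
exact: residue_pi0.
Qed.

Lemma reduction_scalerA a b x :
  reduction_scale a (reduction_scale b x) = reduction_scale (a * b) x.
Proof.
rewrite -(grpalg_liftK a) -(grpalg_liftK b) -(modquot_reprK x).
rewrite -grpalg_redM (reduction_scaleE (grpalg_lift b)).
by rewrite (reduction_scaleE (grpalg_lift a)) (reduction_scaleE (_ * _)) scalerA.
Qed.

Lemma reduction_scale1r : left_id 1 reduction_scale.
Proof.
move=> x; rewrite -(modquot_reprK x) -grpalg_red1.
by rewrite reduction_scaleE scale1r.
Qed.

Lemma reduction_scalerDr : right_distributive reduction_scale +%R.
Proof. by move=> a x y; rewrite /reduction_scale; exact: scalerDr. Qed.

Lemma reduction_scalerDl x : {morph reduction_scale^~ x : a b / a + b}.
Proof.
move=> a b; rewrite -(grpalg_liftK a) -(grpalg_liftK b) -(modquot_reprK x).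
rewrite -grpalg_redD (reduction_scaleE (_ + _)) (reduction_scaleE (grpalg_lift a)).
rewrite (reduction_scaleE (grpalg_lift b)) scalerDl.
exact: modquot_piD.
Qed.

HB.instance Definition _ := GRing.Zmodule_isLmodule.Build KG reduction
  reduction_scalerA reduction_scale1r reduction_scalerDr reduction_scalerDl.

End Reduction.

Section Steinberg.
Variables (n : nat) (F : finFieldType).

(* is_trig_mx means lower triangular. *)
Definition borel_set : {set {'GL_n[F]}} := [set g | is_trig_mx (GLval g)^T].

Lemma borel_group_set : group_set borel_set.
Proof.
apply/group_setP; split=> [|g h].
  by rewrite inE; apply/is_trig_mxP=> i j ij; rewrite mxE GL_1E mxE -val_eqE gtn_eqF.
rewrite !inE => /is_trig_mxP gT /is_trig_mxP hT; apply/is_trig_mxP=> i j ij.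
rewrite !mxE big1 // => k _.
have [kj|jk] := ltnP k j.
  by have := gT k j kj; rewrite mxE => ->; rewrite mul0r.
by have := hT i k (leq_trans ij jk); rewrite mxE => ->; rewrite mulr0.
Qed.

Definition borel : {group {'GL_n[F]}} := Group borel_group_set.

Definition perm_GL (s : 'S_n.-1.+1) : {'GL_n[F]} :=
  FinRing.Unit (unitmx_perm F s).

Variable R : idomainType.
Let RG := grpalg R {'GL_n[F]}.

Definition steinberg_elt : RG :=
  \sum_(s : 'S_n.-1.+1) (-1) ^+ s * (gelt R (perm_GL s) * hatsum R borel).

Definition steinberg_lattice : submodClosed RG^o := lideal steinberg_elt.

(* The bilinear form with (g, h) |-> delta_{g,h} / |B| on G x G. It is defined
   on the whole of RG with values in the fraction field of R, where |B| is
   invertible; its values on I x I are in R. *)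
Definition form (x y : RG) : {fraction R} :=
  FracField.tofrac (\sum_(g : {'GL_n[F]}) coeff x g * coeff y g)
    / #|borel|%:R.

Variable l : nat.

(* I(c), as a left ideal of RG contained in I. *)
Definition latt_filt (c : nat) : {pred RG^o} := fun x =>
  (x \in steinberg_lattice) &&
  `[< forall y : RG, y \in steinberg_lattice ->
        exists r : R, form x y = FracField.tofrac (l%:R ^+ c * r) >].

Definition adjoint (a : RG) : RG := [ffun g => a g^-1%g].

Lemma form_adj (a x y : RG) : form (a * x) y = form x (adjoint a * y).
Proof.
rewrite /form; congr (FracField.tofrac _ / _); rewrite /coeff.
under eq_bigr => g _ do rewrite ffunE mulr_suml.
rewrite exchange_big /=.
under [RHS]eq_bigr => g _ do rewrite ffunE mulr_sumr.
rewrite [RHS]exchange_big /= [RHS](reindex_inj invg_inj) /=.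
apply: eq_bigr => h _; rewrite (reindex_inj (mulgI h)) /=.
apply: eq_bigr => g _; rewrite ffunE invgK mulKg.
by rewrite mulrCA mulrA.
Qed.

Lemma formDl (x x' y : RG) : form (x + x') y = form x y + form x' y.
Proof.
rewrite /form -mulrDl -rmorphD -big_split /=.
by congr (FracField.tofrac _ / _); apply: eq_bigr => g _; rewrite /coeff ffunE mulrDl.
Qed.

Lemma latt_filt_submod c : submod_closed (latt_filt c).
Proof.
split=> [|a x y /andP[xI /asboolP xP] /andP[yI /asboolP yP]]; apply/andP.
  split; first exact: rpred0.
  apply/asboolP=> y _; exists 0; rewrite mulr0 /form big1 ?rmorph0 ?mul0r //.
  by move=> g _; rewrite /coeff ffunE mul0r.
split; first by rewrite rpredD ?rpredZ.
apply/asboolP=> z zI; rewrite formDl [a *: x]/(a * x : RG) form_adj.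
have [|r ->] := xP (adjoint a * z); first exact: (rpredZ (s := steinberg_lattice) (adjoint a) zI).
by have [s ->] := yP z zI; exists (r + s); rewrite -rmorphD mulrDr.
Qed.
HB.instance Definition _ c :=
  GRing.isSubmodClosed.Build RG RG^o (latt_filt c) (latt_filt_submod c).

(* L = I / lI, a module over (R / lR)G. *)
Definition steinberg_red := reduction l (submod steinberg_lattice).

(* L(c) = (I(c) + lI) / lI, as a submodule of L. *)
Definition red_filt (c : nat) : {pred steinberg_red} := fun u =>
  `[< exists x y : submod steinberg_lattice,
        submod_val x \in latt_filt c /\ u = reduction_pi l (x + y *+ l) >].

Lemma red_filt_submod c : submod_closed (red_filt c).
Proof.
split=> [|a _ _ /asboolP[x [y [xc ->]]] /asboolP[x' [y' [xc' ->]]]]; apply/asboolP.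
  exists 0, 0; split; first exact: (rpred0 (latt_filt c)).
  by rewrite mul0rn addr0; apply/esym/(raddf0 (\pi_(Quotient.quot _))).
exists (grpalg_lift a *: x + x'), (grpalg_lift a *: y + y'); split.
  by rewrite [submod_val _]/(grpalg_lift a *: submod_val x + submod_val x')
     rpredD ?rpredZ.
rewrite -[a in LHS]grpalg_liftK [_ *: _]reduction_scaleE.
rewrite -[LHS]modquot_piD; congr (reduction_pi _ _).
by rewrite scalerDr -scalerMnr mulrnDl addrACA.
Qed.
HB.instance Definition _ c :=
  GRing.isSubmodClosed.Build _ steinberg_red (red_filt c) (red_filt_submod c).

Definition Lmod (c : nat) := submod (red_filt c).

Definition red_filt_next (c : nat) : {pred Lmod c} :=
  fun u => submod_val u \in red_filt c.+1.

Lemma red_filt_next_submod c : submod_closed (@red_filt_next c).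
Proof.
split=> [|a x y xP yP]; first exact: (rpred0 (red_filt c.+1)).
by rewrite /in_mem /= /red_filt_next rpredD ?rpredZ.
Qed.
HB.instance Definition _ c :=
  GRing.isSubmodClosed.Build _ (Lmod c) (@red_filt_next c) (@red_filt_next_submod c).

(* M(c) = L(c) / L(c + 1) *)
Definition Mmod (c : nat) := modquot (@red_filt_next c).

(* T^c = I(c) / l I(c) *)
Definition Tmod (c : nat) := reduction l (submod (latt_filt c)).

End Steinberg.

(* Main.v *)
Require Import Defs.
From HB Require Import structures.
From mathcomp Require Import all_boot all_order all_algebra all_fingroup.
From mathcomp Require Import all_solvable.
From mathcomp Require Import boolp.
From mathcomp Require Import zify ring.

Set Implicit Arguments.
Unset Strict Implicit.
Unset Printing Implicit Defensive.

Import GRing.Theory.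
Local Open Scope ring_scope.

(** The lattice I lives on the chambers g B of the building of GL_n(F), and it is
    the lattice of cycles: functions whose sum over every panel vanishes. A cycle
    that vanishes on the big cell U w0 B is zero, by downward induction along the
    Bruhat cells, so the translates u eps with u in the unitriangular group U are
    a basis of I whose coordinates are the values on the big cell. Consequently
    the sum of the translates of any x in I over U is x(1) Ufix, where Ufix is the
    sum of the u eps. This has two consequences.

    First, every left ideal that contains l I and is not contained in l I contains
    Ufix, so Ufix generates the unique minimal submodule of L. Second, pairing with
    g Ufix is evaluation at g up to a constant; a trace computation shows that the
    constant is the index of B (sform_Ufix). Hence Ufix lies in I(b), I(b + 1) is
    contained in l I, and I(b) is generated by Ufix modulo l I (jantzen_top), as
    functionals on I are combinations of evaluations. So M(b) = L(b) is the
    irreducible socle of L.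

    The head is governed by nondegenerate characters of U. For a set S of simple
    roots, whit S is a multiple of the projection onto the characters of U that are
    nontrivial exactly on the root groups of S. The image of I under whit S is
    spanned by the U-translates of whit S eps, and the torus permutes the
    characters of the given type transitively, so a left ideal containing l I and
    some x with whit S x not in l I contains whit S eps (whit_in). The main point
    is that the nondegenerate vector whit setT eps generates I modulo l
    (generation). Conjugating by the permutation that reverses the order of the
    blocks of S produces from it an element with nonzero projection under whit S
    (whit_transfer); therefore all whit S eps are obtained, and so is their sum,
    a multiple by a power of q of the sum of eps over the derived group of U.
    Finally a left ideal containing l I and all sums over the derived group
    contains everything (descent), by removing one root group after another with
    the help of the q + 1 lines of a plane.

    Since whit setT is self-adjoint for the form, an element outside I(1) has a
    translate with nonzero nondegenerate projection, and so generates I modulo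
    I(1): M(0) is irreducible (head_cyclic). It is not isomorphic to M(b), because
    whit setT kills M(b), which comes from I(1), but not M(0).

    For 0 < c < b the inclusion of I(b) in I(c) induces an embedding of M(b) in
    T^c, as I(b) meets l I in l I(b - 1), and multiplication by l ^ c induces an
    embedding of M(0), as l ^ c x lies in l I(c) exactly when x lies in I(1). Two
    non-isomorphic irreducible submodules cannot both fill the socle.

    Orders of p-groups are prime to l, so they are invertible modulo l because the
    ideal generated by l is maximal. *)

(** * General linear groups as abstract finite groups *)

Section Interface.
Variables (n : nat) (F : finFieldType).

(** A name for the group that stays folded: unification then never enumerates
    the invertible matrices when it compares two coefficient functions on them. *)
Definition GLn : finGroupType := {'GL_n[F]}.
Definition GLmx (g : GLn) : 'M[F]_n.-1.+1 := GLval g.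
Definition GLborel : {group GLn} := borel n F.
Definition GLperm (s : 'S_n.-1.+1) : GLn := perm_GL F s.
(** Total, with junk value 1 on singular matrices. *)
Definition GL_of_mx (A : 'M[F]_n.-1.+1) : GLn := insubd (1%g : {'GL_n[F]}) A.

Lemma GL_of_mxK A : A \in unitmx -> GLmx (GL_of_mx A) = A.
Proof. exact: insubdK. Qed.

Lemma GLmx_inj : injective GLmx.
Proof. exact: val_inj. Qed.

Lemma GLmxM (g h : GLn) : GLmx (g * h)%g = GLmx g *m GLmx h.
Proof. by []. Qed.

Lemma GLmx1 : GLmx (1%g : GLn) = 1%:M.
Proof. by []. Qed.

Lemma GLmx_unit (g : GLn) : GLmx g \in unitmx.
Proof. exact: GL_unitmx. Qed.

Lemma GLmx_perm s : GLmx (GLperm s) = perm_mx s.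
Proof. by []. Qed.

Lemma mem_GLborel g : (g \in GLborel) = is_trig_mx (GLmx g)^T.
Proof. by rewrite inE. Qed.

End Interface.
Opaque GLn GLmx GLborel GLperm GL_of_mx.

HB.lock Definition unitri_set (n : nat) (F : finFieldType) : {set GLn n F} :=
  [set g in GLborel n F | [forall i, GLmx g i i == 1]].

Section Matrices.
Variables (n : nat) (F : finFieldType).
Local Notation G := (GLn n F).
Local Notation GLmx := (@GLmx n F).
Local Notation I := 'I_n.-1.+1.
Local Notation P := (@GLperm n F).
Local Notation B := (GLborel n F).
Implicit Types (g h u v : G) (s t : 'S_n.-1.+1) (i j k a b : I) (x y : F).

Lemma GLmx_ext g h : (forall i j, GLmx g i j = GLmx h i j) -> g = h.
Proof. by move=> gh; apply: GLmx_inj; apply/matrixP. Qed.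

Lemma GLmulE g h i j : GLmx (g * h)%g i j = \sum_k GLmx g i k * GLmx h k j.
Proof. by rewrite GLmxM mxE. Qed.

Lemma GLoneE i j : GLmx (1%g : G) i j = (i == j)%:R.
Proof. by rewrite GLmx1 mxE. Qed.

Lemma GLpermE s i j : GLmx (P s) i j = (s i == j)%:R.
Proof. by rewrite GLmx_perm !mxE. Qed.

Lemma GLpermM s t : P (s * t)%g = (P s * P t)%g.
Proof. by apply: GLmx_inj; rewrite GLmxM !GLmx_perm perm_mxM. Qed.

Lemma GLperm1 : P 1%g = 1%g.
Proof. by apply: GLmx_inj; rewrite GLmx1 GLmx_perm perm_mx1. Qed.

Lemma GLpermV s : P s^-1%g = (P s)^-1%g.
Proof. by apply/eqP; rewrite eq_sym eq_invg_mul -GLpermM mulgV GLperm1. Qed.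

Lemma GLmul_perm g s i j : GLmx (g * P s)%g i j = GLmx g i (s^-1%g j).
Proof.
rewrite GLmulE (bigD1 (s^-1%g j)) //= GLpermE permKV eqxx mulr1 big1 ?addr0 // => k.
by rewrite -(inj_eq (@perm_inj _ s)) permKV GLpermE => /negPf->; rewrite mulr0.
Qed.

Lemma GLperm_mul g s i j : GLmx (P s * g)%g i j = GLmx g (s i) j.
Proof.
rewrite GLmulE (bigD1 (s i)) //= GLpermE eqxx mul1r big1 ?addr0 // => k.
by rewrite eq_sym GLpermE => /negPf->; rewrite mul0r.
Qed.

Lemma borelP g :
  reflect (forall i j, (j < i)%N -> GLmx g i j = 0) (g \in B).
Proof.
rewrite mem_GLborel; apply: (iffP is_trig_mxP) => gB i j ij; last by rewrite mxE gB.
by have := gB j i ij; rewrite mxE.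
Qed.

Lemma upper_unit (A : 'M[F]_n.-1.+1) :
  (forall i j, (j < i)%N -> A i j = 0) -> (forall i, A i i != 0) ->
  A \in unitmx.
Proof.
move=> A0 Ad; rewrite unitmxE -det_tr det_trig.
  by apply: rpred_prod => i _; rewrite mxE unitfE.
by apply/is_trig_mxP => i j ij; rewrite mxE A0.
Qed.

Lemma borel_diag g i : g \in B -> GLmx g i i != 0.
Proof.
move=> gB; have := GLmx_unit g;
  rewrite unitmxE unitfE -det_tr det_trig -?mem_GLborel //.
by move/prodf_neq0/(_ i isT); rewrite mxE.
Qed.

Lemma borel_diagM g h i : g \in B -> h \in B ->
  GLmx (g * h)%g i i = GLmx g i i * GLmx h i i.
Proof.
move=> /borelP gB /borelP hB; rewrite GLmulE (bigD1 i) //= big1 ?addr0 // => k ki.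
have [lt_ki|] := ltnP k i; first by rewrite gB ?mul0r.
by rewrite leq_eqVlt val_eqE eq_sym (negPf ki) => /hB->; rewrite mulr0.
Qed.

Lemma unitriP g : reflect
  ((forall i j, (j < i)%N -> GLmx g i j = 0) /\ forall i, GLmx g i i = 1)
  (g \in unitri_set n F).
Proof.
rewrite unitri_set.unlock inE; apply: (iffP andP) =>
  [[/borelP gB /forallP g1]|[g0 g1]].
  by split=> // i; apply/eqP.
by split; [apply/borelP | apply/forallP => i; rewrite g1].
Qed.

Lemma unitri_borel g : g \in unitri_set n F -> g \in B.
Proof. by rewrite unitri_set.unlock inE => /andP[]. Qed.

Lemma unitri_group_set : group_set (unitri_set n F).
Proof.
apply/group_setP; split=> [|g h].
  by apply/unitriP; split=> [i j ij|i]; rewrite GLoneE ?eqxx // -val_eqE gtn_eqF.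
move=> gU hU; have gB := unitri_borel gU; have hB := unitri_borel hU.
rewrite unitri_set.unlock inE groupM //=; apply/forallP=> i; rewrite borel_diagM //.
by case/unitriP: gU => _ ->; case/unitriP: hU => _ ->; rewrite mulr1.
Qed.

Definition unitri : {group G} := Group unitri_group_set.

Lemma mem_unitri g :
  (g \in unitri) = (g \in B) && [forall i, GLmx g i i == 1].
Proof. by rewrite -[LHS]/(g \in unitri_set n F) unitri_set.unlock inE. Qed.

Lemma unitri1 g i : g \in unitri -> GLmx g i i = 1.
Proof. by case/unitriP. Qed.

Lemma unitri0 g i j : g \in unitri -> (j < i)%N -> GLmx g i j = 0.
Proof. by case/unitriP => + _; apply. Qed.

Lemma unitri_of_mx (A : 'M[F]_n.-1.+1) :
  (forall i j, (j < i)%N -> A i j = 0) -> (forall i, A i i = 1) ->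
  GLmx (GL_of_mx A) = A /\ GL_of_mx A \in unitri.
Proof.
move=> A0 A1; have AE : GLmx (GL_of_mx A) = A.
  by rewrite GL_of_mxK // upper_unit // => i; rewrite A1 oner_eq0.
by split=> //; apply/unitriP; rewrite AE.
Qed.

Definition elem a b x : G := GL_of_mx (1%:M + x *: delta_mx a b).

Lemma elem_mx a b x : a != b -> GLmx (elem a b x) = 1%:M + x *: delta_mx a b.
Proof.
move=> ab; rewrite GL_of_mxK //.
have /mulmx1_unit[]// :
  (1%:M + x *: delta_mx a b) *m (1%:M - x *: delta_mx a b) = 1%:M :> 'M[F]_n.-1.+1.
rewrite mulmxDl mul1mx mulmxBr mulmx1 -scalemxAl -scalemxAr.
by rewrite mul_delta_mx_0 1?eq_sym // !scaler0 subr0 subrK.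
Qed.

Lemma elem_mul a b x g i j : a != b ->
  GLmx (elem a b x * g)%g i j = GLmx g i j + (i == a)%:R * (x * GLmx g b j).
Proof.
move=> ab; rewrite GLmxM elem_mx // mulmxDl mul1mx -scalemxAl !mxE; congr (_ + _).
rewrite (bigD1 b) //= mxE eqxx andbT big1 ?addr0; first by rewrite mulrCA.
by move=> k kb; rewrite mxE (negPf kb) andbF mul0r.
Qed.

Lemma mul_elem a b x g i j : a != b ->
  GLmx (g * elem a b x)%g i j = GLmx g i j + (j == b)%:R * (GLmx g i a * x).
Proof.
move=> ab; rewrite GLmxM elem_mx // mulmxDr mulmx1 -scalemxAr !mxE; congr (_ + _).
rewrite (bigD1 a) //= mxE eqxx /= big1 ?addr0; first by ring.
by move=> k ka; rewrite mxE (negPf ka) /= mulr0.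
Qed.

Lemma elemE a b x i j : a != b ->
  GLmx (elem a b x) i j = (i == j)%:R + ((i == a) && (j == b))%:R * x.
Proof. by move=> ab; rewrite elem_mx // !mxE mulrC. Qed.

Lemma elemD a b x y : a != b -> elem a b (x + y) = (elem a b x * elem a b y)%g.
Proof.
move=> ab; apply: GLmx_ext => i j; rewrite elem_mul // !elemE //.
rewrite (eq_sym b a) (negPf ab) /= mul0r addr0 -mulnb natrM (eq_sym b j); ring.
Qed.

Lemma elem0 a b : a != b -> elem a b 0 = 1%g.
Proof. by move=> ab; apply: GLmx_ext => i j;
  rewrite elemE // GLoneE mulr0 addr0. Qed.

Lemma elemV a b x : a != b -> (elem a b x)^-1%g = elem a b (- x).
Proof.
by move=> ab; apply/eqP; rewrite eq_invg_mul -elemD // subrr elem0.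
Qed.

Lemma elem_unitri a b x : (a < b)%N -> elem a b x \in unitri.
Proof.
move=> ab; have nab : a != b by rewrite -val_eqE ltn_eqF.
apply/unitriP; split=> [i j ji|i]; rewrite elemE //.
  have /negPf-> : ~~ ((i == a) && (j == b)).
    by apply/andP => -[/eqP ia /eqP jb]; move: ji; rewrite ia jb; lia.
  by rewrite -val_eqE gtn_eqF //= mul0r addr0.
have /negPf-> : ~~ ((i == a) && (i == b)).
  by apply/andP => -[/eqP -> /eqP ab']; rewrite ab' eqxx in nab.
by rewrite eqxx mul0r addr0.
Qed.

End Matrices.
Opaque unitri.

(** * Permutations and the Bruhat decomposition *)

Section Permutations.
Variable m : nat.
Implicit Types (s t : 'S_m.+1).

Definition lo i : 'I_m.+1 := widen_ord (leqnSn m) i.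
Definition hi i : 'I_m.+1 := lift ord0 i.

Lemma hiE (i : 'I_m) : hi i = i.+1 :> nat. Proof. exact: lift0. Qed.

Lemma lo_hi (i : 'I_m) : lo i != hi i.
Proof. by rewrite -val_eqE /= /bump /=; lia. Qed.

Definition simple i : 'S_m.+1 := tperm (lo i) (hi i).

Definition long : 'S_m.+1 := perm (@rev_ord_inj m.+1).

Lemma longE (i : 'I_m.+1) : long i = (m - i)%N :> nat.
Proof. by rewrite permE /= subSS. Qed.

Lemma longV : long^-1%g = long.
Proof.
apply/permP => i; apply: (@perm_inj _ long); rewrite permKV.
by apply: val_inj; rewrite /= !longE; have := ltn_ord i; lia.
Qed.

(** The two families of values have the same sum, so no inequality is strict. *)
Lemma perm_le s t : (forall i, s i <= t i)%N -> s = t.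
Proof.
move=> le_st; have eq_sum : (\sum_i s i = \sum_i t i)%N.
  rewrite -(reindex_inj (@perm_inj _ s) (P := predT) (F := fun i => val i)).
  by rewrite -(reindex_inj (@perm_inj _ t) (P := predT) (F := fun i => val i)).
have leif i : true -> (s i <= t i ?= iff (s i == t i :> nat))%N.
  by move=> _; split.
have [_] := leqif_sum leif; rewrite eq_sum eqxx => /esym/forallP /= st.
by apply/permP => i; apply: val_inj; apply/eqP/st.
Qed.

Lemma descending_long t : (forall i, t (hi i) < t (lo i))%N -> t = long.
Proof.
move=> dec; apply: perm_le => -[i]; elim: i => [|i IH] lt_i.
  by rewrite longE /= subn0 -ltnS.
have lt_im : (i < m)%N by [].
have := dec (Ordinal lt_im); have := IH (ltn_trans (ltnSn i) lt_i).
rewrite !longE /=.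
have -> : lo (Ordinal lt_im) = Ordinal (ltn_trans (ltnSn i) lt_i) by apply: val_inj.
have -> : hi (Ordinal lt_im) = Ordinal lt_i by apply: val_inj; exact: hiE.
lia.
Qed.

(** Measure for the downward induction on the Bruhat order: it drops when two
    neighbouring increasing values are exchanged, and only the longest element
    has no such pair. *)
Definition disorder t := (\sum_(i < m.+1) i * t i)%N.

Lemma disorder_simple i t : (t (lo i) < t (hi i))%N ->
  (disorder (simple i * t)%g < disorder t)%N.
Proof.
move=> asc; rewrite /disorder.
rewrite (bigD1 (lo i)) //= [X in (_ < X)%N](bigD1 (lo i)) //=.
have hl : hi i != lo i by rewrite eq_sym lo_hi.
rewrite (bigD1 (hi i)) //= [X in (_ < _ + X)%N](bigD1 (hi i)) //=.
rewrite !permM tpermL tpermR.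
rewrite (eq_bigr (fun j : 'I_m.+1 => (j * t j)%N)); last first.
  by move=> j /andP[jl jh]; rewrite permM tpermD // eq_sym.
by move: asc; rewrite /= /bump /=; nia.
Qed.

End Permutations.

Section Bruhat.
Variables (n : nat) (F : finFieldType).
Local Notation G := (GLn n F).
Local Notation GLmx := (@GLmx n F).
Local Notation P := (@GLperm n F).
Local Notation B := (GLborel n F).
Local Notation U := (unitri n F).
Implicit Types (g h u v : G) (i j c r : 'I_n.-1.+1).

(** The first k columns are distinct unit vectors, and the rows of their ones
    vanish elsewhere. *)
Definition reduced_col k g := forall j, (j < k)%N -> exists r,
  (forall i, GLmx g i j = (i == r)%:R) /\ (forall c, c != j -> GLmx g r c = 0).

(** One step of Gaussian elimination with the lowest nonzero entry of the column
    as pivot. Row operations then only add the pivot row to higher rows, and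
    column operations only act to the right, so both are upper triangular; the
    columns already treated are untouched because the pivot row vanishes there. *)
Lemma reduce_col g j : reduced_col j g ->
  exists u b, [/\ u \in U, b \in B & reduced_col j.+1 (u * g * b)%g].
Proof.
move=> redg.
have [r0 r0P] : exists r, GLmx g r j != 0.
  apply/existsP; apply: contraT; rewrite negb_exists => /forallP g0.
  have := GLoneE F j j; rewrite eqxx -(mulVg g) GLmulE big1 => [/eqP|i _].
    by rewrite eq_sym oner_eq0.
  by have /eqP-> := negPn (g0 i); rewrite mulr0.
pose r := [arg max_(i > r0 | GLmx g i j != 0) val i].
have [rN0 r_max] : GLmx g r j != 0 /\
    forall i, (r < i)%N -> GLmx g i j = 0.
  rewrite /r; case: arg_maxnP => //= i iP imax; split=> // i' lt_i.
  by apply/eqP; apply: contraLR lt_i => /imax; rewrite -leqNgt.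
pose p := GLmx g r j.
(* Clears the entries of column j above the pivot row r. *)
pose A := \matrix_(i, c)
  ((i == c)%:R - ((c == r) && (i < r)%N)%:R * (GLmx g i j / p)) : 'M[F]_n.-1.+1.
have [uE uU] : GLmx (GL_of_mx A) = A /\ GL_of_mx A \in U.
  apply: unitri_of_mx => [i c ci|i]; rewrite mxE.
    rewrite -val_eqE gtn_eqF //= sub0r.
    have /negPf-> : ~~ ((c == r) && (i < r)%N) by apply/andP => -[/eqP <-]; lia.
    by rewrite mul0r oppr0.
  have /negPf-> : ~~ ((i == r) && (i < r)%N).
    by apply/andP => -[/eqP <-]; rewrite ltnn.
  by rewrite mul0r eqxx subr0.
(* Scales column j and clears the pivot row to the right of it. *)
pose D := \matrix_(i, c) (if i == j then
  if c == j then p^-1 else if (j < c)%N then - (GLmx g r c / p) else 0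
  else (i == c)%:R) : 'M[F]_n.-1.+1.
have D0 i c : (c < i)%N -> D i c = 0.
  move=> ci; rewrite mxE; case: (eqVneq i j) => [ij|_].
    by rewrite -val_eqE -ij ltn_eqF // ltnNge ltnW.
  by rewrite -val_eqE gtn_eqF.
have bE : GLmx (GL_of_mx D) = D.
  rewrite GL_of_mxK // upper_unit // => i; rewrite mxE.
  by case: (eqVneq i j) => _ /=; rewrite ?invr_eq0 // eqxx oner_eq0.
have bB : GL_of_mx D \in B by apply/borelP => i c ci; rewrite bE D0.
set u := GL_of_mx A in uE uU; set b := GL_of_mx D in bE bB.
have g1E i c : GLmx (u * g)%g i c =
    GLmx g i c - (i < r)%:R * (GLmx g i j / p) * GLmx g r c.
  rewrite GLmulE uE; under eq_bigr => k _ do rewrite mxE mulrBl.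
  rewrite sumrB (bigD1 i) //= eqxx mul1r big1 ?addr0; last first.
    by move=> k ki; rewrite eq_sym (negPf ki) mul0r.
  congr (_ - _); rewrite (bigD1 r) //= eqxx /= big1 ?addr0 // => k kr.
  by rewrite (negPf kr) !mul0r.
have rowr c : GLmx (u * g)%g r c = GLmx g r c.
  by rewrite g1E ltnn !mul0r subr0.
have colj i : GLmx (u * g)%g i j = (i == r)%:R * p.
  rewrite g1E -/p mulrA mulfVK //.
  have [-> | ir] := eqVneq i r; first by rewrite ltnn mul0r subr0 mul1r.
  have [lt_ir | le_ri] := ltnP i r; first by rewrite mul1r subrr mul0r.
  by rewrite mul0r subr0 mul0r r_max // ltn_neqAle eq_sym val_eqE ir.
have g2E i c : GLmx (u * g * b)%g i c =
    if c == j then (i == r)%:R else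
    GLmx (u * g)%g i c - (j < c)%:R * (i == r)%:R * GLmx g r c.
  rewrite GLmulE bE (bigD1 j) //= colj [D _ _]mxE eqxx.
  case: (eqVneq c j) => [->|cj].
    rewrite big1 ?addr0 ?mulfK // => k kj.
    by rewrite [D _ _]mxE (negPf kj) mulr0.
  rewrite (bigD1 c) //= [D c c]mxE (negPf cj) eqxx mulr1 big1 ?addr0; last first.
    by move=> k /andP[kj kc]; rewrite [D _ _]mxE (negPf kj) (negPf kc) mulr0.
  rewrite addrC; congr (_ + _); case: ltnP => _; last by rewrite !mul0r oppr0 mulr0.
  by rewrite !mul1r mulrN -mulrA [p * _]mulrC mulfVK.
have zr c : (c < j)%N -> GLmx g r c = 0.
  move=> cj; have [r' [colc rowr']] := redg c cj; rewrite colc.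
  case: eqVneq => // rr'; have jc : j != c by rewrite -val_eqE gtn_eqF.
  by move: rN0; rewrite rr' rowr' ?eqxx.
exists u, b; split=> // c; rewrite ltnS leq_eqVlt val_eqE => /orP[/eqP-> | cj].
  exists r; split=> [i|c' cj']; first by rewrite g2E eqxx.
  rewrite g2E (negPf cj') rowr eqxx mulr1.
  case: (ltnP j c') => [_|]; first by rewrite mul1r subrr.
  by rewrite mul0r subr0 leq_eqVlt val_eqE (negPf cj') => /zr.
have ncj : c != j by rewrite -val_eqE ltn_eqF.
have [r' [colc rowr']] := redg c cj.
have r'j : GLmx g r' j = 0 by rewrite rowr' // eq_sym.
have g1r' c' : GLmx (u * g)%g r' c' = GLmx g r' c'.
  by rewrite g1E r'j !(mul0r, mulr0) subr0.
have nr' : (r' == r) = false by apply: contraNF rN0 => /eqP<-; rewrite r'j.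
exists r'; split=> [i|c' c'c].
  rewrite g2E (negPf ncj) ltnNge ltnW // !mul0r subr0 g1E zr // mulr0 subr0.
  exact: colc.
rewrite g2E; case: eqP => [_|_]; first by rewrite nr'.
by rewrite nr' mulr0 mul0r subr0 g1r' rowr'.
Qed.

Lemma bruhat g : exists u s b, [/\ u \in U, b \in B & g = (u * P s * b)%g].
Proof.
have redk k : (k <= n.-1.+1)%N ->
    exists u b, [/\ u \in U, b \in B & reduced_col k (u * g * b)%g].
  elim: k => [|k IH] kn; first by exists 1%g, 1%g; split; rewrite ?group1.
  have [u [b [uU bB to_reduction]]] := IH (ltnW kn).
  have [u' [b' [u'U b'B red']]] := reduce_col (j := Ordinal kn) to_reduction.
  exists (u' * u)%g, (b * b')%g; split; rewrite ?groupM //.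
  by rewrite !mulgA in red' *.
have [u [b [uU bB]]] := redk _ (leqnn _); set h := (u * g * b)%g => to_reduction.
have /choice[r rP] : forall j, exists r, (forall i, GLmx h i j = (i == r)%:R) /\
  (forall c, c != j -> GLmx h r c = 0) by move=> j; apply: to_reduction.
have r_inj : injective r.
  move=> j j' rj; apply/eqP; apply: contraT => jj'.
  have [_ /(_ j)] := rP j'; rewrite -rj => /(_ jj').
  by have [-> _] := rP j; rewrite eqxx => /eqP; rewrite oner_eq0.
exists u^-1%g, (perm r_inj)^-1%g, b^-1%g; split; rewrite ?groupV //.
have <- : h = P (perm r_inj)^-1%g.
  apply: GLmx_ext => i j; rewrite GLpermE; have [-> _] := rP j.
  by rewrite -[in RHS](inj_eq (@perm_inj _ (perm r_inj))) permKV permE.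
by rewrite /h !mulgA mulVg mul1g mulgK.
Qed.

End Bruhat.

(** * Translates in a group algebra *)

(** Left multiplication by a group element, locked so that translates by
    different elements are never compared by computing their coefficients. *)
HB.lock Definition translate (R : pzRingType) (gT : finGroupType) (g : gT)
  (x : grpalg R gT) : grpalg R gT := gelt R g * x.
HB.lock Definition rscale (R : pzRingType) (gT : finGroupType) (r : R)
  (x : grpalg R gT) : grpalg R gT := [ffun g => r * x g].

Section GroupAlgebraFacts.
Variables (R : pzRingType) (gT : finGroupType).
Local Notation RG := (grpalg R gT).
Implicit Types (a x y : RG) (g h : gT) (r : R).


Lemma translateE g x h : translate g x h = x (g^-1 * h)%g.
Proof.
rewrite translate.unlock ffunE (bigD1 g) //= ffunE eqxx mul1r big1 ?addr0 // =>
  k kg.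
by rewrite ffunE (negPf kg) mul0r.
Qed.

Lemma geltM g x : gelt R g * x =
  translate g x. Proof. by rewrite translate.unlock. Qed.

Lemma rscaleE r x g : rscale r x g =
  r * x g. Proof. by rewrite rscale.unlock ffunE. Qed.

Lemma grpalg_mulE a x h : (a * x) h = \sum_g a g * x (g^-1 * h)%g.
Proof. by rewrite ffunE. Qed.

Lemma grpalg_sumE (J : Type) (s : seq J) (Q : pred J) (f : J -> RG) g :
  (\sum_(j <- s | Q j) f j) g = \sum_(j <- s | Q j) f j g.
Proof.
by apply: (big_morph (fun x : RG => x g)) => [x y|]; rewrite ffunE.
Qed.

Lemma grpalg_addE x y g : (x + y) g = x g + y g. Proof. exact: ffunE. Qed.
Lemma grpalg_oppE x g : (- x) g = - x g. Proof. exact: ffunE. Qed.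
Lemma grpalg_subE x y g : (x - y) g =
  x g - y g. Proof. by rewrite grpalg_addE grpalg_oppE. Qed.
Lemma grpalg_zeroE g : (0 : RG) g = 0. Proof. exact: ffunE. Qed.
Lemma grpalg_mulrnE x k g : (x *+ k) g = x g *+ k. Proof. exact: ffunMnE. Qed.

Lemma grpalg_mul_translates a x : a * x = \sum_g rscale (a g) (translate g x).
Proof. by apply/ffunP=> h; rewrite grpalg_mulE grpalg_sumE; apply: eq_bigr => g _;
  rewrite rscaleE translateE. Qed.

Lemma rscale_mul r x : rscale r x = rscale r 1 * x.
Proof.
apply/ffunP=> h; rewrite grpalg_mulE rscaleE (bigD1 1%g) //= rscaleE ffunE eqxx
  mulr1 invg1 mul1g.
by rewrite big1 ?addr0 // => g /negPf g1; rewrite rscaleE ffunE g1 mulr0 mul0r.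
Qed.

Lemma translateM g h x : translate (g * h)%g x = translate g (translate h x).
Proof. by apply/ffunP=> k; rewrite !translateE invMg mulgA. Qed.

Lemma translate1 x : translate 1%g x = x.
Proof. by apply/ffunP=> k; rewrite !translateE invg1 mul1g. Qed.

Lemma hatsumE (S : {set gT}) h : hatsum R S h = (h \in S)%:R.
Proof.
rewrite /hatsum grpalg_sumE; case: (boolP (h \in S)) => hS.
  rewrite (bigD1 h) //= ffunE eqxx big1 ?addr0 // => k /andP[_ kh].
  by rewrite ffunE eq_sym (negPf kh).
by rewrite big1 // => k kS; rewrite ffunE; case: eqP hS => // ->; rewrite kS.
Qed.

Lemma hatsum_mulE (S : {set gT}) x h :
  (hatsum R S * x) h = \sum_(g in S) x (g^-1 * h)%g.
Proof.
by rewrite /hatsum mulr_suml grpalg_sumE; apply: eq_bigr => g _;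
  rewrite geltM translateE.
Qed.

Lemma hatsum_mul (S : {set gT}) x : hatsum R S * x = \sum_(g in S) translate g x.
Proof. by apply/ffunP=> h; rewrite hatsum_mulE grpalg_sumE; apply: eq_bigr => g _;
  rewrite translateE. Qed.

End GroupAlgebraFacts.

(** * The Steinberg lattice as a lattice of cycles *)

(** The generator of the lattice: on the cosets g B, which are the chambers of
    the building, it is the alternating sum over the chambers of an apartment. *)
HB.lock Definition apartment (n : nat) (F : finFieldType) (R : idomainType) :
  grpalg R (GLn n F) := steinberg_elt n F R.

Section Lattice.
Variables (n : nat) (F : finFieldType) (R : idomainType).
Local Notation RG := (grpalg R (GLn n F)).

Definition Steinberg : submodClosed RG^o := steinberg_lattice n F R.

Lemma apartmentE : apartment n F R =
  \sum_(s : 'S_n.-1.+1) (-1) ^+ s * (gelt R (GLperm F s) * hatsum R (GLborel n F)).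
Proof. by rewrite apartment.unlock. Qed.

Lemma SteinbergP (x : RG) : reflect (exists a : RG, x =
  a * apartment n F R) (x \in Steinberg).
Proof. by rewrite apartment.unlock; apply: asboolP. Qed.

End Lattice.
Opaque Steinberg.

Section Cycles.
Variables (n : nat) (F : finFieldType) (R : idomainType).
Hypothesis R_char0 : [pchar R] =i pred0.
Local Notation G := (GLn n F).
Local Notation GLmx := (@GLmx n F).
Local Notation P := (@GLperm n F).
Local Notation B := (GLborel n F).
Local Notation U := (unitri n F).
Local Notation RG := (grpalg R G).
Local Notation apt := (apartment n F R).
Local Notation St := (Steinberg n F R).
Local Notation w0 := (P (@long n.-1)).
Local Notation sw := ((-1) ^+ (@long n.-1) : R).
Implicit Types (g h u v b : G) (a c : 'I_n.-1.+1) (x y : RG).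

Lemma natrR_eq0 k : (k%:R == 0 :> R) = (k == 0)%N.
Proof. by rewrite (pcharf0P R).1. Qed.

Lemma signrRG (s : 'S_n.-1.+1) x g : ((-1) ^+ s * x) g = (-1) ^+ s * x g.
Proof. by case: (odd_perm s); rewrite ?expr1 ?expr0 ?mulN1r ?mul1r ?grpalg_oppE.
  Qed.

Lemma apartment_ev g : apt g = \sum_(s : 'S_n.-1.+1) (-1) ^+ s * ((P s)^-1 * g \in
  B)%g%:R.
Proof.
rewrite apartmentE grpalg_sumE; apply: eq_bigr => s _; rewrite signrRG;
  congr (_ * _).
rewrite geltM translateE; move: (_ * g)%g => h; exact: hatsumE.
Qed.

(** Functions on chambers whose sum over every panel vanishes, that is the top
    homology of the building. The chambers of a panel other than g B are the
    g x_i(t) s_i B. *)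
Definition is_cycle x := (forall g b, b \in B -> x (g * b)%g = x g) /\
  forall (i : 'I_n.-1) g,
    x g + \sum_(t : F) x (g * elem (lo i) (hi i) t * P (simple i))%g = 0.

(** The minimal parabolic subgroup of type i. *)
Definition panel (i : 'I_n.-1) g := [forall a : 'I_n.-1.+1, forall c : 'I_n.-1.+1,
  (c < a)%N && ~~ ((a == hi i) && (c == lo i)) ==> (GLmx g a c == 0)].

Lemma panelP i g : reflect (forall a c, (c < a)%N ->
  ~~ ((a == hi i) && (c == lo i)) -> GLmx g a c = 0) (panel i g).
Proof.
apply: (iffP forallP) => [gP a c ca ac|gP a].
  by have /forallP/(_ c)/implyP := gP a; rewrite ca ac => /(_ isT)/eqP.
by apply/forallP => c; apply/implyP => /andP[ca ac]; apply/eqP/gP.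
Qed.

(** A minimal parabolic subgroup is the disjoint union of B and of the right
    cosets of B through the inverses of the x_i(t) s_i: if the entry below the
    diagonal is nonzero, exactly one t clears it after the exchange of the two
    columns. *)
Lemma panel_sum i g :
  (panel i g)%:R = (g \in B)%:R +
    \sum_(t : F) (g * elem (lo i) (hi i) t * P (simple i) \in B)%g%:R :> R.
Proof.
have nlh := lo_hi i.
pose g' t := (g * elem (lo i) (hi i) t * P (simple i))%g.
have g'E t a c : GLmx (g' t) a c = if c == lo i then
     GLmx g a (hi i) + GLmx g a (lo i) * t
   else if c == hi i then GLmx g a (lo i) else GLmx g a c.
  rewrite GLmul_perm tpermV; case: (eqVneq c (lo i)) => [->|cl].
    by rewrite tpermL mul_elem // eqxx mul1r.
  case: (eqVneq c (hi i)) => [->|ch].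
    by rewrite tpermR mul_elem // (negPf nlh) mul0r addr0.
  by rewrite tpermD 1?eq_sym // mul_elem // (negPf ch) mul0r addr0.
have lthi : (lo i < hi i)%N by rewrite hiE /=.
have gB : g \in B = panel i g && (GLmx g (hi i) (lo i) == 0).
  apply/borelP/andP => [g0|[/panelP gP /eqP g0] a c ca].
    by split; [apply/panelP => a c ca _|]; rewrite g0.
  by case: (boolP ((a == hi i) && (c == lo i))) => [/andP[/eqP-> /eqP->]|/gP->].
have g'B t : g' t \in B = panel i g &&
    (GLmx g (hi i) (hi i) + GLmx g (hi i) (lo i) * t == 0).
  apply/borelP/andP => [g0|[/panelP gP /eqP g0] a c ca].
    split; last by have := g0 (hi i) (lo i) lthi; rewrite g'E eqxx => ->.
    apply/panelP => a c ca.
    case: (eqVneq c (lo i)) => [cl ah|cl _].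
      rewrite andbT in ah; have := g0 a (hi i);
        rewrite g'E eq_sym (negPf nlh) eqxx cl.
      by apply; move: ca ah; rewrite cl -val_eqE /= /bump /=; lia.
    case: (eqVneq c (hi i)) => [ch|ch]; last by have := g0 a c ca;
      rewrite g'E (negPf cl) (negPf ch).
    have la : (lo i < a)%N by move: ca; rewrite ch; lia.
    have := g0 a (lo i) la; rewrite g'E eqxx.
    have := g0 a c ca; rewrite g'E (negPf cl) ch eqxx => ->.
    by rewrite mul0r addr0.
  rewrite g'E; case: (eqVneq c (lo i)) => [cl|cl].
    case: (eqVneq a (hi i)) => [->//|ah].
    have ha : (hi i < a)%N.
      by move: ca ah; rewrite cl -val_eqE /= /bump /=; lia.
    rewrite !gP ?mul0r ?addr0 // ?(negPf ah) //; first by rewrite -cl.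
  case: (eqVneq c (hi i)) => [ch|ch].
    by rewrite gP //; [rewrite ch in ca; lia|
      apply: contraTN ca => /andP[/eqP-> _]; rewrite ch ltnn].
  by rewrite gP // (negPf cl) andbF.
rewrite gB; under eq_bigr => t _ do rewrite -/(g' t) g'B.
case: (boolP (panel i g)) => gP /=; last by rewrite big1 ?addr0.
have [g0|g0] := eqVneq (GLmx g (hi i) (lo i)) 0.
  have /borel_diag : g \in B by rewrite gB gP g0 eqxx.
  move=> /(_ (hi i)) ghh; rewrite big1 ?addr0 // => t _.
  by rewrite g0 mul0r addr0 (negPf ghh).
rewrite add0r (bigD1 (- GLmx g (hi i) (hi i) / GLmx g (hi i) (lo i))) //=.
rewrite mulrC divfK // subrr eqxx big1 ?addr0 // => t /negPf tP.
rewrite addrC addr_eq0 -(inj_eq (mulfI (invr_neq0 g0))) mulKf // [_^-1 * _]mulrC.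
by rewrite tP.
Qed.

Lemma panel_simple i g : panel i (P (simple i) * g)%g = panel i g.
Proof.
suff imp h : panel i h -> panel i (P (simple i) * h)%g.
  apply/idP/idP => [/imp|/imp //].
  by rewrite mulgA -GLpermM tperm2 GLperm1 mul1g.
move=> /panelP hP; apply/panelP => a c ca ac; rewrite GLperm_mul.
have lthi : (lo i < hi i)%N by rewrite hiE /=.
case: (eqVneq a (lo i)) => [al|al].
  rewrite al tpermL hP //; first by rewrite al in ca; lia.
  by apply: contraTN ca => /andP[_ /eqP->]; rewrite al ltnn.
case: (eqVneq a (hi i)) => [ah|ah]; last by rewrite tpermD 1?eq_sym // hP.
have cl : (c < lo i)%N by move: ca ac; rewrite ah eqxx -val_eqE /= /bump /=; lia.
by rewrite ah tpermR hP // (negPf (lo_hi i)).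
Qed.

(** The terms of s and of s s_i cancel on each panel, since the minimal
    parabolic subgroup absorbs s_i on the left. The cancellation is read off
    from X = - X, which is where characteristic 0 enters. *)
Lemma apartment_cycle : is_cycle apt.
Proof.
split=> [g b bB|i g].
  by rewrite (apartment_ev g) (apartment_ev (g * b)%g); apply: eq_bigr => s _;
    rewrite mulgA groupMr.
rewrite (apartment_ev g) (eq_bigr _ (fun t _ =>
  apartment_ev _)) exchange_big -big_split /=.
pose f (s : 'S_n.-1.+1) : R := (-1) ^+ s * (panel i ((P s)^-1 * g)%g)%:R.
rewrite (eq_bigr f); last first.
  move=> s _; rewrite /f panel_sum mulrDr mulr_sumr; congr (_ + _).
  by apply: eq_bigr => t _; rewrite !mulgA.
have : \sum_s f s = - \sum_s f s.
  rewrite [LHS](reindex_inj (mulIg (simple i))) /= -sumrN; apply: eq_bigr => s _.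
  rewrite /f GLpermM invMg -(GLpermV F (simple i)) /simple tpermV -mulgA
    panel_simple odd_permM.
  by rewrite odd_tperm lo_hi addbT signrN mulNr.
by move/eqP; rewrite -addr_eq0 -mulr2n -mulr_natl mulf_eq0 natrR_eq0 => /eqP.
Qed.

Lemma cycle_mul (a x : RG) : is_cycle x -> is_cycle (a * x).
Proof.
move=> [xB xP]; split=> [g b bB|i g]; rewrite !grpalg_mulE.
  by apply: eq_bigr => h _; rewrite mulgA xB.
under [X in _ + X]eq_bigr => t _ do rewrite grpalg_mulE.
rewrite exchange_big -big_split big1 //= => h _.
rewrite -mulr_sumr -mulrDr.
have xPh := xP i (h^-1 * g)%g.
under eq_bigr => t _ do rewrite !mulgA.
by rewrite xPh mulr0.
Qed.

Lemma cycleB x y : is_cycle x -> is_cycle y -> is_cycle (x - y).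
Proof.
move=> [xB xP] [yB yP]; split=> [g b bB|i g]; first by rewrite !grpalg_subE xB ?yB.
under eq_bigr => t _ do rewrite grpalg_subE.
by rewrite grpalg_subE sumrB addrACA -opprD xP yP subr0.
Qed.

Lemma Steinberg_cycle x : x \in St -> is_cycle x.
Proof. by case/SteinbergP => a ->; apply: cycle_mul apartment_cycle. Qed.

Lemma GLperm_elem (s : 'S_n.-1.+1) a c t : a != c ->
  (P s * elem a c t)%g = (elem (s^-1%g a) (s^-1%g c) t * P s)%g.
Proof.
move=> ac; have ac' : s^-1%g a != s^-1%g c by rewrite (inj_eq perm_inj).
apply: GLmx_ext => i j; rewrite mul_elem // elem_mul // !GLpermE permKV.
rewrite -(inj_eq (@perm_inj _ s) i) permKV eq_sym [c == j]eq_sym.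
by congr (_ + _); case: (s i == a); case: (j == c);
  rewrite ?(mulr1, mul1r, mulr0, mul0r).
Qed.

(** Downward induction on the Bruhat cell: if s has an ascent at i, all other
    chambers of the panel of type i of u s B lie in the cell of s s_i, which is
    one step closer to the big cell. *)
Lemma cycle_vanish x : is_cycle x -> (forall u, u \in U -> x (u * w0)%g = 0) ->
  x = 0.
Proof.
move=> [xB xP] x0.
have van k : forall s u, (disorder s^-1%g < k)%N -> u \in U -> x (u * P s)%g = 0.
  elim: k => // k IH s u lt_k uU.
  (* At an ascent of s^-1 the panel relation moves up; without ascent s = w0. *)
  have [/existsP[i asc]|] := boolP [exists i, (s^-1%g (lo i) < s^-1%g (hi i))%N].
    have := xP i (u * P s)%g; rewrite big1 ?addr0 // => t _.
    rewrite -[(u * P s * _)%g]mulgA GLperm_elem ?lo_hi // -!mulgA -GLpermM mulgA.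
    apply: IH; last by rewrite groupM // elem_unitri.
    rewrite invMg tpermV; apply: leq_trans (disorder_simple asc) _; exact: lt_k.
  rewrite negb_exists => /forallP dec.
  suff -> : s = @long n.-1 by apply: x0.
  rewrite -(invgK s) (descending_long (t := s^-1%g)) ?longV // => i.
  have := dec i; rewrite -leqNgt leq_eqVlt => /orP[/eqP e|//].
  by have := lo_hi i; rewrite eq_sym => /eqP[]; apply: (@perm_inj _ s^-1%g);
    apply: val_inj.
apply/ffunP => g; have [u [s [b [uU bB ->]]]] := bruhat g.
by rewrite xB // (van _ _ _ (ltnSn _)) // grpalg_zeroE.
Qed.

Lemma apartment_borel b : b \in B -> apt b = 1.
Proof.
move=> bB; rewrite apartment_ev (bigD1 1%g) //= GLperm1 invg1 mul1g bB odd_perm1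
  mulr1.
rewrite big1 ?addr0 // => s s1.
case: (boolP (_ \in B)) => [/borelP sB|_]; last by rewrite mulr0.
case/eqP: s1; apply: perm_le => a; rewrite perm1 leqNgt; apply/negP => lt_a.
have := sB _ _ lt_a; rewrite -GLpermV GLperm_mul permK => /eqP.
by rewrite (negPf (borel_diag _ bB)).
Qed.

(** The cosets s B of an apartment meet the big cell in w0 B only: a diagonal
    argument on u forces s = w0, and then u is both upper and lower unitriangular. *)
Lemma apartment_big_cell u : u \in U -> apt (u * w0)%g = sw * (u == 1%g)%:R.
Proof.
move=> uU; rewrite apartment_ev (bigD1 (@long n.-1)) //= big1 ?addr0 => [|s sl].
  congr (_ * _%:R); congr nat_of_bool; apply/borelP/eqP => [w0B|->]; last first.
    by move=> i j ji; rewrite mul1g mulVg GLoneE -val_eqE gtn_eqF.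
  apply: GLmx_ext => i j; rewrite GLoneE.
  have [ji|ij|/val_inj->] := ltngtP j i; last by rewrite unitri1 ?eqxx.
    by rewrite unitri0 // -val_eqE gtn_eqF.
  rewrite -val_eqE ltn_eqF //.
  have := w0B (@long n.-1 i) (@long n.-1 j).
  rewrite -GLpermV GLperm_mul GLmul_perm permK permK; apply.
  by rewrite !longE; have := ltn_ord j; lia.
case: (boolP (_ \in B)) => [/borelP sB|_]; last by rewrite mulr0.
case/eqP: sl; apply: perm_le => a; rewrite leqNgt; apply/negP => lt_a.
have := sB _ _ lt_a; rewrite -GLpermV GLperm_mul permK GLmul_perm permK unitri1 //.
by move/eqP; rewrite oner_eq0.
Qed.

Lemma sw2 : sw * sw = 1.
Proof. by rewrite -expr2 sqrr_sign. Qed.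

Lemma Steinberg_translate g x : x \in St -> translate g x \in St.
Proof. by rewrite -geltM => xS; apply: (rpredZ (s := St) (gelt R g) xS). Qed.

Lemma Steinberg_mul (a : RG) x : x \in St -> a * x \in St.
Proof. by move=> xS; apply: (rpredZ (s := St) a xS). Qed.

Lemma Steinberg_apartment : apt \in St.
Proof. by apply/SteinbergP; exists 1; rewrite mul1r. Qed.

(** The difference of the two sides is a cycle that vanishes on the big cell.
    Hence the u eps with u unitriangular form a basis, the coordinates being
    the values on the big cell up to a common sign. *)
Lemma big_cell_expansion x : x \in St ->
  x = \sum_(u in U) rscale (sw * x (u * w0)%g) (translate u apt).
Proof.
move=> xS; apply/eqP; rewrite -subr_eq0; apply/eqP/cycle_vanish.
  apply: cycleB; apply: Steinberg_cycle => //; apply: (rpred_sum (S := St)) => u _.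
  by rewrite rscale_mul Steinberg_mul // Steinberg_translate // Steinberg_apartment.
move=> v vU; rewrite grpalg_subE grpalg_sumE (bigD1 v) //= big1 ?addr0 =>
  [|u /andP[uU uv]].
  by rewrite rscaleE translateE mulKg -[w0]mul1g apartment_big_cell ?group1 //
    eqxx mulr1 mulrAC sw2 mul1r mul1g subrr.
rewrite rscaleE translateE mulgA apartment_big_cell ?groupM ?groupV //.
by rewrite -eq_mulVg1 (negPf uv) !mulr0.
Qed.

Lemma big_cell_expansion_ev x g : x \in St ->
  x g = \sum_(u in U) sw * x (u * w0)%g * apt (u^-1 * g)%g.
Proof.
move=> xS; rewrite {1}(big_cell_expansion xS) grpalg_sumE; apply: eq_bigr => u _.
by rewrite rscaleE translateE.
Qed.

(** The value on a chamber is, up to sign, the sum over all opposite chambers: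
    evaluate the big-cell expansion at 1, where every u eps takes the value 1. *)
Lemma Steinberg_ev1 x : x \in St -> x 1%g = \sum_(u in U) sw * x (u * w0)%g.
Proof.
move=> xS; rewrite (big_cell_expansion_ev _ xS); apply: eq_bigr => u uU.
by rewrite mulg1 apartment_borel ?mulr1 // groupV unitri_borel.
Qed.

End Cycles.

(** * The invariant form and the vector fixed by the unitriangular group *)

Section SumForm.
Variables (R : idomainType) (gT : finGroupType).
Local Notation RG := (grpalg R gT).
Implicit Types (a x y : RG) (g h : gT) (r : R).

(** The form of the theorem multiplied by the order of B, so that it takes its
    values in R on the whole group algebra. *)
Definition sform x y : R := \sum_g x g * y g.

Lemma sformC x y : sform x y = sform y x.
Proof. by apply: eq_bigr => g _; rewrite mulrC. Qed.

Lemma sform_tr h x y : sform (translate h x) y = sform x (translate h^-1%g y).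
Proof.
rewrite /sform (reindex_inj (mulgI h)) /=; apply: eq_bigr => g _.
by rewrite !translateE mulKg invgK.
Qed.

Lemma sformDl x y z : sform (x + y) z = sform x z + sform y z.
Proof. by rewrite /sform -big_split; apply: eq_bigr => g _;
  rewrite grpalg_addE mulrDl. Qed.

Lemma sform_rs r x z : sform (rscale r x) z = r * sform x z.
Proof. by rewrite /sform mulr_sumr; apply: eq_bigr => g _;
  rewrite rscaleE mulrA. Qed.

Lemma sform0l z : sform 0 z = 0.
Proof. by rewrite /sform big1 // => g _; rewrite grpalg_zeroE mul0r. Qed.

Lemma sform_suml (J : Type) (s : seq J) (Q : pred J) (f : J -> RG) z :
  sform (\sum_(j <- s | Q j) f j) z = \sum_(j <- s | Q j) sform (f j) z.
Proof. by apply: (big_morph (fun x => sform x z)) => [x y|];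
  rewrite ?sformDl ?sform0l. Qed.

Lemma sformDr x y z : sform z (x + y) = sform z x + sform z y.
Proof. by rewrite sformC sformDl !(sformC _ z). Qed.

Lemma sform_rsr r x z : sform z (rscale r x) = r * sform z x.
Proof. by rewrite sformC sform_rs sformC. Qed.

Lemma sform_sumr (J : Type) (s : seq J) (Q : pred J) (f : J -> RG) z :
  sform z (\sum_(j <- s | Q j) f j) = \sum_(j <- s | Q j) sform z (f j).
Proof. by rewrite sformC sform_suml; apply: eq_bigr => j _; rewrite sformC. Qed.

Lemma sform_hatsum (H : {group gT}) x y :
  sform (hatsum R H * x) y = sform x (hatsum R H * y).
Proof.
rewrite !hatsum_mul sform_suml sform_sumr (reindex_inj invg_inj) /=.
by apply: eq_big => h; rewrite ?groupV // => _; rewrite sform_tr invgK.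
Qed.

End SumForm.

(** The vector that spans the invariants of the unitriangular group in the
    lattice. *)
HB.lock Definition Ufix (n : nat) (F : finFieldType) (R : idomainType) :
  grpalg R (GLn n F) := hatsum R (unitri n F) * apartment n F R.

Section UFixed.
Variables (n : nat) (F : finFieldType) (R : idomainType).
Hypothesis R_char0 : [pchar R] =i pred0.
Local Notation G := (GLn n F).
Local Notation P := (@GLperm n F).
Local Notation B := (GLborel n F).
Local Notation U := (unitri n F).
Local Notation RG := (grpalg R G).
Local Notation apt := (apartment n F R).
Local Notation St := (Steinberg n F R).
Local Notation w0 := (P (@long n.-1)).
Local Notation sw := ((-1) ^+ (@long n.-1) : R).
Implicit Types (g h u v b : G) (x y : RG).

Local Notation Ufix := (Ufix n F R).

Lemma UfixE g : Ufix g = \sum_(u in U) apt (u^-1 * g)%g.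
Proof. by rewrite Ufix.unlock hatsum_mulE. Qed.


Lemma Steinberg_Ufix : Ufix \in St.
Proof. by rewrite Ufix.unlock Steinberg_mul // Steinberg_apartment. Qed.

(** Summing the big-cell expansion over U sends every u eps to the same vector,
    so only the sum of the coordinates, which is the value at 1, survives. *)
Lemma Uhat_fix x : x \in St -> hatsum R U * x = rscale (x 1%g) Ufix.
Proof.
move=> xS; apply/ffunP => g; rewrite rscaleE UfixE hatsum_mulE (Steinberg_ev1
  R_char0 xS).
under eq_bigr => v vU do rewrite (big_cell_expansion_ev R_char0 _ xS).
rewrite exchange_big mulr_suml; apply: eq_bigr => u uU /=.
rewrite -mulr_sumr; congr (_ * _).
rewrite (reindex_inj (mulIg u^-1%g)) /=.
apply: eq_big => v; first by rewrite groupMr // groupV.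
by rewrite invMg invgK !mulgA mulVg mul1g.
Qed.

Lemma Ufix1 : Ufix 1%g = #|U|%:R.
Proof.
rewrite UfixE (eq_bigr (fun=> 1)) ?sumr_const // => u uU.
by rewrite mulg1 apartment_borel // groupV unitri_borel.
Qed.

Lemma unitriJ b u : b \in B -> u \in U -> (b * u * b^-1)%g \in U.
Proof.
move=> bB uU; have uB := unitri_borel uU.
have cB : (b * u * b^-1)%g \in B by rewrite !groupM // groupV.
rewrite mem_unitri cB; apply/forallP => i.
rewrite !borel_diagM ?groupM ?groupV // (unitri1 _ uU) mulr1.
by rewrite -borel_diagM ?groupV // mulgV GLoneE eqxx.
Qed.

(** B normalizes U, so a B-translate of this vector is again the sum over U of a
    translate of eps, hence a multiple of it. *)
Lemma Ufix_borel b : b \in B -> translate b Ufix = Ufix.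
Proof.
move=> bB; transitivity (hatsum R U * translate b apt); last first.
  rewrite Uhat_fix ?Steinberg_translate ?Steinberg_apartment //
    translateE mulg1 apartment_borel ?groupV //.
  by apply/ffunP => g; rewrite rscaleE mul1r.
apply/ffunP => g; rewrite translateE UfixE hatsum_mulE.
have inj : injective (fun v => (b^-1 * v * b)%g).
  by move=> v v' /mulIg/mulgI.
rewrite (reindex_inj inj) /=.
apply: eq_big => [v|v _].
  apply/idP/idP => [vU|vU].
    by have := unitriJ bB vU; rewrite !mulgA mulgV mul1g mulgK.
  by have := unitriJ (groupVr bB) vU; rewrite invgK.
by rewrite translateE !invMg invgK !mulgA mulgK.
Qed.

(** Inversion turns the pairs (b, b') with b s b' = g into those for the inverse
    of g and the inverse permutation, which has the same sign. *)
Lemma Bhat_sym g : (hatsum R B * apt) g^-1%g = (hatsum R B * apt) g.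
Proof.
rewrite !hatsum_mulE.
under eq_bigr => b _ do rewrite apartment_ev.
under [RHS]eq_bigr => b _ do rewrite apartment_ev.
rewrite exchange_big [RHS]exchange_big /= [LHS](reindex_inj invg_inj) /=.
apply: eq_bigr => s _; rewrite odd_permV -!mulr_sumr; congr (_ * _).
rewrite big_mkcond [RHS]big_mkcond /=.
have inj : injective (fun b => g^-1 * b * (P s^-1)^-1)%g.
  by move=> b b' /mulIg/mulgI.
rewrite (reindex_inj inj) /=; apply: eq_bigr => b _.
have -> : (g^-1 * b * (P s^-1)^-1 \in B)%g = ((P s)^-1 * (b^-1 * g) \in B)%g.
  by rewrite -groupV !invMg invgK GLpermV invgK mulgA.
rewrite !invMg !invgK -!mulgA mulgV mulg1 mulKg groupV.
by case: (b \in B); case: (_ \in B).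
Qed.

(** Up to the orders of B and U this vector is the sum of eps over B, which is
    visibly symmetric. *)
Lemma Ufix_sym g : Ufix g^-1%g = Ufix g.
Proof.
have key h : #|B|%:R * Ufix h = #|U|%:R * (hatsum R B * apt) h.
  transitivity (\sum_(b in B) Ufix (b^-1 * h)%g).
    rewrite (eq_bigr (fun=> Ufix h)) ?sumr_const ?mulr_natl // => b bB.
    by rewrite -translateE Ufix_borel.
  under eq_bigr => b _ do rewrite UfixE.
  rewrite exchange_big (eq_bigr (fun=> (hatsum R B * apt) h)) /=.
    by rewrite sumr_const mulr_natl.
  move=> u uU; rewrite hatsum_mulE (reindex_inj (mulIg u^-1%g)) /=.
  apply: eq_big => b; first by rewrite groupMr // groupV unitri_borel.
  by rewrite invMg invgK !mulgA mulVg mul1g.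
have B0 : #|B|%:R != 0 :> R by rewrite (natrR_eq0 R_char0) -lt0n cardG_gt0.
by apply: (mulfI B0); rewrite !key Bhat_sym.
Qed.

Lemma sform_apartment y : y \in St ->
  sform apt y = #|B|%:R * \sum_(s : 'S_n.-1.+1) (-1) ^+ s * y (P s).
Proof.
move=> /(Steinberg_cycle R_char0)[yB _]; rewrite /sform.
under eq_bigr => g _ do rewrite apartment_ev mulr_suml.
rewrite exchange_big mulr_sumr; apply: eq_bigr => s _ /=.
rewrite (reindex_inj (mulgI (P s))) /= [in RHS]mulrCA.
rewrite (eq_bigr (fun g => (-1) ^+ s * ((g \in B)%:R * y (P s * g)%g))); last first.
  by move=> g _; rewrite mulKg mulrA.
rewrite -mulr_sumr; congr (_ * _).
rewrite mulr_natl -sumr_const big_mkcond [RHS]big_mkcond /=.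
by apply: eq_bigr => b _; case: ifP => bB; rewrite ?mul1r ?mul0r ?yB.
Qed.

Lemma sform_Ufix_c g x : x \in St ->
  sform (translate g Ufix) x = sform apt Ufix * x g.
Proof.
move=> xS; rewrite sform_tr {1}Ufix.unlock sform_hatsum Uhat_fix
  ?Steinberg_translate //.
by rewrite sform_rsr translateE invgK mulg1 mulrC.
Qed.


(** A trace computation. The operator that sends x to the sum of the x(g) g Ufix is
    multiplication by the constant c = sform eps Ufix on the lattice, by
    sform_Ufix_c and the symmetry of Ufix. Its trace on the lattice, of rank
    #|U|, is c #|U|; computed from the coefficients of g Ufix at g it is
    #|G| Ufix(1) = #|G| #|U|. *)
Lemma sform_apartment_Ufix : sform apt Ufix = #|[set: G]|%:R.
Proof.
have U0 : #|U|%:R != 0 :> R by rewrite (natrR_eq0 R_char0) -lt0n cardG_gt0.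
apply: (mulIf U0); set c := sform _ _.
have key x h : x \in St -> \sum_g x g * translate g Ufix h = c * x h.
  move=> xS; rewrite -sform_Ufix_c // sformC; apply: eq_bigr => g _.
  by rewrite !translateE -(Ufix_sym (g^-1 * h)%g) invMg invgK.
transitivity (\sum_(v in U) sw * (c * translate v apt (v * w0)%g)).
  rewrite mulr_natr -sumr_const; apply: eq_bigr => v vU.
  by rewrite translateE mulKg -[w0]mul1g apartment_big_cell ?group1 //
    eqxx mulr1 mulrCA sw2 mulr1.
transitivity (\sum_(v in U) sw * (\sum_g translate v apt g * translate g Ufix (v *
  w0)%g)).
  by apply: eq_bigr => v vU; rewrite key // Steinberg_translate //
    Steinberg_apartment.
under eq_bigr => v _ do rewrite mulr_sumr.
rewrite exchange_big /= mulr_natl -sumr_const.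
rewrite [RHS]big_mkcond; apply: eq_bigr => g _ /=; rewrite inE -Ufix1.
transitivity (translate g Ufix g); last by rewrite translateE mulVg.
rewrite [RHS](big_cell_expansion_ev R_char0 _ (Steinberg_translate g
  Steinberg_Ufix)).
by apply: eq_bigr => v _; rewrite -translateE mulrA mulrAC.
Qed.

(** Pairing with a translate of the invariant vector is evaluation, up to the
    order of the group. This single formula yields the nondegeneracy of the
    form, the depth of Ufix in the filtration and the shape of the top layer. *)
Lemma sform_Ufix g x : x \in St ->
  sform (translate g Ufix) x = #|[set: G]|%:R * x g.
Proof. by move=> xS; rewrite sform_Ufix_c // sform_apartment_Ufix. Qed.

End UFixed.

(** * The filtration of the Steinberg lattice and its top layer *)

Section LeftSubmodules.
Variables (R : idomainType) (gT : finGroupType).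
Local Notation RG := (grpalg R gT).
Implicit Types (a x y : RG) (N : RG -> Prop).

(** Left ideals as predicates, so that ideals built on the way, such as
    preimages of submodules, need no structure instance. *)
Definition left_stable N :=
  [/\ N 0, forall x y, N x -> N y -> N (x + y) & forall a x, N x -> N (a * x)].

Lemma left_stableD N x y : left_stable N -> N x -> N y -> N (x + y).
Proof. by case=> _ + _; apply. Qed.

Lemma left_stableM N a x : left_stable N -> N x -> N (a * x).
Proof. by case=> _ _; apply. Qed.

Lemma left_stable_translate N g x : left_stable N -> N x -> N (translate g x).
Proof. by rewrite -geltM; apply: left_stableM. Qed.

Lemma left_stable_rscale N r x : left_stable N -> N x -> N (rscale r x).
Proof. by rewrite rscale_mul; apply: left_stableM. Qed.

Lemma left_stable_sum N (J : Type) (s : seq J) (Q : pred J) (f : J -> RG) :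
  left_stable N ->
  (forall j, Q j -> N (f j)) -> N (\sum_(j <- s | Q j) f j).
Proof.
move=> [N0 ND NM] Nf; elim: s => [|j s IH]; rewrite ?big_nil ?big_cons //.
by case: ifP => // /Nf Nj; apply: ND.
Qed.

Lemma left_stableN N x : left_stable N -> N x -> N (- x).
Proof. by move=> sN Nx; rewrite -mulN1r; apply: left_stableM. Qed.

Lemma left_stableB N x y : left_stable N -> N x -> N y -> N (x - y).
Proof. by move=> sN Nx Ny; apply: left_stableD => //; apply: left_stableN. Qed.

Lemma left_stable_translates N : N 0 -> (forall x y, N x -> N y -> N (x + y)) ->
  (forall r x, N x -> N (rscale r x)) -> (forall g x, N x -> N (translate g x)) ->
    left_stable N.
Proof.
move=> N0 ND Nr Nt; split=> // a x Nx; rewrite grpalg_mul_translates.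
by elim/big_rec: _ => // g y _ Ny; apply: ND Ny; apply/Nr/Nt.
Qed.

Lemma rscaleDl r s x : rscale (r + s) x = rscale r x + rscale s x.
Proof. by apply/ffunP => g; rewrite !(grpalg_addE, rscaleE) mulrDl. Qed.

Lemma rscaleA r s x : rscale r (rscale s x) = rscale (r * s) x.
Proof. by apply/ffunP => g; rewrite !rscaleE mulrA. Qed.

Lemma rscale1 x : rscale 1 x = x.
Proof. by apply/ffunP => g; rewrite rscaleE mul1r. Qed.

Lemma rscaleDr r x y : rscale r (x + y) = rscale r x + rscale r y.
Proof. by apply/ffunP => g; rewrite !(grpalg_addE, rscaleE) mulrDr. Qed.

Lemma rscale_nat k x : rscale k%:R x = x *+ k.
Proof. by apply/ffunP => g; rewrite rscaleE grpalg_mulrnE mulr_natl. Qed.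

Lemma rscale_mulr r a x : rscale r (a * x) = a * rscale r x.
Proof.
apply/ffunP => g; rewrite rscaleE !grpalg_mulE mulr_sumr; apply: eq_bigr => h _.
by rewrite rscaleE mulrCA.
Qed.

Lemma rscale_mull r a x : rscale r a * x = rscale r (a * x).
Proof. by rewrite rscale_mul -mulrA -rscale_mul. Qed.

Lemma rscale_translate r g x : rscale r (translate g x) = translate g (rscale r x).
Proof. by rewrite -!geltM rscale_mulr. Qed.

End LeftSubmodules.

Section Reduction.
Variables (n : nat) (F : finFieldType) (R : idomainType) (l : nat).
Hypothesis R_char0 : [pchar R] =i pred0.
Local Notation G := (GLn n F).
Local Notation P := (@GLperm n F).
Local Notation B := (GLborel n F).
Local Notation U := (unitri n F).
Local Notation RG := (grpalg R G).
Local Notation apt := (apartment n F R).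
Local Notation St := (Steinberg n F R).
Local Notation w0 := (P (@long n.-1)).
Local Notation sw := ((-1) ^+ (@long n.-1) : R).
Implicit Types (g h u v b : G) (a x y z : RG) (r s : R) (N : RG -> Prop).

Definition ldvd r := exists s, r = s * l%:R.

Hypothesis l_prime : prime l.
Hypothesis l_nunit : ~ ldvd 1.
Hypothesis l_max : forall r, ~ ldvd r -> exists s t, s * r + t * l%:R = 1.

Lemma ldvdD r s : ldvd r -> ldvd s -> ldvd (r + s).
Proof. by move=> [r' ->] [s' ->]; exists (r' + s'); rewrite mulrDl. Qed.

Lemma ldvdMl r s : ldvd s -> ldvd (r * s).
Proof. by move=> [s' ->]; exists (r * s'); rewrite mulrA. Qed.

Lemma l_neq0 : l%:R != 0 :> R.
Proof. by rewrite (natrR_eq0 R_char0) -lt0n prime_gt0. Qed.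

(** The ideal generated by l is maximal, hence prime. *)
Lemma nldvdM r s : ~ ldvd r -> ~ ldvd s -> ~ ldvd (r * s).
Proof.
move=> /l_max[a [b ab]] ns lrs; apply: ns; rewrite -[s]mul1r -ab mulrDl.
by apply: ldvdD; [rewrite -mulrA; apply: ldvdMl|exists (b * s); rewrite mulrAC].
Qed.

Lemma nldvd_nat k : ~~ (l %| k)%N -> ~ ldvd k%:R.
Proof.
move=> lk [r kE]; apply: l_nunit.
have k0 : (0 < k)%N by case: k lk {kE} => //; rewrite dvdn0.
have cop : gcdn k l = 1%N by apply/eqP;
  rewrite -[_ == _]/(coprime k l) coprime_sym prime_coprime.
case: (egcdnP l k0) => u v; rewrite cop => uv _.
exists (u%:R * r - v%:R); rewrite mulrBl -mulrA -kE -!natrM uv.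
by rewrite natrD addrC addKr.
Qed.

Lemma nldvdX r k : ~ ldvd r -> ~ ldvd (r ^+ k).
Proof. by move=> nr; elim: k => [|k IH]; rewrite ?exprS //; apply: nldvdM. Qed.

Lemma nldvd_sign (e : bool) : ~ ldvd ((-1) ^+ e).
Proof.
by move=> /(ldvdMl ((-1) ^+ e)); rewrite -expr2 sqrr_sign.
Qed.

Lemma nldvdN r : ~ ldvd r -> ~ ldvd (- r).
Proof. by rewrite -mulN1r => nr; apply: nldvdM => //; have := @nldvd_sign true;
  rewrite expr1. Qed.

(** The left ideals with this property are the preimages of the submodules of the
    reduction of the lattice modulo l. *)
Definition contains_lSt N := forall x, x \in St -> N (rscale l%:R x).

(** Scalars prime to l act invertibly modulo l. *)
Lemma left_stable_cancel N r x : left_stable N -> contains_lSt N -> x \in St ->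
  ~ ldvd r ->
  N (rscale r x) -> N x.
Proof.
move=> sN lN xS /l_max[s [t st]] Nrx.
rewrite -[x]rscale1 -st rscaleDl -!rscaleA; apply: left_stableD => //;
  apply: left_stable_rscale => //.
exact: lN.
Qed.

Lemma Steinberg_rscale r x : x \in St -> rscale r x \in St.
Proof. by rewrite rscale_mul; apply: Steinberg_mul. Qed.

Lemma SteinbergD x y : x \in St -> y \in St -> x + y \in St.
Proof. exact: (rpredD (S := St)). Qed.

Lemma Steinberg0 : (0 : RG) \in St.
Proof. exact: (rpred0 St). Qed.

Lemma Steinberg_sum (J : Type) (q : seq J) (Q : pred J) (f : J -> RG) :
  (forall j, Q j -> f j \in St) -> \sum_(j <- q | Q j) f j \in St.
Proof. exact: (rpred_sum (S := St)). Qed.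

Definition lmultiple x := exists2 y, y \in St & x = rscale l%:R y.

(** The values on the big cell are the coordinates in a basis. *)
Lemma lmultiple_big_cell x : x \in St -> (forall u, u \in U ->
  ldvd (x (u * w0)%g)) ->
  lmultiple x.
Proof.
move=> xS xl.
have /choice[f fP] : forall u, exists r, u \in U -> x (u * w0)%g = r * l%:R.
  move=> u; case: (boolP (u \in U)) => [/xl[r ->]|_]; [by exists r|by exists 0].
exists (\sum_(u in U) rscale (sw * f u) (translate u apt)).
  by apply: Steinberg_sum => u _;
    rewrite Steinberg_rscale // Steinberg_translate // Steinberg_apartment.
rewrite {1}(big_cell_expansion R_char0 xS); apply/ffunP => g;
  rewrite rscaleE !grpalg_sumE mulr_sumr.
by apply: eq_bigr => u uU; rewrite !rscaleE fP // [f u * _]mulrC mulrCA !mulrA.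
Qed.

Lemma lmultipleN x : x \in St -> ~ lmultiple x -> exists g, ~ ldvd (x g).
Proof.
move=> xS nx; apply: contrapT => /forallNP xg; apply: nx.
by apply: lmultiple_big_cell => // u _; apply: contrapT; apply: xg.
Qed.

Lemma lmultiple_ldvd x g : lmultiple x -> ldvd (x g).
Proof. by case=> y _ ->; exists (y g); rewrite rscaleE mulrC. Qed.

(** Every nonzero submodule of L contains the invariant vector: if x(g) is a unit
    modulo l, the sum over U of the translate of x by the inverse of g is
    x(g) Ufix. *)
Lemma Ufix_in N x : left_stable N -> contains_lSt N -> x \in St -> N x ->
  ~ lmultiple x ->
  N (Ufix n F R).
Proof.
move=> sN lN xS Nx /(lmultipleN xS)[g ng].
apply: (left_stable_cancel (r := x g)) => //; first exact: Steinberg_Ufix.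
suff -> : rscale (x g) (Ufix n F R) = hatsum R U * translate g^-1%g x.
  by apply: left_stableM => //; apply: left_stable_translate.
by rewrite Uhat_fix ?Steinberg_translate // translateE invgK mulg1.
Qed.

(** I(c), written with the integral form sform. *)
Definition jantzen c x := x \in St /\
  forall y, y \in St -> exists r, sform x y = #|B|%:R * (l%:R ^+ c * r).

Lemma B_neq0 : #|B|%:R != 0 :> R.
Proof. by rewrite (natrR_eq0 R_char0) -lt0n cardG_gt0. Qed.

Lemma jantzen_left_stable c : left_stable (jantzen c).
Proof.
apply: left_stable_translates => [|x y [xS xP] [yS yP]|r x [xS xP]|g x [xS xP]].
- by split=> [|y _]; [exact: Steinberg0|exists 0; rewrite sform0l !mulr0].
- split=> [|z zS]; first exact: SteinbergD.
  have [r rE] := xP z zS; have [s sE] := yP z zS.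
  by exists (r + s); rewrite sformDl rE sE !mulrDr.
- split=> [|z zS]; first exact: Steinberg_rscale.
  have [s sE] := xP z zS.
  by exists (r * s); rewrite sform_rs sE mulrCA (mulrCA r).
split=> [|z zS]; first exact: Steinberg_translate.
by rewrite sform_tr; apply: xP; rewrite Steinberg_translate.
Qed.

(** The pairing of eps with any element is divisible by the order of B, because
    eps is a signed sum of cosets of B on which the other argument is constant. *)
Lemma jantzen0 x : x \in St -> jantzen 0 x.
Proof.
case/SteinbergP => a ->; apply: left_stableM; first exact: jantzen_left_stable.
split=> [|y yS]; first exact: Steinberg_apartment.
by rewrite sform_apartment // expr0;
  exists (\sum_(s : 'S_n.-1.+1) (-1) ^+ s * y (P s)); rewrite mul1r.
Qed.

Lemma jantzen_l c x : x \in St -> jantzen c.+1 (rscale l%:R x) <-> jantzen c x.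
Proof.
move=> xS; split=> -[_ xP]; (split; first by rewrite ?Steinberg_rscale) => y yS.
  have [r rE] := xP y yS; exists r; apply: (mulfI l_neq0).
  by rewrite -sform_rs rE exprS [in RHS]mulrCA !mulrA.
by have [r rE] := xP y yS; exists r; rewrite sform_rs rE exprS mulrCA !mulrA.
Qed.

Lemma jantzen_lX c x : x \in St -> jantzen c (rscale (l%:R ^+ c) x).
Proof.
move=> xS; elim: c => [|c IH]; first by rewrite expr0 rscale1; apply: jantzen0.
by rewrite exprS -rscaleA; apply/jantzen_l => //; apply: Steinberg_rscale.
Qed.

Lemma jantzenW c d x : (c <= d)%N -> jantzen d x -> jantzen c x.
Proof.
move=> cd [xS xP]; split=> // y /xP[r ->].
by exists (l%:R ^+ (d - c) * r); rewrite (mulrA (l%:R ^+ c)) -exprD subnKC.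
Qed.

Lemma jantzen1_contains_lSt : contains_lSt (jantzen 1).
Proof. by move=> x xS; apply/jantzen_l/jantzen0. Qed.

Let idx := #|[set: G] : B|%g.
Let b := logn l idx.

Lemma idx_split : exists m, [/\ ~ ldvd m%:R & forall r, 
  #|[set: G]|%:R * r = #|B|%:R * (l%:R ^+ b * (m%:R * r))].
Proof.
have idx_gt0 : (0 < idx)%N by apply: indexg_gt0.
exists (idx`_l^')%N; split.
  apply: nldvd_nat; rewrite -prime_coprime //.
  by apply: (@pnat_coprime l); rewrite ?pnat_id ?part_pnat.
move=> r; rewrite -(Lagrange (subsetT B)) -/idx natrM -mulrA; congr (_ * _).
by rewrite mulrA -natrX -natrM -p_part partnC.
Qed.

Lemma jantzen_Ufix : jantzen b (Ufix n F R).
Proof.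
split=> [|y yS]; first exact: Steinberg_Ufix.
have [m [_ mE]] := idx_split.
by exists (m%:R * y 1%g); rewrite -{1}[Ufix n F R]translate1 sform_Ufix.
Qed.

(** Pairing with the translates of Ufix reads off every coefficient of x times
    the order of the group, which is #|B| l ^ b times a factor prime to l. *)
Lemma jantzen_above x : jantzen b.+1 x -> lmultiple x.
Proof.
move=> [xS xP]; apply: lmultiple_big_cell => // u _; set g := (u * _)%g.
have [m [nm mE]] := idx_split.
have [r rE] := xP (translate g (Ufix n F R)) (Steinberg_translate _ (Steinberg_Ufix
  _ _ _)).
move: rE; rewrite sformC sform_Ufix // mE => /(mulfI B_neq0).
rewrite exprSr -mulrA => /(mulfI (expf_neq0 _ l_neq0)) GLmx.
apply: contrapT => nx; apply: (nldvdM nm nx); exists r.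
by rewrite GLmx mulrC.
Qed.

(** A functional on the lattice is a combination of evaluations on the big cell,
    and evaluations are pairings with translates of Ufix up to the factor #|G|.
    So if x pairs into l ^ b, a multiple of x prime to l is a combination of
    translates of Ufix; nondegeneracy turns equality of pairings into equality. *)
Lemma jantzen_top x : jantzen b x -> exists a z, z \in St /\
  x = a * Ufix n F R + rscale l%:R z.
Proof.
move=> [xS xP]; have [m [nm mE]] := idx_split.
have /choice[f fP] : forall u, exists r, u \in U ->
    sform x (translate u apt) = #|B|%:R * (l%:R ^+ b * r).
  move=> u; have [r rE] := xP _ (Steinberg_translate u (Steinberg_apartment n F
    R)); by exists r.
pose z := \sum_(u in U) rscale (sw * f u) (translate (u * w0)%g (Ufix n F R)).
have zS : z \in St by apply: Steinberg_sum => u _;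
  rewrite Steinberg_rscale // Steinberg_translate // Steinberg_Ufix.
have sxz y : y \in St -> sform (rscale m%:R x) y = sform z y.
  move=> yS; rewrite {1}(big_cell_expansion R_char0 yS) sform_sumr sform_suml.
  apply: eq_bigr => u uU; rewrite sform_rsr !sform_rs sform_Ufix // fP // mE.
  move: (#|_|%:R : R) (_ ^+ b) ((-1) ^+ _) (m%:R) (y _) (f _) => c1 c2 c3 c4 c5 c6.
  ring.
have xz : rscale m%:R x = z.
  apply/ffunP => g.
  have G0 : #|[set: G]|%:R != 0 :> R by rewrite (natrR_eq0 R_char0) -lt0n cardG_gt0.
  apply: (mulfI G0); rewrite -!sform_Ufix ?Steinberg_rscale //.
  by rewrite sformC sxz ?Steinberg_translate ?Steinberg_Ufix // sformC.
have [s [t st]] := l_max nm.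
exists (\sum_(u in U) rscale (s * (sw * f u)) (gelt R (u * w0)%g)), (rscale t x).
split; first exact: Steinberg_rscale.
transitivity (rscale (s * m%:R + t * l%:R) x); first by rewrite st rscale1.
rewrite rscaleDl rscaleA [l%:R * t]mulrC -rscaleA xz; congr (_ + _).
rewrite mulr_suml /z; apply/ffunP => g; rewrite rscaleE !grpalg_sumE mulr_sumr.
by apply: eq_bigr => u _; rewrite rscale_mull geltM !rscaleE !mulrA.
Qed.

End Reduction.

(** * Projections attached to the superdiagonal characters *)

Section Superdiagonal.
Variables (n : nat) (F : finFieldType).
Local Notation G := (GLn n F).
Local Notation GLmx := (@GLmx n F).
Local Notation P := (@GLperm n F).
Local Notation B := (GLborel n F).
Local Notation U := (unitri n F).
Local Notation w0 := (P (@long n.-1)).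
Implicit Types (g h u v b : G) (i : 'I_n.-1).

(** The superdiagonal entries, additive on U; together they identify U modulo
    its derived subgroup with F ^ (n - 1). *)
Definition sdiag i g : F := GLmx g (lo i) (hi i).

Lemma borel_sdiag i g h : g \in B -> h \in B -> sdiag i (g * h)%g =
  GLmx g (lo i) (lo i) * sdiag i h + sdiag i g * GLmx h (hi i) (hi i).
Proof.
move=> /borelP gB /borelP hB; rewrite /sdiag GLmulE (bigD1 (lo i)) //=.
rewrite (bigD1 (hi i)) /=; last by rewrite eq_sym lo_hi.
rewrite big1 ?addr0 // => k /andP[kl kh].
have [lt_k|le_k] := ltnP k (lo i); first by rewrite gB ?mul0r.
rewrite [X in _ * X]hB ?mulr0 //.
by move: kl kh; rewrite -!val_eqE /= /bump /= in le_k *; lia.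
Qed.

Lemma sdiagM i u v : u \in U -> v \in U ->
  sdiag i (u * v)%g = sdiag i u + sdiag i v.
Proof.
move=> uU vU; rewrite borel_sdiag ?unitri_borel //.
by rewrite !unitri1 // mul1r mulr1 addrC.
Qed.

Lemma sdiag1 i : sdiag i (1%g : G) = 0.
Proof. by rewrite /sdiag GLoneE (negPf (lo_hi i)). Qed.

Lemma sdiagV i u : u \in U -> sdiag i u^-1%g = - sdiag i u.
Proof.
by move=> uU; apply/eqP; rewrite -addr_eq0 -sdiagM ?groupV // mulVg sdiag1.
Qed.

(** Conjugation by this diagonal matrix scales the i-th superdiagonal entry by
    t i exactly, so the diagonal is made of the partial products of t. *)
Definition torus_mx (t : 'I_n.-1 -> F) : 'M[F]_n.-1.+1 :=
  \matrix_(a, c) ((a == c)%:R * \prod_(j : 'I_n.-1 | (a <= j)%N) t j).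
Definition torus (t : 'I_n.-1 -> F) : G := GL_of_mx (torus_mx t).

Section Torus.
Variable t : 'I_n.-1 -> F.
Hypothesis t0 : forall i, t i != 0.

Lemma torusE a c : GLmx (torus t) a c =
  (a == c)%:R * \prod_(j : 'I_n.-1 | (a <= j)%N) t j.
Proof.
rewrite GL_of_mxK ?mxE // upper_unit // => [i j ji|i]; rewrite mxE.
  by rewrite -val_eqE gtn_eqF // mul0r.
by rewrite eqxx mul1r; apply/prodf_neq0 => j _.
Qed.

Lemma torus_borel : torus t \in B.
Proof. by apply/borelP => a c ca; rewrite torusE -val_eqE gtn_eqF // mul0r. Qed.

Lemma torus_lo i : GLmx (torus t) (lo i) (lo i) =
  t i * GLmx (torus t) (hi i) (hi i).
Proof.
rewrite !torusE !eqxx !mul1r (bigD1 i) ?leqnn //=; congr (_ * _).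
by apply: eq_bigl => j; rewrite -val_eqE /= /bump /=; lia.
Qed.

Lemma torus_sdiag i u : u \in U ->
  sdiag i ((torus t)^-1 * u * torus t)%g = (t i)^-1 * sdiag i u.
Proof.
move=> uU; have uB := unitri_borel uU; have tB := torus_borel.
have cU : ((torus t)^-1 * u * torus t)%g \in U.
  by have := unitriJ (groupVr tB) uU; rewrite invgK.
set v := (_ * _)%g in cU *.
have : sdiag i (torus t * v)%g =
  sdiag i (u * torus t)%g by rewrite /v !mulgA mulgV mul1g.
have t_sd : sdiag i (torus t) = 0 by rewrite /sdiag torusE (negPf (lo_hi i)) mul0r.
clearbody v; rewrite !borel_sdiag ?(unitri_borel cU) //
  t_sd mul0r mulr0 addr0 add0r torus_lo.
rewrite [sdiag i u * _]mulrC -mulrA mulrCA => /(mulfI (borel_diag _ tB)) <-.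
by rewrite mulKf.
Qed.

Lemma torus_long : (w0^-1 * torus t * w0)%g \in B.
Proof.
apply/borelP => a c ca.
rewrite GLmul_perm -GLpermV GLperm_mul torusE //.
by rewrite (inj_eq perm_inj) -val_eqE gtn_eqF // mul0r.
Qed.

End Torus.
End Superdiagonal.

Section Whittaker.
Variables (n : nat) (F : finFieldType) (R : idomainType) (l : nat).
Hypothesis R_char0 : [pchar R] =i pred0.
Local Notation G := (GLn n F).
Local Notation P := (@GLperm n F).
Local Notation B := (GLborel n F).
Local Notation U := (unitri n F).
Local Notation RG := (grpalg R G).
Local Notation apt := (apartment n F R).
Local Notation St := (Steinberg n F R).
Local Notation w0 := (P (@long n.-1)).
Local Notation sw := ((-1) ^+ (@long n.-1) : R).
Local Notation q := (#|F|%:R : R).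
Implicit Types (g h u v b : G) (x y z : RG) (r s : R) (S : {set 'I_n.-1}).

(** The coefficients of q [0] - \sum_a [a] in the group algebra of F, which is q
    times the projection onto the augmentation ideal. *)
Definition aug (a : F) : R := q * (a == 0)%:R - 1.
Definition whit_coef S u : R := \prod_(i in S) aug (sdiag i u).
(** A multiple, by the order of U, of the idempotent that projects onto the
    characters of U which are trivial on the simple root groups outside S and
    nontrivial on those in S. For S = setT the characters are the
    nondegenerate ones. *)
Definition whit S : RG := [ffun g => if g \in U then whit_coef S g else 0].

Lemma whit_mulE S x g : (whit S * x) g =
  \sum_(u in U) whit_coef S u * x (u^-1 * g)%g.
Proof.
rewrite grpalg_mulE [RHS]big_mkcond; apply: eq_bigr => u _ /=.
by rewrite ffunE; case: ifP; rewrite ?mul0r.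
Qed.

Lemma augN a : aug (- a) = aug a.
Proof. by rewrite /aug oppr_eq0. Qed.

Lemma whit_coefV S u : u \in U -> whit_coef S u^-1%g = whit_coef S u.
Proof. by move=> uU; apply: eq_bigr => i _; rewrite sdiagV // augN. Qed.

Lemma whit_translate S v x : v \in U ->
  whit S * translate v x = translate v (whit S * x).
Proof.
move=> vU; apply/ffunP => g; rewrite translateE !whit_mulE.
have inj : injective (fun u => (v * u * v^-1)%g) by move=> u u' /mulIg/mulgI.
rewrite (reindex_inj inj) /=; apply: eq_big => u.
  by rewrite groupMr ?groupV // groupMl.
rewrite groupMr ?groupV // groupMl // => uU; rewrite translateE; congr (_ * x _).
  apply: eq_bigr => i _; rewrite !sdiagM ?groupM ?groupV // sdiagV //.
  by rewrite addrAC subrr add0r.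
by rewrite !invMg invgK !mulgA mulVg mul1g.
Qed.

Lemma whit_big_cell S x u : x \in St -> u \in U -> (whit S * x) (u * w0)%g =
  \sum_(v in U) whit_coef S (u * v^-1)%g * x (v * w0)%g.
Proof.
move=> xS uU; rewrite whit_mulE.
have inj : injective (fun v => (u * v^-1)%g) by move=> v v' /mulgI/invg_inj.
rewrite (reindex_inj inj) /=; apply: eq_big => v.
  by rewrite groupMl // groupV.
by move=> _; rewrite invMg invgK -!mulgA mulKg.
Qed.

Lemma Steinberg_eq_big_cell x y : x \in St -> y \in St ->
  (forall u, u \in U -> x (u * w0)%g = y (u * w0)%g) -> x = y.
Proof.
move=> xS yS xy; rewrite (big_cell_expansion R_char0 xS) (big_cell_expansion
  R_char0 yS).
by apply: eq_bigr => u uU; rewrite xy.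
Qed.

Lemma whit_apartment_big_cell S u : u \in U ->
  (whit S * apt) (u * w0)%g = sw * whit_coef S u.
Proof.
move=> uU; rewrite whit_big_cell ?Steinberg_apartment //
  (bigD1 1%g) //= big1 ?addr0.
  by rewrite apartment_big_cell ?group1 // eqxx invg1 mulg1 mulr1 mulrC.
by move=> v /andP[vU v1]; rewrite apartment_big_cell // (negPf v1) !mulr0.
Qed.

(** Averaging over the dilations of F makes a function of augmentation type
    proportional to aug, since the dilations are transitive on nonzero elements. *)
Lemma aug_torus_sum (d e : F) :
  \sum_(t : F | t != 0) aug (t^-1 * d - e) = aug d * aug e.
Proof.
have cardFx : \sum_(t : F | t != 0) (1 : R) = q - 1.
  have <- : \sum_(t : F) (1 : R) = q by rewrite sumr_const.
  by rewrite [in RHS](bigD1 (0 : F)) //= addrC addrK.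
rewrite /aug sumrB cardFx -mulr_sumr.
have [->|d0] := eqVneq d 0; have [->|e0] := eqVneq e 0.
- under eq_bigr => t _ do rewrite mulr0 subr0 eqxx.
  by rewrite cardFx mulr1; ring.
- rewrite big1 => [|t _]; last by rewrite mulr0 add0r oppr_eq0 (negPf e0).
  by rewrite /=; ring.
- rewrite big1 /=; first by ring.
  by move=> t t0; rewrite subr0 mulf_eq0 invr_eq0 (negPf t0) (negPf d0).
rewrite (bigD1 (d / e)) /=; last by rewrite mulf_neq0 ?invr_eq0.
rewrite invf_div mulrVK ?unitfE // subrr eqxx big1; first by rewrite /=; ring.
move=> t /andP[t0 te]; rewrite subr_eq0; case: eqP => // /(canRL (mulVKf t0)) dE.
by move: te; rewrite dE mulfK ?eqxx.
Qed.

(** Only the coordinates in S vary: averaging over the others would bring in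
    factors q - 1, which l may divide. *)
Definition torus_params S := [pred t : {ffun 'I_n.-1 -> F} | t \in
  family (fun i => if i \in S then [pred x : F | x != 0] else pred1 1)].

Lemma torus_params_neq0 S (t : {ffun 'I_n.-1 -> F}) i : t \in torus_params S ->
  t i != 0.
Proof.
rewrite inE => /familyP/(_ i); case: ifP => _; rewrite inE // => /eqP->.
exact: oner_neq0.
Qed.

Lemma torus_params_sum S (d e : 'I_n.-1 -> F) :
  \sum_(t in torus_params S) \prod_(i in S) aug ((t i)^-1 * d i - e i) =
  (\prod_(i in S) aug (d i)) * (\prod_(i in S) aug (e i)).
Proof.
rewrite -big_split /=.
pose f i (a : F) : R := if i \in S then aug (a^-1 * d i - e i) else 1.
pose Q i := if i \in S then [pred a : F | a != 0] else pred1 1.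
transitivity (\sum_(t in family Q) \prod_i f i (t i)).
  by apply: eq_big => [t|t _]; rewrite ?inE // big_mkcond.
rewrite -(bigA_distr_big_dep _ f) [RHS]big_mkcond; apply: eq_bigr => i _ /=.
rewrite /f /Q; case: ifP => iS; first by rewrite -aug_torus_sum.
by rewrite big_pred1_eq.
Qed.

(** The image of the projection is spanned by the U-translates of one vector, and
    the torus permutes its characters transitively. So the torus average of
    whit S * x is a multiple of whit S * eps, the factor being its value at w0. *)
Lemma torus_sum_whit S x : x \in St ->
  \sum_(t in torus_params S) translate (torus t) (whit S * x) =
  rscale (sw * (whit S * x) w0) (whit S * apt).
Proof.
move=> xS; have nuS : whit S * x \in St by rewrite Steinberg_mul.
apply: Steinberg_eq_big_cell => [||u uU].
- by apply: Steinberg_sum => t _; rewrite Steinberg_translate.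
- by rewrite Steinberg_rscale // Steinberg_mul // Steinberg_apartment.
rewrite rscaleE whit_apartment_big_cell // mulrACA sw2 mul1r grpalg_sumE.
rewrite -{2}[w0]mul1g whit_big_cell ?group1 // mulr_suml.
pose c (t : {ffun 'I_n.-1 -> F}) := ((torus t)^-1 * u * torus t)%g.
transitivity (\sum_(t in torus_params S) (whit S * x) (c t * w0)%g).
  apply: eq_bigr => t tS; have t0 i := torus_params_neq0 i tS.
  have [xB _] := Steinberg_cycle R_char0 nuS.
  rewrite translateE -(xB _ _ (torus_long t0)); congr (fun_of_fin (whit S * x) _).
  by rewrite /c -!mulgA mulKVg.
transitivity (\sum_(t in torus_params S) \sum_(v in U) whit_coef S (c t * v^-1)%g *
  x (v * w0)%g).
  apply: eq_bigr => t tS; have t0 i := torus_params_neq0 i tS;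
    rewrite whit_big_cell //.
  by have := unitriJ (groupVr (torus_borel t0)) uU; rewrite invgK.
rewrite exchange_big; apply: eq_bigr => v vU /=.
rewrite -mulr_suml mulrAC; congr (_ * _); rewrite mul1g whit_coefV // mulrC.
rewrite -torus_params_sum; apply: eq_bigr => t tS; apply: eq_bigr => i _.
have t0 j := torus_params_neq0 j tS.
rewrite sdiagM ?groupV // ?sdiagV ?torus_sdiag //.
by have := unitriJ (groupVr (torus_borel t0)) uU; rewrite invgK.
Qed.

Local Notation ldvd := (@ldvd R l).
Hypothesis l_prime : prime l.
Hypothesis l_nunit : ~ ldvd 1.
Hypothesis l_max : forall r, ~ ldvd r -> exists s t, s * r + t * l%:R = 1.
Local Notation contains_lSt := (@contains_lSt n F R l).
Local Notation lmultiple := (@lmultiple n F R l).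

(** The torus average of torus_sum_whit, applied to a translate of x whose
    projection has a value prime to l at w0. *)
Lemma whit_in N S x : left_stable N -> contains_lSt N -> x \in St -> N x ->
  ~ lmultiple (whit S * x) -> N (whit S * apt).
Proof.
move=> sN lN xS Nx nm; have nuS : whit S * x \in St by rewrite Steinberg_mul.
have [u uU ndu] : exists2 u, u \in U & ~ ldvd ((whit S * x) (u * w0)%g).
  apply: contrapT => /forall2NP xu; apply: nm; apply: lmultiple_big_cell => // u uU.
  by apply: contrapT => ndu; case: (xu u).
have := torus_sum_whit S (Steinberg_translate u^-1%g xS).
rewrite whit_translate ?groupV // translateE invgK => xE.
apply: (left_stable_cancel l_max (r := sw * (whit S * x) (u * w0)%g)) => //.
- by rewrite Steinberg_mul // Steinberg_apartment.
- by apply: nldvdM => //; apply: nldvd_sign.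
rewrite -xE; apply: left_stable_sum => // t _.
by do 2 apply: left_stable_translate => //; apply: left_stableM.
Qed.

End Whittaker.

(** * From the nondegenerate projection to the degenerate ones *)

Section BlockOrder.
Variables (m : nat) (S : {set 'I_m}).
Implicit Types (a b c : 'I_m.+1).

(** The indices lo i and hi i lie in the same block exactly when i is in S; the
    blocks are those of the Levi subgroup whose simple roots are in S. *)
Definition block_index a : nat := #|[set i : 'I_m | (i < a)%N && (i \notin S)]|.

Lemma block_index_mono a b : (a <= b)%N -> (block_index a <= block_index b)%N.
Proof.
move=> ab; apply/subset_leq_card/subsetP => i; rewrite !inE => /andP[ia ->].
by rewrite (leq_trans ia).
Qed.

Lemma block_index_hi (i : 'I_m) : (block_index (lo i) == block_index (hi i)) =
  (i \in S).
Proof.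
apply/eqP/idP => [e|iS].
  apply: contraT => iS; suff : (block_index (lo i) < block_index (hi i))%N by move:
    e; lia.
  apply: proper_card; apply/properP; split.
    by apply/subsetP => j; rewrite !inE => /andP[ji ->]; rewrite hiE ltnS ltnW.
  by exists i; rewrite !inE iS andbT /= ?/bump /=; lia.
congr #|pred_of_set _|; apply/setP => j; rewrite !inE.
have -> : (j < hi i)%N = (j < i)%N || (j == i).
  by rewrite -val_eqE /= /bump /=; lia.
by case: eqVneq => [->|_]; rewrite ?orbF // iS !andbF.
Qed.

Definition block_prec a b : bool := (block_index b < block_index a)%N ||
  (block_index a == block_index b) && (a < b)%N.

Lemma block_prec_irr a : block_prec a a = false.
Proof. by rewrite /block_prec !ltnn andbF. Qed.

Lemma block_prec_trans b a c : block_prec a b -> block_prec b c -> block_prec a c.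
Proof. rewrite /block_prec; lia. Qed.

Lemma block_prec_total a b : a != b -> block_prec a b || block_prec b a.
Proof. by rewrite /block_prec -val_eqE /=; lia. Qed.

Lemma block_rank_lt a : (#|[set c | block_prec c a]| < m.+1)%N.
Proof.
rewrite -[X in (_ < X)%N]card_ord -cardsT; apply: proper_card.
by apply/properP; split; [exact: subsetT|exists a; rewrite !inE // block_prec_irr].
Qed.

Definition block_rank a : 'I_m.+1 := Ordinal (block_rank_lt a).

Lemma block_rank_prec a b : block_prec a b -> (block_rank a < block_rank b)%N.
Proof.
move=> ab; apply: proper_card; apply/properP; split.
  by apply/subsetP => c; rewrite !inE => /block_prec_trans; apply.
by exists a; rewrite !inE // block_prec_irr.
Qed.

Lemma block_rank_inj : injective block_rank.
Proof.
move=> a b ab; apply/eqP; apply: contraT =>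
  /block_prec_total/orP[] /block_rank_prec;
  by rewrite ab ltnn.
Qed.

(** The permutation that keeps the order inside each block and reverses the
    order of the blocks, obtained by ranking. It conjugates the Levi subgroup of
    S to a standard one and makes the unipotent radical opposite. *)
Definition block_perm : 'S_m.+1 := perm block_rank_inj.

Lemma block_perm_prec a b : block_prec a b -> (block_perm a < block_perm b)%N.
Proof. by rewrite !permE; apply: block_rank_prec. Qed.

Lemma block_perm_lt a b : (block_perm a < block_perm b)%N -> block_prec a b.
Proof.
move=> ab; have : a != b by apply: contraTneq ab => ->; rewrite ltnn.
by move/block_prec_total/orP => [//|/block_perm_prec]; lia.
Qed.

Lemma block_perm_hi (i : 'I_m) : i \in S ->
  block_perm (hi i) = (block_perm (lo i)).+1 :> nat.
Proof.
move=> iS; have e : block_index (lo i) = block_index (hi i) by apply/eqP;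
  rewrite block_index_hi.
rewrite !permE /=.
have -> : [set c | block_prec c (hi i)] = lo i |: [set c | block_prec c (lo i)].
  apply/setP => c; rewrite !inE /block_prec -e.
  case: (eqVneq c (lo i)) => [->|]; rewrite /= ?/bump /=; first by lia.
  by rewrite -val_eqE /=; lia.
by rewrite cardsU1 inE block_prec_irr.
Qed.

(** Two indices of the same block with consecutive images are consecutive, since
    an index between them would have its image in between. *)
Lemma block_perm_next a b : block_perm b = (block_perm a).+1 :> nat ->
  block_index a = block_index b -> (a < b)%N ->
  exists2 i, i \in S & a = lo i /\ b = hi i.
Proof.
move=> ab e lt_ab.
have [lt_c|] := ltnP a.+1 b.
  pose c : 'I_m.+1 := Ordinal (ltn_trans lt_c (ltn_ord b)).
  have ec : block_index a = block_index c.
    have := @block_index_mono a c (leqnSn a);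
      have := @block_index_mono c b (ltnW lt_c); lia.
  have /block_perm_prec : block_prec a c by rewrite /block_prec ec eqxx /= ltnSn
    orbT.
  have /block_perm_prec : block_prec c b by rewrite /block_prec -ec e eqxx /= lt_c
    orbT.
  lia.
move=> ba; have lt_m : (a < m)%N by have := ltn_ord b; lia.
have al : a = lo (Ordinal lt_m) by apply: val_inj.
have bh : b = hi (Ordinal lt_m) by apply: val_inj => /=; rewrite /bump /=; lia.
by exists (Ordinal lt_m) => //; rewrite -block_index_hi -al -bh e.
Qed.

(** The simple root of the conjugated Levi subgroup that corresponds to i; the
    default value i is only taken outside S. *)
Definition block_shift (i : 'I_m) : 'I_m := insubd i (val (block_perm (lo i))).

Lemma block_shift_lo i : i \in S -> lo (block_shift i) = block_perm (lo i).
Proof.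
move=> iS; apply: val_inj; rewrite /= insubdK //.
by have := ltn_ord (block_perm (hi i)); rewrite block_perm_hi.
Qed.

Lemma block_shift_hi i : i \in S -> hi (block_shift i) = block_perm (hi i).
Proof.
move=> iS; apply: val_inj; transitivity (lo (block_shift i)).+1; first exact: hiE.
by rewrite block_shift_lo // -block_perm_hi.
Qed.

Lemma block_shift_inj : {in S &, injective block_shift}.
Proof.
move=> i j iS jS ij; apply: val_inj.
by have := block_shift_lo iS; rewrite ij block_shift_lo // =>
  /perm_inj/(congr1 val).
Qed.

End BlockOrder.

Section BlockPart.
Variables (n : nat) (F : finFieldType) (S : {set 'I_n.-1}).
Local Notation G := (GLn n F).
Local Notation GLmx := (@GLmx n F).
Local Notation P := (@GLperm n F).
Local Notation B := (GLborel n F).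
Local Notation U := (unitri n F).
Local Notation w0 := (P (@long n.-1)).
Implicit Types (g h u v b : G) (i : 'I_n.-1) (a c : 'I_n.-1.+1).

(** The projection of U onto the unitriangular group of the Levi subgroup. *)
Definition block_part u : G :=
  GL_of_mx (\matrix_(a, c) (if block_index S a == block_index S c then GLmx u a c
    else 0)).

Lemma block_partP u : u \in U -> block_part u \in U /\
  forall a c, GLmx (block_part u) a c =
    if block_index S a == block_index S c then GLmx u a c else 0.
Proof.
move=> uU; pose A := (\matrix_(a, c) (if block_index S a == block_index S c then
  GLmx u a c else 0)
  : 'M[F]_n.-1.+1).
have [] := @unitri_of_mx n F A.
- by move=> a c ca; rewrite mxE unitri0 // if_same.
- by move=> a; rewrite mxE eqxx unitri1.
by rewrite -/(block_part u) => mE mU; split=> // a c; rewrite mE mxE.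
Qed.

(** A path a <= k <= c with a and c in one block stays in that block. *)
Lemma block_partM u v : u \in U -> v \in U ->
  block_part (u * v)%g = (block_part u * block_part v)%g.
Proof.
move=> uU vU; have [_ uvE] := block_partP (groupM uU vU).
have [_ uE] := block_partP uU; have [_ vE] := block_partP vU.
apply: GLmx_ext => a c; rewrite uvE !GLmulE.
under [RHS]eq_bigr => k _ do rewrite uE vE.
case: (eqVneq (block_index S a) (block_index S c)) => [ac|ac]; last first.
  rewrite big1 // => k _; case: eqVneq => [e|_]; last by rewrite mul0r.
  by rewrite -e (negPf ac) mulr0.
apply: eq_bigr => k _; have [ka|ak] := ltnP k a.
  by rewrite !(unitri0 _ ka) // if_same !mul0r.
have [ck|kc] := ltnP c k.
  by rewrite !(unitri0 _ ck) // if_same !mulr0.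
have ek : block_index S a = block_index S k.
  by have := @block_index_mono _ S a k ak; have := @block_index_mono _ S k c kc;
    lia.
by rewrite -ac ek eqxx.
Qed.

Lemma block_part_id u : u \in U -> block_part (block_part u) = block_part u.
Proof.
move=> uU; have [mU mE] := block_partP uU; have [_ mmE] := block_partP mU.
by apply: GLmx_ext => a c; rewrite mmE !mE; case: (_ == _).
Qed.

Lemma block_part_kernel u : u \in U -> block_part ((block_part u)^-1 * u)%g = 1%g.
Proof.
move=> uU; have [mU _] := block_partP uU.
apply: (mulgI (block_part u)); rewrite mulg1 -{1}(block_part_id uU) -block_partM
  ?groupM ?groupV //.
by rewrite mulKVg.
Qed.

Local Notation Q := (P (block_perm S)).

Lemma block_perm_conj u a c :
  GLmx (Q^-1 * u * Q)%g (block_perm S a) (block_perm S c) = GLmx u a c.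
Proof. by rewrite GLmul_perm -GLpermV GLperm_mul !permK. Qed.

Definition transfer u : G := (Q^-1 * block_part u * Q)%g.

Lemma transfer_U u : u \in U -> transfer u \in U.
Proof.
move=> uU; have [mU mE] := block_partP uU; apply/unitriP; split=> [a c|a].
  rewrite /transfer -{1 2}(permKV (block_perm S) a) -{1 2}(permKV (block_perm S) c).
  set a' := _ a; set c' := _ c => ca; rewrite block_perm_conj mE.
  case: eqVneq => // e; have := block_perm_lt ca;
    rewrite /block_prec e ltnn eqxx /= => ca'.
  exact: unitri0.
by rewrite /transfer -(permKV (block_perm S) a) block_perm_conj unitri1.
Qed.

(** The part of u in the unipotent radical ends up in B after conjugation by the
    permutation that reverses each block, so that it disappears in the coset. *)
Lemma transfer_coset u : u \in U -> exists2 b, b \in B &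
  (Q^-1 * u * Q * w0^-1 = transfer u * w0 * b)%g.
Proof.
move=> uU; have [mU _] := block_partP uU.
have w0V : w0^-1%g = w0 by rewrite -GLpermV longV.
pose v := ((block_part u)^-1 * u)%g; have vU : v \in U by rewrite groupM ?groupV.
exists (w0^-1 * (Q^-1 * v * Q) * w0)%g; last first.
  by rewrite {1}w0V /transfer /v !mulgA !mulgK.
apply/borelP => a c ca; rewrite GLmul_perm -GLpermV GLperm_mul longV.
rewrite -(permKV (block_perm S) (long _ a)) -(permKV (block_perm S) (long _ c)).
set a' := _ (long _ a); set c' := _ (long _ c); rewrite block_perm_conj.
have : (block_perm S a' < block_perm S c')%N.
  by rewrite !permKV !longE; have := ltn_ord a; lia.
move=> /block_perm_lt; rewrite /block_prec => /orP[lt_blk|/andP[eq_blk lt_ac]].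
  rewrite unitri0 // ltnNge; apply/negP => /(@block_index_mono _ S); lia.
have [_ vE] := block_partP vU.
have := vE a' c'; rewrite block_part_kernel // eq_blk GLoneE -val_eqE ltn_eqF //.
Qed.

Lemma transfer_sdiag u i : u \in U -> i \in S ->
  sdiag (block_shift S i) (transfer u) = sdiag i u.
Proof.
move=> uU iS; have [_ mE] := block_partP uU.
by rewrite /sdiag /transfer block_shift_lo // block_shift_hi //
  block_perm_conj mE block_index_hi iS.
Qed.

Lemma transfer_sdiag0 u j : u \in U -> j \notin block_shift S @: S ->
  sdiag j (transfer u) = 0.
Proof.
move=> uU jS; have [mU mE] := block_partP uU; rewrite /sdiag /transfer.
rewrite -(permKV (block_perm S) (lo j)) -(permKV (block_perm S) (hi j)).
set a := _ (lo j); set c := _ (hi j); rewrite block_perm_conj mE.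
case: eqVneq => // e; have [lt_ac|le_ca] := ltnP a c; last first.
  rewrite unitri0 // ltn_neqAle le_ca andbT val_eqE.
  by rewrite (inj_eq perm_inj) eq_sym lo_hi.
have next : block_perm S c = (block_perm S a).+1 :> nat by rewrite !permKV;
  exact: hiE.
have [i iS [ai ci]] := block_perm_next next e lt_ac.
case/negP: jS; apply/imsetP; exists i => //; apply: val_inj.
have := block_shift_lo iS; rewrite -ai permKV => /(congr1 val) /= e'.
by rewrite e'.
Qed.

End BlockPart.

Section CardU.
Variables (n : nat) (F : finFieldType).
Local Notation G := (GLn n F).
Local Notation GLmx := (@GLmx n F).
Local Notation U := (unitri n F).
Implicit Types (g u v : G).

(** The order of U is a power of the order of F: as a set, U is a product
    of copies of F and of one-point sets. *)
Lemma prime_unitri l : prime l -> ~~ (l %| #|F|)%N -> ~~ (l %| #|U|)%N.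
Proof.
move=> lp lF.
pose Q (ij : 'I_n.-1.+1 * 'I_n.-1.+1) : pred F :=
  if (ij.1 < ij.2)%N then predT else pred1 (ij.1 == ij.2)%:R.
pose f (w : {ffun 'I_n.-1.+1 * 'I_n.-1.+1 -> F}) : G :=
  GL_of_mx (\matrix_(i, j) w (i, j)).
have fE w : w \in family Q -> f w \in U /\ forall i j, GLmx (f w) i j = w (i, j).
  move=> /familyP wQ; pose A := \matrix_(i, j) w (i, j) : 'M[F]_n.-1.+1.
  have [] := @unitri_of_mx n F A.
  - move=> i j ji; rewrite mxE; have := wQ (i, j); rewrite /Q /= ltnNge ltnW //=.
    by rewrite -val_eqE gtn_eqF // inE => /eqP.
  - by move=> i; rewrite mxE; have := wQ (i, i);
    rewrite /Q /= ltnn eqxx inE => /eqP.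
  by move=> fwE fwU; split=> // i j; rewrite /f fwE mxE.
have -> : #|U| = #|family Q|.
  rewrite -(card_in_imset (f := f)) => [|w w' /fE[_ wE] /fE[_ wE'] ww'].
    apply: eq_card => u; apply/idP/imsetP => [uU|[w /fE[fU _] ->]//].
    have uQ : [ffun ij => GLmx u ij.1 ij.2] \in family Q.
      apply/familyP => -[i j]; rewrite ffunE /Q /=; case: ltnP => // le_ji.
      rewrite inE; case: (eqVneq i j) => [->|ij]; first by rewrite unitri1.
      by rewrite unitri0 // ltn_neqAle le_ji andbT val_eqE eq_sym.
    exists [ffun ij => GLmx u ij.1 ij.2] => //; have [_ wE] := fE _ uQ.
    by apply: GLmx_ext => i j; rewrite wE ffunE.
  by apply/ffunP => -[i j]; rewrite -wE ww' wE'.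
rewrite card_family /image_mem; elim: (enum_mem _) => [|ij s IH] /=.
  by rewrite dvdn1 neq_ltn prime_gt1 // orbT.
rewrite Euclid_dvdM // negb_or IH andbT /Q; case: ifP => _; first by [].
by rewrite card1 dvdn1 neq_ltn prime_gt1 // orbT.
Qed.

Lemma sdiag_surj (a : 'I_n.-1 -> F) : exists2 u, u \in U & forall i, sdiag i u =
  a i.
Proof.
pose A := \matrix_(r, c) ((r == c)%:R +
  \sum_(i : 'I_n.-1 | (r == lo i) && (c == hi i)) a i) : 'M[F]_n.-1.+1.
have [] := @unitri_of_mx n F A => [r c cr|r|AE AU].
- rewrite mxE -val_eqE gtn_eqF // add0r big1 // => i /andP[/eqP ri /eqP ci].
  by move: cr; rewrite ri ci /= /bump /=; lia.
- rewrite mxE eqxx big1 ?addr0 // => i /andP[/eqP ->].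
  by rewrite (negPf (lo_hi i)).
exists (GL_of_mx A) => // i; rewrite /sdiag AE mxE (negPf (lo_hi i)) add0r.
rewrite (big_pred1 i) // => j /=; rewrite -!val_eqE /= /bump /=; lia.
Qed.

Definition unitri' : {set G} := [set u in U | [forall i, sdiag i u == 0]].

Lemma unitri'P u : reflect (u \in U /\ forall i, sdiag i u = 0) (u \in unitri').
Proof.
rewrite inE; apply: (iffP andP) => -[uU u0]; split=> //.
  by move=> i; apply/eqP/(forallP u0).
by apply/forallP => i; rewrite u0.
Qed.

Lemma sdiag_fiber (a : {ffun 'I_n.-1 -> F}) :
  #|[set u in U | [forall i, sdiag i u == a i]]| = #|unitri'|.
Proof.
have [x xU xa] := sdiag_surj a.
rewrite -(card_imset unitri' (mulgI x)); apply: eq_card => u.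
rewrite inE; apply/andP/imsetP => [[uU /forallP ua]|[v /unitri'P[vU v0] ->]].
  exists (x^-1 * u)%g; last by rewrite mulKVg.
  apply/unitri'P; split=> [|i]; first by rewrite groupM ?groupV.
  by rewrite sdiagM ?groupV // sdiagV // xa (eqP (ua i)) addNr.
by split; [rewrite groupM|apply/forallP => i; rewrite sdiagM // xa v0 addr0].
Qed.

Lemma unitri_sum (R : comPzRingType) (H : ('I_n.-1 -> F) -> R) :
  (forall a a', a =1 a' -> H a = H a') ->
  \sum_(u in U) H (fun i => sdiag i u) =
  #|unitri'|%:R * \sum_(a : {ffun 'I_n.-1 -> F}) H a.
Proof.
move=> Hext; pose d u := [ffun i => sdiag i u] : {ffun 'I_n.-1 -> F}.
rewrite (partition_big d xpredT) //= mulr_sumr; apply: eq_bigr => a _.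
rewrite (eq_bigr (fun=> H a)) => [|u /andP[_ /eqP<-]]; last first.
  by apply: Hext => i; rewrite ffunE.
rewrite sumr_const mulr_natl -(sdiag_fiber a); congr (_ *+ _).
apply: eq_card => u; rewrite [in RHS]inE; congr (_ && _).
apply/eqP/forallP => [<- i|ua]; first by rewrite ffunE.
by apply/ffunP => i; rewrite ffunE; apply/eqP.
Qed.

Lemma card_unitri : #|U| = (#|unitri'| * #|F| ^ n.-1)%N.
Proof.
have := @unitri_sum int (fun=> 1) (fun _ _ _ => erefl).
rewrite !sumr_const card_ffun card_ord -natrM => /eqP.
by rewrite Num.Theory.eqr_nat => /eqP.
Qed.

Lemma prime_unitri' l : prime l -> ~~ (l %| #|F|)%N -> ~~ (l %| #|unitri'|)%N.
Proof.
move=> lp lF; have := prime_unitri lp lF; rewrite card_unitri Euclid_dvdM //.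
by rewrite negb_or => /andP[].
Qed.

End CardU.

Section Generation.
Variables (n : nat) (F : finFieldType) (R : idomainType) (l : nat).
Hypothesis R_char0 : [pchar R] =i pred0.
Local Notation G := (GLn n F).
Local Notation P := (@GLperm n F).
Local Notation B := (GLborel n F).
Local Notation U := (unitri n F).
Local Notation U' := (unitri' n F).
Local Notation RG := (grpalg R G).
Local Notation apt := (apartment n F R).
Local Notation St := (Steinberg n F R).
Local Notation w0 := (P (@long n.-1)).
Local Notation sw := ((-1) ^+ (@long n.-1) : R).
Local Notation q := (#|F|%:R : R).
Local Notation ldvd := (@ldvd R l).
Hypothesis l_prime : prime l.
Hypothesis l_nunit : ~ ldvd 1.
Hypothesis l_max : forall r, ~ ldvd r -> exists s t, s * r + t * l%:R = 1.
Hypothesis l_q : ~~ (l %| #|F|)%N.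
Local Notation contains_lSt := (@contains_lSt n F R l).
Local Notation lmultiple := (@lmultiple n F R l).
Local Notation whit := (@whit n F R).
Implicit Types (g h u v b : G) (x y z : RG) (r s : R) (S : {set 'I_n.-1}).

Lemma nldvd_q : ~ ldvd q.
Proof. exact: nldvd_nat. Qed.

Lemma aug_shift_sum : \sum_(a : F) aug R a * aug R (a - 1) = - q.
Proof.
transitivity (\sum_(a : F) (1 - q * (a == 0)%:R - q * (a == 1)%:R)).
  apply: eq_bigr => a _; rewrite /aug subr_eq0.
  case: (eqVneq a 0) => [->|_]; last by case: (a == 1); rewrite /=; ring.
  by rewrite (eq_sym 0) oner_eq0 /=; ring.
rewrite !sumrB sumr_const -!mulr_sumr.
rewrite (bigD1 (0 : F)) //= eqxx big1 ?addr0 => [|a /negPf->//].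
rewrite (bigD1 (1 : F)) //= eqxx big1 ?addr0 => [|a /negPf->//].
have -> : 1 *+ #|F| = q by [].
rewrite /=; ring.
Qed.

Lemma aug_prod_sum S :
  \sum_(a : {ffun 'I_n.-1 -> F}) \prod_(i in S) (aug R (a i) * aug R (a i - 1)) =
  \prod_(i < n.-1) (if i \in S then - q else q).
Proof.
pose f i (t : F) : R := if i \in S then aug R t * aug R (t - 1) else 1.
transitivity (\sum_(a : {ffun 'I_n.-1 -> F}) \prod_i f i (a i)).
  by apply: eq_bigr => a _; rewrite big_mkcond.
rewrite -(bigA_distr_bigA f); apply: eq_bigr => i _; rewrite /f.
by case: ifP => _; [exact: aug_shift_sum|rewrite sumr_const].
Qed.

(** Conjugation by Q = P (block_perm S) turns nondegenerate characters of U into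
    characters that are nondegenerate on the Levi subgroup of S, so a Q-translate
    of a nondegenerate vector can have a nonzero projection of type S. The value
    of that projection at the chamber of Q w0 is, up to sign, a sum over U of a
    product over the simple roots. Each root in S contributes - q and each other
    root contributes q, so that the value is a unit modulo l. The vector is moved
    by v, with superdiagonal entries 1, because the contribution of a root in S
    would otherwise have a factor q - 1, which l may divide. *)
Lemma whit_transfer S : exists x : RG, [/\ x \in St,
  forall N, left_stable N -> N (whit setT * apt) -> N x & ~ lmultiple (whit S * x)].
Proof.
have [v vU v1] := @sdiag_surj n F (fun=> 1).
pose Q : G := P (block_perm S).
pose y := translate v (whit setT * apt).
have yS : y \in St by rewrite Steinberg_translate // Steinberg_mul //
  Steinberg_apartment.
exists (translate Q y); split; first by rewrite Steinberg_translate.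
  by move=> N sN Nnu; do 2 apply: left_stable_translate => //.
move=> /(@lmultiple_ldvd _ _ _ _ _ (Q * w0^-1)%g).
rewrite whit_mulE.
pose k := #|~: (block_shift S @: S)|.
have yE u : u \in U -> y (transfer S u * w0)%g =
    sw * (-1) ^+ k * \prod_(i in S) aug R (sdiag i u - 1).
  move=> uU; have tU := transfer_U S uU.
  rewrite translateE mulgA whit_apartment_big_cell ?(groupM (groupVr vU) tU) //
    -mulrA; congr (_ * _).
  rewrite /whit_coef (eq_bigl xpredT) => [|i]; last by rewrite inE.
  rewrite (bigID [in block_shift S @: S]) /= mulrC; congr (_ * _).
    rewrite (eq_bigr (fun=> -1)) ?prodr_const => [|j jS].
      by congr (_ ^+ _); apply: eq_card => j; rewrite [in RHS]inE.
    rewrite sdiagM ?groupV // sdiagV // v1 transfer_sdiag0 // addr0 augN.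
    by rewrite /aug oner_eq0 mulr0 sub0r.
  rewrite big_imset /=; last exact: block_shift_inj.
  apply: eq_bigr => i iS; rewrite sdiagM ?groupV // sdiagV // v1.
  by rewrite transfer_sdiag // addrC.
have [yB _] := Steinberg_cycle R_char0 yS.
have -> : \sum_(u in U) whit_coef R S u * translate Q y (u^-1 * (Q * w0^-1))%g =
    \sum_(u in U) sw * (-1) ^+ k *
       \prod_(i in S) (aug R (sdiag i u) * aug R (sdiag i u - 1)).
  rewrite (reindex_inj invg_inj) /=; apply: eq_big => u; first by rewrite groupV.
  rewrite groupV => uU; rewrite whit_coefV // invgK translateE !mulgA.
  have [b bB ->] := transfer_coset S uU; rewrite yB // yE //.
  by rewrite big_split /= mulrCA.
rewrite -mulr_sumr.
rewrite (@unitri_sum n F R (fun a =>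
  \prod_(i in S) (aug R (a i) * aug R (a i - 1)))).
  rewrite aug_prod_sum; apply: nldvdM => //.
    by apply: nldvdM => //; [exact: nldvd_sign|apply/nldvdX/nldvdN].
  apply: nldvdM => //; first by apply: nldvd_nat => //; apply: prime_unitri'.
  elim/big_rec: _ => // i r _; apply: nldvdM => //.
  by case: ifP => _; [apply: nldvdN|]; rewrite ?nldvd_q //; apply: nldvd_q.
by move=> a a' aa'; apply: eq_bigr => i _; rewrite aa'.
Qed.

Lemma whit_all N S : left_stable N -> contains_lSt N -> N (whit setT * apt) ->
  N (whit S * apt).
Proof.
move=> sN lN Nnu; have [x [xS /(_ N sN Nnu) Nx nx]] := whit_transfer S.
exact: (whit_in R_char0 l_nunit l_max sN lN xS Nx nx).
Qed.

(** Expand the product over i of aug(d_i) + 1 = q [d_i = 0]. *)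
Lemma sum_whit : \sum_(S : {set 'I_n.-1}) whit S = rscale (q ^+ n.-1) (hatsum R U').
Proof.
apply/ffunP => u; rewrite grpalg_sumE rscaleE hatsumE.
under eq_bigr => S _ do rewrite ffunE.
case: (boolP (u \in U)) => uU; last first.
  by rewrite big1 // inE (negPf uU) mulr0.
transitivity (\prod_(i < n.-1) (q * (sdiag i u == 0)%:R)).
  transitivity (\prod_(i < n.-1) (aug R (sdiag i u) + 1)).
    rewrite bigA_distr; apply: eq_bigr => S _; rewrite /whit_coef big_mkcond /=.
    by apply: eq_bigr => i _; case: ifP.
  by apply: eq_bigr => i _; rewrite /aug subrK.
rewrite big_split /= prodr_const card_ord; congr (_ * _).
case: (boolP (u \in U')) => [/unitri'P[_ u0]|].
  by rewrite big1 // => i _; rewrite u0 eqxx.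
rewrite inE uU /= negb_forall => /existsP[i ui].
by rewrite (bigD1 i) //= (negPf ui) mul0r.
Qed.

Lemma hat'_translate v x : v \in U ->
  hatsum R U' * translate v x = translate v (hatsum R U' * x).
Proof.
move=> vU; apply/ffunP => g; rewrite translateE !hatsum_mulE.
have inj : injective (fun u => (v * u * v^-1)%g) by move=> u u' /mulIg/mulgI.
rewrite (reindex_inj inj) /=; apply: eq_big => u.
  rewrite !inE groupMr ?groupV // groupMl //; case uU : (u \in U) => //=.
  apply: eq_forallb => i; rewrite !sdiagM ?groupM ?groupV // sdiagV //.
  by rewrite addrAC subrr add0r.
by move=> _; rewrite translateE !invMg invgK !mulgA mulVg mul1g.
Qed.

(** The derived group of U fixes the sum of all projections of eps, so the
    projections recover the sum of eps over that group. *)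
Lemma hat'_in N x : left_stable N -> contains_lSt N -> N (whit setT * apt) ->
  x \in St ->
  N (hatsum R U' * x).
Proof.
move=> sN lN Nnu xS.
have Neps : N (hatsum R U' * apt).
  apply: (left_stable_cancel l_max (r := q ^+ n.-1)) => //.
  - by rewrite Steinberg_mul // Steinberg_apartment.
  - exact/nldvdX/nldvd_q.
  rewrite -rscale_mull -sum_whit mulr_suml; apply: left_stable_sum => // S _.
  exact: whit_all.
rewrite (big_cell_expansion R_char0 xS) mulr_sumr;
  apply: left_stable_sum => // u uU.
by rewrite -rscale_mulr hat'_translate //; apply: left_stable_rscale => //;
  apply: left_stable_translate.
Qed.

End Generation.

(** * Generation by the nondegenerate projection *)

(** Matrices that differ from 1 only at the positions allowed by A. For the
    relations used below this is a group of unitriangular matrices. *)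
HB.lock Definition supported (n : nat) (F : finFieldType) (A : rel 'I_n.-1.+1) :
    {set GLn n F} :=
  [set g | [forall a : 'I_n.-1.+1, forall c : 'I_n.-1.+1,
    (GLmx g a c != (a == c)%:R) ==> A a c]].

Section Supports.
Variables (n : nat) (F : finFieldType).
Local Notation G := (GLn n F).
Local Notation GLmx := (@GLmx n F).
Local Notation P := (@GLperm n F).
Local Notation supported := (@supported n F).
Implicit Types (g h : G) (A : rel 'I_n.-1.+1) (a b c i : 'I_n.-1.+1).

Lemma supportedP A g : reflect (forall a c, ~~ A a c -> GLmx g a c = (a == c)%:R)
  (g \in supported A).
Proof.
rewrite supported.unlock inE; apply: (iffP forallP) => [gA a c nA|gA a].
  by have /forallP/(_ c) := gA a; rewrite implyNb (negPf nA) orbF => /eqP.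
by apply/forallP => c; rewrite implyNb orbC -implyNb; apply/implyP => /gA/eqP.
Qed.

Lemma supported_elem A a b x g : a != b -> (forall i, ~~ A i a) -> ~~ A b b ->
  (forall c, A b c -> A a c) -> g \in supported A ->
  (elem a b x * g * elem a b (- x))%g \in supported A.
Proof.
move=> ab Aa Ab Abc /supportedP gA; apply/supportedP => i c nA.
rewrite mul_elem // !elem_mul // (gA i c nA) (gA i a) // (gA b a) // (eq_sym b a).
rewrite (negPf ab) mulr0n !mulr0 addr0.
case: (eqVneq c b) => [->|cb]; last first.
  rewrite mul0r addr0; case: (eqVneq i a) => [ia|_]; last by rewrite mul0r addr0.
  rewrite (gA b c) ?mulr0 ?mulr0n; last by apply: contra nA => /Abc; rewrite ia.
  by rewrite (eq_sym b) (negPf cb) mulr0n !mulr0 addr0.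
by rewrite (gA b b) // eqxx; case: (i == a) => /=; ring.
Qed.

Lemma supported_perm A (s : 'S_n.-1.+1) g : (forall i c, A (s i) (s c) -> A i c) ->
  g \in supported A -> (P s * g * (P s)^-1)%g \in supported A.
Proof.
move=> As /supportedP gA; apply/supportedP => i c nA.
rewrite -GLpermV GLmul_perm GLperm_mul invgK gA ?(inj_eq perm_inj) //.
by apply: contra nA => /As.
Qed.

(** Adding the position (a, b) to a pattern amounts to a right multiplication by
    the root group of that position, because column a is trivial. *)
Lemma supported_sum (V : zmodType) A A' a b (f : G -> V) : a != b ->
  (forall i, ~~ A' i a) -> ~~ A a b ->
  (forall i c, A' i c = A i c || ((i == a) && (c == b))) ->
  \sum_(g in supported A') f g =
  \sum_(x : F) \sum_(g in supported A) f (g * elem a b x)%g.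
Proof.
move=> ab A'a nAab AA'.
rewrite (partition_big (fun g => GLmx g a b) xpredT) //=; apply: eq_bigr => x _.
rewrite (reindex_inj (mulIg (elem a b x))) /=; apply: eq_bigl => g.
have gxE i c : GLmx g i a = (i == a)%:R ->
    GLmx (g * elem a b x)%g i c = GLmx g i c + ((c == b) && (i == a))%:R * x.
  by move=> ga; rewrite mul_elem // ga mulrA -natrM mulnb.
apply/andP/supportedP => [[/supportedP gA' /eqP gx] i c nA|gA].
  have ga k : GLmx g k a = (k == a)%:R.
    by rewrite -(gA' k a) // mul_elem // (negPf ab) mul0r addr0.
  case: (boolP ((i == a) && (c == b))) => [/andP[/eqP-> /eqP->]|nic].
    move: gx; rewrite gxE // !eqxx mul1r => /(canRL (addrK _)).
    by rewrite subrr (negPf ab).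
  by rewrite -(gA' i c) ?AA' ?negb_or ?nA // gxE // andbC (negPf nic) mul0r addr0.
have ga k : GLmx g k a = (k == a)%:R.
  by apply: gA; have := A'a k; rewrite AA' negb_or => /andP[].
split; last by rewrite gxE // !eqxx mul1r gA // (negPf ab) add0r.
apply/supportedP => i c; rewrite AA' negb_or => /andP[nA nic].
by rewrite gxE // andbC (negPf nic) mul0r addr0 gA.
Qed.

Lemma elem_comm a b c (x y : F) : a != b -> b != c -> a != c ->
  (elem a b x * elem b c y = elem a c (x * y)%R * elem b c y * elem a b x)%g.
Proof.
move=> ab bc ac; apply: GLmx_ext => i d; rewrite -mulgA !elem_mul // !elemE //.
rewrite (eq_sym c b) (eq_sym c a) (negPf bc) (negPf ac) (eq_sym d b) (eq_sym d c)
  /=.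
rewrite eqxx /= -!mulnb !natrM; ring.
Qed.

End Supports.

Section Descent.
Variables (n : nat) (F : finFieldType) (R : idomainType) (l : nat).
Hypothesis R_char0 : [pchar R] =i pred0.
Local Notation G := (GLn n F).
Local Notation P := (@GLperm n F).
Local Notation U := (unitri n F).
Local Notation U' := (unitri' n F).
Local Notation RG := (grpalg R G).
Local Notation apt := (apartment n F R).
Local Notation St := (Steinberg n F R).
Local Notation q := (#|F|%:R : R).
Local Notation ldvd := (@ldvd R l).
Hypothesis l_prime : prime l.
Hypothesis l_nunit : ~ ldvd 1.
Hypothesis l_max : forall r, ~ ldvd r -> exists s t, s * r + t * l%:R = 1.
Hypothesis l_q : ~~ (l %| #|F|)%N.
Local Notation contains_lSt := (@contains_lSt n F R l).
Local Notation whit := (@whit n F R).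
Local Notation hatp A := (hatsum R (@supported n F A)).
Implicit Types (g h : G) (x y z : RG).

Lemma hat_norm (D : {set G}) h z :
  (forall g, g \in D -> h * g * h^-1 \in D)%g ->
  (forall g, g \in D -> h^-1 * g * h \in D)%g ->
  hatsum R D * translate h z = translate h (hatsum R D * z).
Proof.
move=> Dh DhV; apply/ffunP => y; rewrite translateE !hatsum_mulE.
have inj : injective (fun g => (h * g * h^-1)%g) by move=> g g' /mulIg/mulgI.
rewrite (reindex_inj inj) /=; apply: eq_big => g.
  apply/idP/idP => [/DhV|/Dh//].
  by rewrite !mulgA mulVg mul1g mulgKV.
by move=> _; rewrite translateE !invMg invgK !mulgA mulVg mul1g.
Qed.

(** Summing the indicator functions of the #|F| + 1 lines through 0 of the plane
    counts 0 once too often for each line but one. *)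
Lemma plane_sum (V : zmodType) (H : F -> F -> V) :
  H 0 0 *+ #|F| + \sum_t \sum_s H s t =
  \sum_s H s 0 + \sum_s \sum_t H (s * t) t.
Proof.
rewrite [X in _ = _ + X]exchange_big /=.
rewrite (bigD1 (0 : F)) //= [X in _ = _ + X](bigD1 (0 : F)) //=.
rewrite addrCA; congr (_ + _); congr (_ + _).
  by under eq_bigr => s _ do rewrite mulr0; rewrite sumr_const.
apply: eq_bigr => t t0; rewrite (reindex_inj (mulIf t0)) //.
Qed.

Variable N : RG -> Prop.
Hypothesis sN : left_stable N.
Hypothesis lN : contains_lSt N.

(** Positions strictly above the superdiagonal, in columns after k or in column
    k with row below j. As k and j vary they exhaust the positions of the derived
    group of U one by one. *)
Definition roots_from (k j : nat) : rel 'I_n.-1.+1 :=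
  fun a c => (a.+1 < c)%N && ((k < c) || (c == k :> nat) && (a < j))%N.

(** Let E be the group of the positions already treated, and consider the plane
    spanned by the root groups (a, c) and (b, c) with c = b + 1. All its lines are
    conjugate to the root group (a, c) under elements acting on the rows a and b,
    which normalize E. By plane_sum, q times the E-sum of g x is the sum over the
    lines minus the sum over the plane; if the sums over E and the root group
    (a, c) of all translates of x lie in N, every term does. *)
Lemma descent_step (a b c : 'I_n.-1.+1) x : x \in St ->
  (a < b)%N -> (c = b.+1 :> nat) ->
  (forall g, N (hatp (roots_from c a.+1) * translate g x)) ->
  forall g, N (hatp (roots_from c a) * translate g x).
Proof.
move=> xS lt_ab cb NA g.
have nab : a != b by rewrite -val_eqE ltn_eqF.
have nac : a != c by rewrite -val_eqE /=; lia.
have nbc : b != c by rewrite -val_eqE /=; lia.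
have X_in g' : N (\sum_t hatp (roots_from c a) * translate (elem a c t) (translate
  g' x)).
  have := NA g'; rewrite hatsum_mul (@supported_sum _ _ _ (roots_from c a) _ a c).
  - congr (N _); apply: eq_bigr => t _; rewrite hatsum_mul; apply: eq_bigr => h _.
    by rewrite translateM.
  - by [].
  - by move=> i; rewrite /roots_from; lia.
  - by rewrite /roots_from; lia.
  - by move=> i d; rewrite /roots_from -!val_eqE /=; lia.
have norm_ab t z : hatp (roots_from c a) * translate (elem a b t) z =
    translate (elem a b t) (hatp (roots_from c a) * z).
  have pn s g' : g' \in supported F (roots_from c a) ->
      (elem a b s * g' * elem a b (- s))%g \in supported F (roots_from c a).
    apply: supported_elem => //.
    - by move=> i; rewrite /roots_from; lia.
    - by rewrite /roots_from; lia.
    - by move=> d; rewrite /roots_from; lia.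
  apply: hat_norm => g' g'D; first by rewrite elemV // pn.
  by rewrite elemV // -{2}(opprK t) pn.
have norm_bc t z : hatp (roots_from c a) * translate (elem b c t) z =
    translate (elem b c t) (hatp (roots_from c a) * z).
  have pn s g' : g' \in supported F (roots_from c a) ->
      (elem b c s * g' * elem b c (- s))%g \in supported F (roots_from c a).
    apply: supported_elem => //.
    - by move=> i; rewrite /roots_from; lia.
    - by rewrite /roots_from; lia.
    - by move=> d; rewrite /roots_from; lia.
  apply: hat_norm => g' g'D; first by rewrite elemV // pn.
  by rewrite elemV // -{2}(opprK t) pn.
pose w := P (tperm a b).
have norm_w z : hatp (roots_from c a) * translate w z =
  translate w (hatp (roots_from c a) * z).
  have wV : w^-1%g = w by rewrite -GLpermV tpermV.
  have pn g' : g' \in supported F (roots_from c a) ->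
      (w * g' * w^-1)%g \in supported F (roots_from c a).
    apply: supported_perm => i d; rewrite /roots_from.
    case: (tpermP a b d) => [->|->|_ _]; try lia.
    by case: (tpermP a b i) => [->|->|_ _]; lia.
  by apply: hat_norm => g' g'D; rewrite ?pn // wV -{2}wV pn.
pose H s t := hatp (roots_from c a) * translate (elem a c s * elem b c t)%g
  (translate g x).
have H00 : H 0 0 = hatp (roots_from c a) * translate g x by rewrite /H !elem0 //
  mulg1 translate1.
apply: (left_stable_cancel l_max (r := q)) => //.
- by rewrite Steinberg_mul // Steinberg_translate.
- exact: nldvd_q.
rewrite -H00 rscale_nat -[X in N X](addrK (\sum_t \sum_s H s t)) plane_sum.
apply: left_stableB => //.
  apply: left_stableD => //.
    under eq_bigr => s _ do rewrite /H elem0 // mulg1.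
    exact: X_in.
  apply: left_stable_sum => // s _.
  pose h := (elem a b s * w)%g.
  have hX t : (elem a c (s * t)%R * elem b c t = h * elem a c t * h^-1)%g.
    have wX : (w * elem a c t = elem b c t * w)%g.
      by rewrite /w GLperm_elem // tpermV tpermL tpermD // eq_sym.
    by apply: (mulIg h); rewrite mulgKV /h mulgA -elem_comm // -!mulgA wX.
  have norm_h z : hatp (roots_from c a) * translate h z =
    translate h (hatp (roots_from c a) * z).
    by rewrite /h !(translateM (elem a b s)) norm_ab norm_w.
  have -> : \sum_t H (s * t) t =
      translate h (\sum_t hatp (roots_from c a) * translate (elem a c t) (translate
        (h^-1 * g)%g x)).
    rewrite -geltM mulr_sumr; apply: eq_bigr => t _.
    by rewrite geltM -norm_h /H hX -!translateM !mulgA.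
  by apply: left_stable_translate => //; apply: X_in.
apply: left_stable_sum => // t _.
have -> : \sum_s H s t =
    translate (elem b c t) (\sum_s hatp (roots_from c a) * translate (elem a c s)
      (translate g x)).
  rewrite -geltM mulr_sumr; apply: eq_bigr => s _;
    rewrite geltM -norm_bc /H -!translateM.
  suff -> : (elem b c t * elem a c s = elem a c s * elem b c t)%g by [].
  apply: GLmx_ext => i d; rewrite !elem_mul // !elemE //.
  rewrite !(eq_sym c) (negPf nbc) (negPf nac) /=.
  by rewrite -!mulnb !natrM; ring.
by apply: left_stable_translate => //; apply: X_in.
Qed.


Lemma descent_column (k : 'I_n.-1.+1) j x : x \in St ->
  (forall g, N (hatp (roots_from k j) * translate g x)) -> (j < k)%N ->
  forall g, N (hatp (roots_from k 0) * translate g x).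
Proof.
move=> xS; elim: j => [//|j IH] NA jk; apply: IH (ltnW jk).
have lt_jn : (j < n.-1.+1)%N by have := ltn_ord k; lia.
have lt_bn : (k.-1 < n.-1.+1)%N by have := ltn_ord k; lia.
pose a : 'I_n.-1.+1 := Ordinal lt_jn; pose b : 'I_n.-1.+1 := Ordinal lt_bn.
by apply: (@descent_step a b k) => //=; lia.
Qed.

Lemma roots_from_col k : roots_from k.+1 k =2 roots_from k 0.
Proof. by move=> a c; rewrite /roots_from; lia. Qed.

Lemma hatp_ext (A A' : rel 'I_n.-1.+1) : A =2 A' -> hatp A = hatp A'.
Proof.
move=> AA'; congr (hatsum _ _); apply/setP => g.
by apply/supportedP/supportedP => gA a c; [rewrite -AA' | rewrite AA']; apply: gA.
Qed.

(** A left ideal containing l I that contains the sums over the derived group of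
    U of all translates of x contains x itself: a nonzero quotient of L cannot
    have zero coinvariants under that group. The positions of the group are
    removed one at a time. *)
Lemma descent x : x \in St -> (forall g, N (hatsum R U' * translate g x)) -> N x.
Proof.
move=> xS NU'.
have U'E : hatsum R U' = hatp (roots_from 0 0).
  congr (hatsum _ _); apply/setP => u;
    apply/unitri'P/supportedP => [[uU u0] a c|uA].
    rewrite /roots_from; case: (ltngtP a c) => [lt_ac|lt_ca|/val_inj->] nac.
    - have lt_am : (a < n.-1)%N by have := ltn_ord c; lia.
      rewrite -val_eqE ltn_eqF //.
      have := u0 (Ordinal lt_am); rewrite /sdiag.
      have -> : lo (Ordinal lt_am) = a by apply: val_inj.
      have -> // : hi (Ordinal lt_am) = c.
      by apply: val_inj; rewrite /= /bump /=; lia.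
    - by rewrite unitri0 // -val_eqE gtn_eqF.
    - by rewrite unitri1 // eqxx.
  split=> [|i]; last by rewrite /sdiag uA ?(negPf (lo_hi i)) // /roots_from hiE /=;
    lia.
  apply/unitriP; split=> [a c ca|a]; rewrite uA /roots_from ?eqxx //; try lia.
  by rewrite -val_eqE gtn_eqF.
have base k : (k <= n.-1)%N -> forall g, N (hatp (roots_from k 0) * translate g x).
  elim: k => [|k IH] kn g; first by rewrite -U'E.
  have lt_kn : (k.+1 < n.-1.+1)%N by [].
  apply: (@descent_column (Ordinal lt_kn) k) => //= g'.
  by rewrite (hatp_ext (roots_from_col k)); apply: IH; lia.
have := base _ (leqnn _) 1%g; rewrite translate1.
suff -> : hatp (roots_from n.-1 0) = 1 by rewrite mul1r.
apply/ffunP => g; rewrite hatsumE ffunE; congr (nat_of_bool _)%:R.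
apply/supportedP/eqP => [gA|-> a c _]; last by rewrite GLoneE.
apply: GLmx_ext => a c; rewrite gA ?GLoneE // /roots_from; have := ltn_ord c; lia.
Qed.

(** L is generated by its nondegenerate part; equivalently every nonzero
    quotient of L has nondegenerate characters. *)
Lemma generation : N (whit setT * apt) -> forall x, x \in St -> N x.
Proof.
move=> Nnu x xS; apply: descent => // g.
by apply: (hat'_in R_char0 l_prime l_nunit l_max l_q) => //;
  apply: Steinberg_translate.
Qed.

End Descent.

(** * Irreducible modules, socles and presentations *)

Section CyclicSubmodule.
Variables (A : pzRingType) (V : lmodType A) (v : V).

Definition cyclic_sub : {pred V} := fun w => `[< exists a : A, w = a *: v >].

Lemma cyclic_sub_closed : submod_closed cyclic_sub.
Proof.
split=> [|a x y /asboolP[s ->] /asboolP[t ->]]; apply/asboolP.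
  by exists 0; rewrite scale0r.
by exists (a * s + t); rewrite scalerDl scalerA.
Qed.
HB.instance Definition _ := GRing.isSubmodClosed.Build A V cyclic_sub
  cyclic_sub_closed.

End CyclicSubmodule.

Section ImageSubmodule.
Variables (A : pzRingType) (M V : lmodType A) (h : {linear M -> V}).

Definition image_sub : {pred V} := fun w => `[< exists u, w = h u >].

Lemma image_sub_closed : submod_closed image_sub.
Proof.
split=> [|a x y /asboolP[s ->] /asboolP[t ->]]; apply/asboolP.
  by exists 0; rewrite linear0.
by exists (a *: s + t); rewrite linearP.
Qed.
HB.instance Definition _ := GRing.isSubmodClosed.Build A V image_sub
  image_sub_closed.

End ImageSubmodule.

Section Irreducible.
Variable A : pzRingType.
Implicit Types V M : lmodType A.

Lemma irreducibleP V : irreducible_mod V <->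
  (exists v : V, v != 0) /\ forall v w : V, v != 0 -> exists a : A, w = a *: v.
Proof.
split=> [[V0 Virr]|[V0 Vcyc]]; split=> //.
  move=> v w v0; case: (Virr (cyclic_sub v)) => [W0|/(_ w)/asboolP//].
  by case/eqP: v0; apply: W0; apply/asboolP; exists 1; rewrite scale1r.
move=> W; have [[v vW v0]|nW] := pselect (exists2 v, v \in W & v != 0).
  by right=> w; have [a ->] := Vcyc v w v0; apply: rpredZ.
left=> v vW; apply: contrapT => /eqP v0; apply: nW; by exists v.
Qed.

Lemma irreducible_image M V (h : {linear M -> V}) : injective h ->
  irreducible_mod M -> irreducible_mod (submod (image_sub h)).
Proof.
move=> h_inj /irreducibleP[[m m0] Mcyc].
have im u : h u \in image_sub h by apply/asboolP; exists u.
apply/irreducibleP; split.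
  exists (Submod (im m)); apply: contraNneq m0 =>
    /(congr1 (@submod_val _ _ _)) /= e.
  by apply/eqP/h_inj; rewrite linear0.
move=> [_ /[dup] /asboolP[u ->] vP] [_ /[dup] /asboolP[w ->] wP] v0.
have u0 : u != 0.
  apply: contraNneq v0 => u0; apply/eqP/val_inj; by rewrite /= u0 linear0.
have [a wE] := Mcyc u w u0; exists a.
by apply: val_inj; rewrite /= wE linearZ.
Qed.

Lemma image_socle M V (h : {linear M -> V}) x : injective h ->
  irreducible_mod M -> h x \in socle (V := V).
Proof.
move=> h_inj irrM; apply/asboolP; exists [:: h x]; split; first by rewrite big_seq1.
move=> v; rewrite inE => /eqP->; pose W : submodClosed V := image_sub h; exists W.
by split; [exact: irreducible_image|apply/asboolP; exists x].
Qed.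

Lemma bij_of_surj (M V : Type) (h : M -> V) : injective h ->
  (forall v, exists u, h u = v) -> bijective h.
Proof.
move=> h_inj /choice[g gP]; exists g => // u.
by apply: h_inj; rewrite gP.
Qed.

(** An irreducible socle equals the image of each of the two embeddings. *)
Lemma irreducible_socle_iso M M' V (h : {linear M -> V}) (h' : {linear M' -> V}) :
  injective h -> injective h' -> irreducible_mod M -> irreducible_mod M' ->
  irreducible_mod (submod (socle (V := V))) -> isomorphic_mod M M'.
Proof.
move=> h_inj h'_inj irrM irrM' /irreducibleP[_ Scyc].
have onto M1 (h1 : {linear M1 -> V}) : injective h1 -> irreducible_mod M1 ->
    forall v, v \in socle (V := V) -> exists u, h1 u = v.
  move=> h1_inj irrM1 v vS; have [[m m0] _] := (irreducibleP M1).1 irrM1.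
  have mS := image_socle m h1_inj irrM1.
  have [|a] := Scyc (Submod mS) (Submod vS).
    apply: contraNneq m0 => /(congr1 (@submod_val _ _ _)) /= e.
    by apply/eqP/h1_inj; rewrite linear0.
  move=> /(congr1 (@submod_val _ _ _)) /= ->; exists (a *: m).
  by rewrite linearZ.
have /choice[g gE] u : exists u', h' u' = h u.
  by apply: onto => //; apply: image_socle.
have g_lin : linear g.
  by move=> a u v; apply: h'_inj; rewrite gE !linearP !gE.
pose gl : {linear M -> M'} := HB.pack g (GRing.isLinear.Build _ _ _ _ g g_lin).
exists gl; apply: bij_of_surj => [u v /(congr1 h')|v].
  by rewrite /= !gE => /h_inj.
have [u hu] := onto M h h_inj irrM (h' v) (image_socle v h'_inj irrM').
by exists u; apply: h'_inj; rewrite /= gE.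
Qed.

End Irreducible.

Section Presentation.
Variables (R : idomainType) (gT : finGroupType) (l : nat).
Local Notation RG := (grpalg R gT).
Local Notation KG := (grpalg (residue (l%:R : R)) gT).
Implicit Types (V : lmodType KG) (N : RG -> Prop) (x y a : RG).

Definition semilinear N V (f : RG -> V) :=
  (forall x y, N x -> N y -> f (x + y) = f x + f y) /\
  (forall a x, N x -> f (a * x) = grpalg_red l a *: f x).

(** V is the quotient of the left ideal N of RG by the kernel of f, with scalars
    acting through reduction modulo l. Both irreducibility and embeddings are
    then checked on elements of N. *)
Definition presents N V (f : RG -> V) :=
  [/\ left_stable N, semilinear N f & forall v, exists2 x, N x & f x = v].

Lemma semilinear0 N V (f : RG -> V) : left_stable N -> semilinear N f -> f 0 = 0.
Proof.
move=> [N0 _ _] [fD _]; apply: (addrI (f 0)).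
by rewrite -fD // !addr0.
Qed.

Lemma semilinearB N V (f : RG -> V) x y : left_stable N -> semilinear N f ->
  N x -> N y -> f (x - y) = f x - f y.
Proof.
move=> sN fl Nx Ny; apply: (addIr (f y)); rewrite subrK -fl.1 ?subrK //.
exact: left_stableB.
Qed.

Lemma presents_irreducible N V (f : RG -> V) : presents N f ->
  (exists2 x, N x & f x != 0) ->
  (forall x y, N x -> N y -> f x != 0 -> exists a, f y = f (a * x)) ->
  irreducible_mod V.
Proof.
move=> [sN [fD fM] f_surj] [x0 Nx0 fx0] gen; apply/irreducibleP.
split=> [|v w]; first by exists (f x0).
have [x Nx <-] := f_surj v; have [y Ny <-] := f_surj w => fx.
by have [a ->] := gen x y Nx Ny fx; exists (grpalg_red l a); rewrite fM.
Qed.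

Lemma presents_induced N V V' (f : RG -> V) (f' : RG -> V') :
  presents N f -> semilinear N f' -> (forall x, N x -> f x = 0 <-> f' x = 0) ->
  exists h : {linear V -> V'}, injective h /\ forall x, N x -> h (f x) = f' x.
Proof.
move=> [sN fl f_surj] f'l ker.
have /choice[s sP] v : exists x, N x /\ f x = v.
  by have [x Nx <-] := f_surj v; exists x.
pose g v := f' (s v).
have gf x : N x -> g (f x) = f' x.
  move=> Nx; have [Ns fs] := sP (f x); apply/eqP; rewrite -subr_eq0; apply/eqP.
  rewrite -(semilinearB sN f'l) //; apply/ker; first exact: left_stableB.
  by rewrite (semilinearB sN fl) // fs subrr.
have g_lin : linear g.
  move=> k u v; have [x Nx <-] := f_surj u; have [y Ny <-] := f_surj v.
  rewrite -(grpalg_liftK k) -fl.2 // -fl.1 ?gf //; last exact: left_stableM.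
    by rewrite f'l.1 ?f'l.2 //; apply: left_stableM.
  by apply: left_stableD => //; apply: left_stableM.
pose h : {linear V -> V'} := HB.pack g (GRing.isLinear.Build _ _ _ _ g g_lin).
exists h; split=> // u v; have [x Nx <-] := f_surj u; have [y Ny <-] := f_surj v.
rewrite /= !gf // => f'xy; apply/eqP; rewrite -subr_eq0; apply/eqP.
rewrite -(semilinearB sN fl) //; apply/ker; first exact: left_stableB.
by rewrite (semilinearB sN f'l) // f'xy subrr.
Qed.

End Presentation.

(** * The layers as quotients of left ideals *)

Section ReductionPresentation.
Variables (R : idomainType) (gT : finGroupType) (l : nat).
Local Notation RG := (grpalg R gT).
Variable W : submodClosed RG^o.
Implicit Types x y a : RG.

(** Total: elements outside W are sent to 0. *)
Definition submod_of x : submod W := insubd (0 : submod W) (x : RG^o).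

Lemma submod_ofK x : x \in W -> submod_val (submod_of x) = x.
Proof. by move=> xW; rewrite -[submod_val _]/(val _) insubdK. Qed.

Lemma submod_of_val (w : submod W) : submod_of (submod_val w) = w.
Proof. by apply: val_inj; rewrite /= submod_ofK //; apply: (valP w). Qed.

Lemma submod_ofD x y : x \in W -> y \in W ->
  submod_of (x + y) = submod_of x + submod_of y.
Proof.
move=> xW yW; apply: val_inj.
have xyW : (x + y : RG^o) \in W by apply: rpredD.
by rewrite [LHS]submod_ofK // [RHS]/= /GRing.add /= !submod_ofK.
Qed.


Lemma submod_ofM a x : x \in W -> submod_of (a * x) = a *: submod_of x.
Proof.
move=> xW; apply: val_inj.
have axW : (a * x : RG^o) \in W by apply: (rpredZ (s := W) a xW).
by rewrite [LHS]submod_ofK // [RHS]/= /GRing.scale /= submod_ofK.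
Qed.

Lemma submod_left_stable : left_stable (fun x => x \in W).
Proof.
split=> [|x y xW yW|a x xW]; first exact: (rpred0 W).
  exact: (rpredD (S := W)).
exact: (rpredZ (s := W) a xW).
Qed.

Definition to_reduction x : reduction l (submod W) := reduction_pi l (submod_of x).

Lemma reduction_piD (V : lmodType RG) : {morph @reduction_pi R gT l V : u v / u +
  v}.
Proof. exact: modquot_piD. Qed.

Lemma reduction_piM (V : lmodType RG) a (v : V) :
  reduction_pi l (a *: v) = grpalg_red l a *: reduction_pi l v.
Proof. by rewrite -reduction_scaleE. Qed.

Lemma to_reduction_presents : presents (fun x => x \in W) to_reduction.
Proof.
split; [exact: submod_left_stable|split=> [x y xW yW|a x xW]|].
- by rewrite /to_reduction submod_ofD // reduction_piD.
- by rewrite /to_reduction submod_ofM // reduction_piM.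
move=> v; exists (submod_val (modquot_repr v));
  first exact: (valP (modquot_repr v)).
by rewrite /to_reduction submod_of_val; exact: modquot_reprK.
Qed.

Lemma to_reduction_eq0 x : x \in W ->
  to_reduction x = 0 <-> exists2 y, y \in W & x = rscale l%:R y.
Proof.
have red0 : to_reduction 0 = 0.
  by case: to_reduction_presents => sW fl _; apply: semilinear0 sW fl.
have into0 : submod_of 0 = 0.
  by apply: val_inj; rewrite [LHS]submod_ofK //; apply: (rpred0 W).
move=> xW; split=> [x0|[y yW ->]].
  have /modquot_eqP : to_reduction x = to_reduction 0 by rewrite x0.
  rewrite into0 subr0 => /asboolP[w xw]; exists (submod_val w);
    first exact: (valP w).
  have /(congr1 (@submod_val _ _ _)) := xw; rewrite submod_ofK // => ->.
  by rewrite rscale_nat -[submod_val _]/(val _) raddfMn.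
rewrite -red0; apply/modquot_eqP; rewrite into0 subr0; apply/asboolP.
exists (submod_of y); rewrite rscale_nat.
have -> : y *+ l = (l%:R : RG) * y by rewrite mulr_natl.
by rewrite submod_ofM // scaler_nat.
Qed.

End ReductionPresentation.

Section Layers.
Variables (n : nat) (F : finFieldType) (R : idomainType) (l c : nat).
Local Notation RG := (grpalg R {'GL_n[F]}).
Local Notation St := (steinberg_lattice n F R).
Local Notation Ic := (@latt_filt n F R l c).
Local Notation inIc := (fun x : RG => x \in Ic).
Implicit Types x y a : RG.

Lemma latt_filt_St d x : x \in @latt_filt n F R l d -> x \in St.
Proof. by case/andP. Qed.

Local Notation redI := (to_reduction l St).

Lemma to_reduction_red_filt x : x \in Ic -> redI x \in @red_filt n F R l c.
Proof.
move=> xc; apply/asboolP; exists (submod_of St x), 0.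
by rewrite mul0rn addr0 submod_ofK // (latt_filt_St xc).
Qed.

Definition to_Lmod x : Lmod n F R l c := insubd (0 : Lmod n F R l c) (redI x).

Lemma to_Lmod_val x : x \in Ic -> submod_val (to_Lmod x) = redI x.
Proof. by move=> xc; rewrite -[submod_val _]/(val _) insubdK //
  to_reduction_red_filt. Qed.

Lemma to_Lmod_presents : presents inIc to_Lmod.
Proof.
have [_ [rD rM] r_surj] := to_reduction_presents l St.
split; first exact: submod_left_stable.
  split=> [x y xc yc|a x xc]; apply: val_inj.
    have xyc : x + y \in Ic by apply: (rpredD (S := Ic)).
    by rewrite [LHS]to_Lmod_val // rD ?(latt_filt_St xc) ?(latt_filt_St yc) //=
      !to_Lmod_val.
  have axc : a * x \in Ic by apply: (rpredZ (s := Ic) a xc).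
  by rewrite [LHS]to_Lmod_val // rM ?(latt_filt_St xc) //= to_Lmod_val.
move=> [u /[dup] /asboolP[x [y [xc uE]]] uP]; exists (submod_val x) => //.
apply: val_inj; rewrite [LHS]to_Lmod_val //= uE /to_reduction submod_of_val;
  apply/modquot_eqP.
rewrite opprD addNKr; apply/asboolP; exists (- y).
by rewrite mulNrn.
Qed.

Lemma to_Lmod_eq0 x : x \in Ic ->
  to_Lmod x = 0 <-> exists2 y, y \in St & x = rscale l%:R y.
Proof.
move=> xc; rewrite -to_reduction_eq0 ?(latt_filt_St xc) //; split=> [x0|x0].
  by rewrite -to_Lmod_val // x0.
by apply: val_inj; rewrite [LHS]to_Lmod_val.
Qed.

Definition to_Mmod x : Mmod n F R l c := modquot_pi (@red_filt_next n F R l c)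
  (to_Lmod x).

Lemma to_Mmod_presents : presents inIc to_Mmod.
Proof.
have [sI [LD LM] L_surj] := to_Lmod_presents.
split=> //; first split=> [x y xc yc|a x xc].
- by rewrite /to_Mmod LD // modquot_piD.
- by rewrite /to_Mmod LM //; symmetry; apply: modquot_scaleE.
move=> v; have [x xc xE] := L_surj (modquot_repr v); exists x => //.
by rewrite /to_Mmod xE; exact: modquot_reprK.
Qed.

Lemma to_Mmod_eq0 x : x \in Ic -> to_Mmod x = 0 <->
  exists y z, [/\ y \in @latt_filt n F R l c.+1, z \in St & x = y + rscale l%:R z].
Proof.
move=> xc; have [_ [rD rM] _] := to_reduction_presents l St.
have L0 : to_Lmod 0 = 0.
  by have [sI fl _] := to_Lmod_presents; apply: semilinear0 sI fl.
have M0 : to_Mmod 0 = 0.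
  by have [sI fl _] := to_Mmod_presents; apply: semilinear0 sI fl.
have xS := latt_filt_St xc.
have next : to_Mmod x = 0 <-> redI x \in @red_filt n F R l c.+1.
  rewrite -M0 -to_Lmod_val //; split=> [/modquot_eqP|xn]; first by rewrite L0 subr0.
  by apply/modquot_eqP; rewrite L0 subr0.
apply: (iff_trans next); split=> [/asboolP[y [z [yc /modquot_eqP/asboolP[w xE]]]]|].
  exists (submod_val y), (submod_val (z + w)); split=> //;
    first exact: (valP (z + w)).
  move: xE => /(canRL (subrK _))/(congr1 (@submod_val _ _ _));
    rewrite submod_ofK // => ->.
  rewrite addrC -addrA -mulrnDl rscale_nat.
  by rewrite -[submod_val _]/(val _) raddfD raddfMn.
move=> [y [z [yc zS xE]]]; apply/asboolP; exists (submod_of St y), (submod_of St z).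
have yS := latt_filt_St yc; rewrite submod_ofK //; split=> //.
rewrite /to_reduction xE submod_ofD //; last by rewrite rscale_mul;
  apply: (rpredZ (s := St) _ zS).
congr (reduction_pi _ (_ + _)); rewrite rscale_nat.
have -> : z *+ l = (l%:R : RG) * z by rewrite mulr_natl.
by rewrite submod_ofM // scaler_nat.
Qed.

End Layers.

(** * The head and the socle of the reduced lattice *)

Section Cosocle.
Variables (n : nat) (F : finFieldType) (R : idomainType) (l : nat).
Hypothesis R_char0 : [pchar R] =i pred0.
Local Notation G := (GLn n F).
Local Notation GLmx := (@GLmx n F).
Local Notation P := (@GLperm n F).
Local Notation B := (GLborel n F).
Local Notation U := (unitri n F).
Local Notation RG := (grpalg R G).
Local Notation apt := (apartment n F R).
Local Notation St := (Steinberg n F R).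
Local Notation ldvd := (@ldvd R l).
Hypothesis l_prime : prime l.
Hypothesis l_nunit : ~ ldvd 1.
Hypothesis l_max : forall r, ~ ldvd r -> exists s t, s * r + t * l%:R = 1.
Hypothesis l_q : ~~ (l %| #|F|)%N.
Local Notation contains_lSt := (@contains_lSt n F R l).
Local Notation lmultiple := (@lmultiple n F R l).
Local Notation whit := (@whit n F R).
Local Notation jantzen := (@jantzen n F R l).
Implicit Types (g h u v : G) (x y z a : RG) (D N : RG -> Prop).

Lemma lmultiple_left_stable : left_stable lmultiple.
Proof.
apply: left_stable_translates => [|x y [x' xS ->] [y' yS ->]|r x [x' xS ->]|g x [x'
  xS ->]].
- by exists 0; [exact: Steinberg0|apply/ffunP => g;
  rewrite rscaleE grpalg_zeroE mulr0].
- by exists (x' + y'); [exact: SteinbergD|rewrite rscaleDr].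
- by exists (rscale r x'); [exact: Steinberg_rscale|rewrite !rscaleA mulrC].
- by exists (translate g x'); [exact: Steinberg_translate|rewrite rscale_translate].
Qed.

Lemma lmultiple_contains_lSt : contains_lSt lmultiple.
Proof. by move=> x xS; exists x. Qed.

Lemma span_left_stable D x : left_stable D -> left_stable (fun y =>
  exists a, D (y - a * x)).
Proof.
move=> sD; split=> [|y z [a ya] [b zb]|a y [b yb]].
- by exists 0; rewrite mul0r subr0; case: sD.
- by exists (a + b); rewrite mulrDl opprD addrACA; apply: left_stableD.
- by exists (a * b); rewrite -mulrA -mulrBr; apply: left_stableM.
Qed.

Lemma span_sub D x y : D y -> exists a, D (y - a * x).
Proof. by exists 0; rewrite mul0r subr0. Qed.

Lemma span_self D x : left_stable D -> exists a, D (x - a * x).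
Proof. by case=> D0 _ _; exists 1; rewrite mul1r subrr. Qed.

Lemma Ufix_nlmultiple : ~ lmultiple (Ufix n F R).
Proof.
move=> /(@lmultiple_ldvd _ _ _ _ _ 1%g); rewrite Ufix1; apply: nldvd_nat => //.
exact: prime_unitri.
Qed.

Lemma whit_adjoint S x y : sform (whit S * x) y = sform x (whit S * y).
Proof.
have nuE z : whit S * z = \sum_(u in U) rscale (whit_coef R S u) (translate u z).
  apply/ffunP => g; rewrite whit_mulE grpalg_sumE; apply: eq_bigr => u _.
  by rewrite rscaleE translateE.
rewrite !nuE sform_suml sform_sumr (reindex_inj invg_inj) /=.
apply: eq_big => u; first by rewrite groupV.
rewrite groupV => uU; rewrite sform_rs sform_rsr whit_coefV //.
by rewrite sform_tr invgK.
Qed.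

(** Let v be unitriangular with all superdiagonal entries 1. The apartments of
    eps and of v eps have the single chamber B in common, so that their pairing
    is 1 after division by the order of B. *)
Lemma apartment_njantzen1 : ~ jantzen 1 apt.
Proof.
have [v vU v1] := @sdiag_surj n F (fun=> 1).
case=> _ /(_ _ (Steinberg_translate v (Steinberg_apartment n F R)))[r].
rewrite sform_apartment ?Steinberg_translate ?Steinberg_apartment // =>
  /(mulfI (B_neq0 _ _ R_char0)) vE.
apply: l_nunit; exists r; rewrite mulrC -[l%:R]expr1 -vE.
rewrite (bigD1 1%g) //= odd_perm1 expr0 mul1r GLperm1 translateE mulg1.
rewrite apartment_borel ?groupV ?unitri_borel // big1 ?addr0 // => s s1.
rewrite translateE apartment_ev big1 ?mulr0 // => t _.
case: (boolP (_ \in B)) => [/borelP vB|_]; last by rewrite mulr0.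
have vE' (i j : 'I_n.-1.+1) : (j < i)%N -> GLmx v^-1%g (t^-1%g i) (s^-1%g j) = 0.
  by move=> /vB; rewrite mulgA GLmul_perm -GLpermV GLperm_mul.
have vVU : v^-1%g \in U by rewrite groupV.
have ts : t = s.
  apply: perm_le => k; rewrite leqNgt; apply/negP => /vE'.
  by rewrite !permK unitri1 // => /eqP; rewrite oner_eq0.
case/eqP: s1; apply: (mulIg (@long n.-1)); rewrite mul1g.
apply: descending_long => i; rewrite !permM !longE.
have le_lo : (s (lo i) <= s (hi i))%N.
  rewrite leqNgt; apply/negP => /vE'; rewrite ts !permK => /eqP.
  have vi : @sdiag n F i v^-1%g = -1 by rewrite sdiagV // v1.
  by rewrite -/(@sdiag n F i v^-1%g) vi oppr_eq0 oner_eq0.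
have lt_lo : (s (lo i) < s (hi i))%N.
  by rewrite ltn_neqAle le_lo andbT val_eqE (inj_eq perm_inj) lo_hi.
by apply: ltn_sub2l => //; apply: leq_trans lt_lo _; rewrite -ltnS.
Qed.

Lemma whit_njantzen1 : ~ jantzen 1 (whit setT * apt).
Proof.
move=> fnu; apply: apartment_njantzen1.
apply: (generation R_char0 l_prime l_nunit l_max l_q _ _ fnu) => //.
- exact: jantzen_left_stable.
- exact: jantzen1_contains_lSt.
- exact: Steinberg_apartment.
Qed.

(** The first step of the filtration has no nondegenerate characters modulo l:
    otherwise it would contain whit setT * eps, hence the whole lattice. *)
Lemma whit_jantzen1 x : jantzen 1 x -> lmultiple (whit setT * x).
Proof.
move=> fx; apply: contrapT => nm; apply: whit_njantzen1.
apply: (whit_in R_char0 l_nunit l_max _ _ _ fx nm).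
- exact: jantzen_left_stable.
- exact: jantzen1_contains_lSt.
- by case: fx.
Qed.

(** The head of L is irreducible. If some translate of x has a nondegenerate
    projection that is nonzero modulo l, the left ideal generated by x contains
    whit setT * eps and so everything. Otherwise x is orthogonal modulo l to
    whit setT * eps and its translates, because the projection is self-adjoint;
    these generate, so x lies in I(1). *)
Lemma head_cyclic x y : x \in St -> ~ jantzen 1 x -> y \in St ->
  exists a, jantzen 1 (y - a * x).
Proof.
move=> xS nfx yS; pose N z := exists a, jantzen 1 (z - a * x).
have sN : left_stable N by apply/span_left_stable/jantzen_left_stable.
have lN : contains_lSt N by move=> z zS; apply/span_sub/jantzen1_contains_lSt.
apply: (generation R_char0 l_prime l_nunit l_max l_q sN lN) => //.
have [[g ng]|allg] := pselect (exists g, ~ lmultiple (whit setT * translate g x)).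
  apply: (whit_in R_char0 l_nunit l_max sN lN (Steinberg_translate g xS) _ ng).
  by apply: left_stable_translate => //; apply/span_self/jantzen_left_stable.
(* The elements that are orthogonal to x modulo l together with their translates. *)
pose N' z := z \in St /\ forall a, exists r, sform x (a * z) = #|B|%:R * (l%:R * r).
have sN' : left_stable N'.
  split=> [|z w [zS zP] [wS wP]|b z [zS zP]].
  - split=> [|a]; first exact: Steinberg0.
    by exists 0; rewrite mulr0 sformC sform0l !mulr0.
  - split=> [|a]; first exact: SteinbergD.
    have [r rE] := zP a; have [s sE] := wP a; exists (r + s).
    by rewrite mulrDr sformDr rE sE !mulrDr.
  - split=> [|a]; first exact: Steinberg_mul.
    by rewrite mulrA; apply: zP.
have lN' : contains_lSt N'.
  move=> z zS; split=> [|a]; first exact: Steinberg_rscale.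
  have [_ /(_ _ (Steinberg_mul a zS))[r rE]] := jantzen0 l R_char0 xS.
  by exists r; rewrite -rscale_mulr sform_rsr rE expr0 mul1r mulrCA.
case: nfx; split=> // z zS.
have [] : N' z.
  apply: (generation R_char0 l_prime l_nunit l_max l_q sN' lN') => //.
  split=> [|a]; first by rewrite Steinberg_mul // Steinberg_apartment.
  have /choice[f fP] g : exists r, sform x (translate g (whit setT * apt)) =
    #|B|%:R * (l%:R * r).
    have [w wS wE] : lmultiple (whit setT * translate g^-1%g x).
      by apply: contrapT => nm; apply: allg; exists g^-1%g.
    have [_ /(_ _ (Steinberg_apartment n F R))[r rE]] := jantzen0 l R_char0 wS.
    exists r; rewrite -[g]invgK -sform_tr -whit_adjoint wE sform_rs rE.
    by rewrite expr0 mul1r mulrCA.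
  exists (\sum_g a g * f g); rewrite grpalg_mul_translates sform_sumr !mulr_sumr.
  apply: eq_bigr => g _; rewrite sform_rsr fP mulrCA; congr (_ * _).
  by rewrite mulrCA.
by move=> _ /(_ 1)[r]; rewrite mul1r => ->; exists r; rewrite expr1.
Qed.

Let b := logn l #|[set: G] : B|%g.

(** I(b) is generated modulo l I by Ufix, and Ufix lies in every submodule that
    is nonzero modulo l. *)
Lemma socle_cyclic x y : jantzen b x -> ~ lmultiple x -> jantzen b y ->
  exists a, lmultiple (y - a * x).
Proof.
move=> [xS _] nx fy; pose N z := exists a, lmultiple (z - a * x).
have sN : left_stable N by apply/span_left_stable/lmultiple_left_stable.
have lN : contains_lSt N by move=> z zS; apply/span_sub/lmultiple_contains_lSt.
have [a [z [zS ->]]] := jantzen_top R_char0 l_prime l_nunit l_max fy.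
apply: (left_stableD sN); last exact: lN.
apply: left_stableM => //; apply: (Ufix_in R_char0 l_max sN lN xS _ nx).
exact/span_self/lmultiple_left_stable.
Qed.

Lemma jantzen_lX_shift k d x : x \in St ->
  jantzen (k + d) (rscale (l%:R ^+ k) x) <-> jantzen d x.
Proof.
move=> xS; elim: k => [|k IH]; first by rewrite expr0 rscale1.
rewrite exprS -rscaleA addSn; apply: iff_trans IH.
by apply: jantzen_l => //; apply: Steinberg_rscale.
Qed.

(** I(b) meets l I in l I(b - 1). *)
Lemma lmultiple_jantzen c x : (c < b)%N -> jantzen b x -> lmultiple x ->
  exists2 y, jantzen c y & x = rscale l%:R y.
Proof.
move=> cb fx [y yS xE]; exists y => //; rewrite {}xE in fx.
case: (b) cb fx => // b' cb /(jantzen_l R_char0 l_prime _ yS).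
exact: jantzenW.
Qed.

Lemma jantzen1_lX c x : (0 < c)%N -> x \in St ->
  jantzen 1 x <-> exists2 y, jantzen c y & rscale (l%:R ^+ c) x = rscale l%:R y.
Proof.
case: c => // c _ xS; rewrite exprS -rscaleA; split=> [fx|[y fy xy]].
  exists (rscale (l%:R ^+ c) x) => //; rewrite -addn1.
  exact/jantzen_lX_shift.
apply/(jantzen_lX_shift c _ xS); rewrite addn1.
suff -> : rscale (l%:R ^+ c) x = y by [].
apply/ffunP => g; apply: (mulfI (l_neq0 R_char0 l_prime)).
by rewrite -!(rscaleE _ _ g) xy rscaleE.
Qed.


End Cosocle.

Transparent GLn GLmx GLborel GLperm GL_of_mx unitri Steinberg.

(** * The theorem *)

Lemma prime_card_finField (F : finFieldType) p l : p \in [pchar F] ->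
  prime l -> l != p -> ~~ (l %| #|F|)%N.
Proof.
move=> Fp lp l_p; apply/negP => lF.
have /and3P[pF _ _] := fin_ring_pchar_abelem Fp.
have := pgroupP pF l lp; rewrite cardsT => /(_ lF).
by rewrite inE (negPf l_p).
Qed.

Section IdealSum.
Variables (R : comPzRingType) (r t : R).

Definition ideal_sum : {pred R^o} :=
  fun x => `[< exists a b : R, a * r + b * t = x >].

Lemma ideal_sum_closed : submod_closed ideal_sum.
Proof.
split=> [|k x y /asboolP[a [b <-]] /asboolP[a' [b' <-]]]; apply/asboolP.
  by exists 0, 0; rewrite !mul0r addr0.
exists (k * a + a'), (k * b + b'); rewrite !mulrDl -!mulrA addrACA -mulrDr.
by [].
Qed.
HB.instance Definition _ :=
  GRing.isSubmodClosed.Build R R^o ideal_sum ideal_sum_closed.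

End IdealSum.

Lemma local_residue (R : idomainType) (l : nat) :
  local_with_maximal_ideal (lideal (l%:R : R)) ->
  ~ @ldvd R l 1 /\
  forall r, ~ @ldvd R l r -> exists s t, s * r + t * l%:R = 1.
Proof.
move=> /(_ (lideal (l%:R : R))) [_ /(_ (fun=> erefl))[n1 max]].
split=> [l1|r nr]; first by case/negP: n1; apply/asboolP.
have [|eqJ|/(_ 1)/asboolP//] := max (ideal_sum r (l%:R : R)).
  move=> x /asboolP[a ->]; apply/asboolP; exists 0, a.
  by rewrite mul0r add0r.
case: nr; have : (r : R^o) \in ideal_sum r (l%:R : R).
  by apply/asboolP; exists 1, 0; rewrite mul1r mul0r addr0.
by rewrite eqJ => /asboolP.
Qed.

Lemma latt_filtP (n : nat) (F : finFieldType) (R : idomainType) (l c : nat)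
    (x : grpalg R {'GL_n[F]}) : [pchar R] =i pred0 ->
  (x \in @latt_filt n F R l c) <-> @jantzen n F R l c x.
Proof.
move=> R0; have natE k : k%:R = FracField.tofrac (k%:R : R) by rewrite tofracMn
  tofrac1.
have B0 : #|borel n F|%:R != 0 :> {fraction R}.
  by rewrite natE tofrac_eq0 (natrR_eq0 R0) -lt0n cardG_gt0.
have key (y : grpalg R {'GL_n[F]}) (r : R) : (Defs.form x y =
  FracField.tofrac (l%:R ^+ c * r)) <->
    sform x y = #|borel n F|%:R * (l%:R ^+ c * r).
  rewrite /Defs.form; split=> [/(canRL (divfK B0))|e].
    by rewrite natE -tofracM mulrC => /eqP; rewrite tofrac_eq => /eqP.
  by apply: (canLR (mulfK B0)); rewrite natE -tofracM mulrC -e.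
split=> [/andP[xS /asboolP xP]|[xS xP]].
  by split=> // y /xP[r /key]; exists r.
by apply/andP; split=> //; apply/asboolP => y /xP[r /key]; exists r.
Qed.

Theorem proposition7p4
    (n : nat) (n_ge2 : (2 <= n)%N)
    (F : finFieldType) (p : nat) (charF : p \in [pchar F])
    (l : nat) (l_prime : prime l) (l_neq_p : l != p)
    (R : idomainType) (R_pid : is_pid R) (R_char0 : [pchar R] =i pred0)
    (R_local : local_with_maximal_ideal (lideal (l%:R : R)))
    (R_root : exists z : R, p.-primitive_root z) :
  let b := logn l #|'GL_n[F] : borel n F|%g in
  forall c : nat, (0 < c < b)%N ->
  [/\ irreducible_mod (Mmod n F R l b),
      isomorphic_mod (Mmod n F R l b) (Lmod n F R l b),
      irreducible_mod (Mmod n F R l 0) &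
      ~ isomorphic_mod (Mmod n F R l b) (Mmod n F R l 0)] /\
  [/\ contains_copy (Mmod n F R l b) (socle (V := Tmod n F R l c)),
      contains_copy (Mmod n F R l 0) (socle (V := Tmod n F R l c)) &
      ~ irreducible_mod (submod (socle (V := Tmod n F R l c)))].
Proof.
move=> b c /andP[c_gt0 c_lt_b].
have [l_nunit l_max] := local_residue R_local.
have l_q := prime_card_finField charF l_prime l_neq_p.
pose RG := grpalg R {'GL_n[F]}.
pose St := steinberg_lattice n F R.
have filtP d (x : RG) : (x \in @latt_filt n F R l d) <-> @jantzen n F R l d x.
  exact: latt_filtP.
have filtSt d (x : RG) : @jantzen n F R l d x -> x \in St by case.
have filt0P (x : RG) : x \in St -> x \in @latt_filt n F R l 0.
  by move=> xS; apply/filtP/jantzen0.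
have c_le_b := ltnW c_lt_b; have b_gt0 := leq_ltn_trans (leq0n c) c_lt_b.
have top_eq0 (x : RG) : x \in @latt_filt n F R l b ->
    @to_Mmod n F R l b x = 0 <-> @lmultiple n F R l x.
  move=> xb; apply: (iff_trans (to_Mmod_eq0 xb)).
  split=> [[y [z [/filtP yb zS ->]]]|[z zS ->]].
    apply: left_stableD; [exact: lmultiple_left_stable| |exact:
      lmultiple_contains_lSt].
    exact: (jantzen_above R_char0 l_prime l_nunit l_max yb).
  exists 0, z; split=> //; first exact: (rpred0 (@latt_filt n F R l b.+1)).
  by rewrite add0r.
have head_eq0 (x : RG) : x \in @latt_filt n F R l 0 ->
    @to_Mmod n F R l 0 x = 0 <-> @jantzen n F R l 1 x.
  move=> x0; apply: (iff_trans (to_Mmod_eq0 x0)).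
  split=> [[y [z [/filtP y1 zS ->]]]|x1].
    by apply: left_stableD => //; [exact: jantzen_left_stable|apply:
      jantzen1_contains_lSt].
  exists x, 0; split; [exact/filtP|exact: (rpred0 St)|].
  by apply/ffunP => g; rewrite grpalg_addE rscaleE grpalg_zeroE mulr0 addr0.
have presb := to_Mmod_presents n F R l b; have [sb fb sjb] := presb.
have pres0 := to_Mmod_presents n F R l 0; have [s0 f0 sj0] := pres0.
have Ufix_b : (Ufix n F R : RG) \in @latt_filt n F R l b.
  exact/filtP/jantzen_Ufix.
have eps_0 : (apartment n F R : RG) \in @latt_filt n F R l 0.
  exact/filt0P/Steinberg_apartment.
have irrb : irreducible_mod (Mmod n F R l b).
  apply: (presents_irreducible presb).
    exists (Ufix n F R) => //; apply/eqP => /(top_eq0 _ Ufix_b).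
    exact: Ufix_nlmultiple.
  move=> x y xb yb x0.
  have nx : ~ @lmultiple n F R l x by move=> /(top_eq0 _ xb) x0';
    rewrite x0' eqxx in x0.
  have [a xy] := socle_cyclic R_char0 l_prime l_nunit l_max
    ((filtP _ _).1 xb) nx ((filtP _ _).1 yb).
  have axb : a * x \in @latt_filt n F R l b by apply: (left_stableM a sb).
  exists a; apply/eqP; rewrite -subr_eq0 -(semilinearB sb fb) //; apply/eqP.
  by apply/(top_eq0 _ (left_stableB sb yb axb)).
have irr0 : irreducible_mod (Mmod n F R l 0).
  apply: (presents_irreducible pres0).
    exists (apartment n F R) => //; apply/eqP => /(head_eq0 _ eps_0).
    exact: apartment_njantzen1.
  move=> x y x0 y0 nx0.
  have nx : ~ @jantzen n F R l 1 x by move=> /(head_eq0 _ x0) x0';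
    rewrite x0' eqxx in nx0.
  have [a xy] := head_cyclic R_char0 l_prime l_nunit l_max l_q
    (latt_filt_St x0) nx (latt_filt_St y0).
  have ax0 : a * x \in @latt_filt n F R l 0 by apply: (left_stableM a s0).
  exists a; apply/eqP; rewrite -subr_eq0 -(semilinearB s0 f0) //; apply/eqP.
  by apply/(head_eq0 _ (left_stableB s0 y0 ax0)).
have not_iso : ~ isomorphic_mod (Mmod n F R l b) (Mmod n F R l 0).
  move=> [h [h' _ hK]]; pose e := @whit n F R setT : RG.
  have ee0 : e * (apartment n F R : RG) \in @latt_filt n F R l 0 by apply:
    (left_stableM e s0).
  apply: (whit_njantzen1 R_char0 l_prime l_nunit l_max l_q); apply/(head_eq0 _ ee0).
  rewrite f0.2 // -(hK (to_Mmod l 0 _)) -linearZ.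
  have [x xb <-] := sjb (h' (to_Mmod l 0 (apartment n F R))).
  rewrite -fb.2 //; have exb : e * x \in @latt_filt n F R l b by apply:
    (left_stableM e sb).
  suff -> : to_Mmod l b (e * x) = 0 by rewrite linear0.
  apply/(top_eq0 _ exb); apply: (whit_jantzen1 R_char0 l_prime l_nunit l_max l_q).
  by apply: jantzenW b_gt0 _; apply/filtP.
have [hL [hL_inj hLE]] : exists h : {linear Mmod n F R l b -> Lmod n F R l b},
    injective h /\ forall x : RG, x \in @latt_filt n F R l b ->
      h (to_Mmod l b x) = to_Lmod l b x.
  apply: (presents_induced presb); first by have [] := to_Lmod_presents n F R l b.
  by move=> x xb; exact: iff_trans (top_eq0 _ xb) (iff_sym (to_Lmod_eq0 xb)).
have [sc fc _] := to_reduction_presents l (@latt_filt n F R l c).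
have subc (x : RG) : x \in @latt_filt n F R l b -> x \in @latt_filt n F R l c.
  by move=> /filtP xb; apply/filtP/(jantzenW c_le_b).
have powc (x : RG) : x \in @latt_filt n F R l 0 ->
    rscale (l%:R ^+ c) x \in @latt_filt n F R l c.
  by move=> x0; apply/filtP/jantzen_lX => //; apply: latt_filt_St x0.
(* The map induced by the inclusion of I(b) in I(c). *)
have [hb [hb_inj _]] : exists h : {linear Mmod n F R l b -> Tmod n F R l c},
    injective h /\ forall x : RG, x \in @latt_filt n F R l b ->
      h (to_Mmod l b x) = to_reduction l (@latt_filt n F R l c) x.
  apply: (presents_induced presb).
    split=> [x y xb yb|a x xb]; first by rewrite fc.1 ?subc.
    by rewrite fc.2 ?subc.
  move=> x xb; apply: iff_trans (top_eq0 _ xb) _.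
  apply: iff_trans _ (iff_sym (to_reduction_eq0 l (subc _ xb))).
  split=> [xl|[y /latt_filt_St yS ->]]; last by exists y.
  have [y yc ->] := lmultiple_jantzen R_char0 l_prime c_lt_b ((filtP _ _).1 xb) xl.
  by exists y => //; apply/filtP.
(* The map induced by multiplication by l ^ c. *)
have [h0 [h0_inj _]] : exists h : {linear Mmod n F R l 0 -> Tmod n F R l c},
    injective h /\ forall x : RG, x \in @latt_filt n F R l 0 ->
      h (to_Mmod l 0 x) = to_reduction l (@latt_filt n F R l c) (rscale (l%:R ^+ c)
        x).
  apply: (presents_induced pres0).
    split=> [x y x0 y0|a x x0]; first by rewrite rscaleDr fc.1 ?powc.
    by rewrite rscale_mulr fc.2 ?powc.
  move=> x x0; apply: iff_trans (head_eq0 _ x0) _.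
  apply: iff_trans _ (iff_sym (to_reduction_eq0 l (powc _ x0))).
  apply: iff_trans (jantzen1_lX R_char0 l_prime c_gt0 (latt_filt_St x0)) _.
  by split=> -[y yc ->]; exists y => //; apply/filtP.
split; split=> //.
- exists hL; apply: bij_of_surj => // v;
  have [_ _ sL] := to_Lmod_presents n F R l b.
  by have [x xb <-] := sL v; exists (to_Mmod l b x); apply: hLE.
- by exists hb; split=> // x; apply: image_socle.
- by exists h0; split=> // x; apply: image_socle.
- by move=> irrS; apply: not_iso; apply: (irreducible_socle_iso hb_inj h0_inj).
Qed.
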